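(* Let $M\ge 2$, let $S=\{i_1,\ldots,i_M\}\subset\mathbb{R}$ with $i_1<\cdots<i_M$, and let $\underline p=(p_1,\ldots,p_M)$ be a probability mass function over $S$ with $\min_j p_j>0$ and $e_0=\sum_{j=1}^M i_jp_j$. For any integer $r\ge1$ and any real $t>0$, let $\tau$ be a random time with probability density function $$f_\tau(x)=\frac{1}{\Gamma(r)}\Big(\frac rt\Big)^rx^{r-1}e^{-rx/t},\qquad x\ge0 .$$ Then there exists a CMRW process $X$ on $S$ (see context), independent of $\tau$, such that $$\mathbb{P}(X_\tau=i_j\mid X_0=e_0)=p_j,\qquad j=1,\ldots,M.$$
   Context: CMRW (continuous time Markov martingale random walk on the finite state space $S=\{i_1<\cdots<i_M\}$): a martingale that is a time homogeneous continuous time Markov chain for which there exists $\underline\lambda=(\lambda_1,\ldots,\lambda_M)\in\{0\}\times\mathbb{R}_+^{M-2}\times\{0\}$ such that: (1) $\mathbb{P}(X_{s+u}=i_j\ \forall\,0\le u\le v\mid X_s=i_j)=e^{-\lambda_jv}$ for all $v\ge0$, $j=1,\ldots,M$; (2) for $j=2,\ldots,M-1$, $\lim_{h\to0}\frac1h\mathbb{P}(X_{s+h}=i_{j+1}\mid X_s=i_j)=\frac{i_j-i_{j-1}}{i_{j+1}-i_{j-1}}\lambda_j$ and $\lim_{h\to0}\frac1h\mathbb{P}(X_{s+h}=i_{j-1}\mid X_s=i_j)=\frac{i_{j+1}-i_j}{i_{j+1}-i_{j-1}}\lambda_j$; (3) if the initial value $y$ lies in $(i_{j-1},i_j)$, the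 process immediately jumps at time $0$: $\mathbb{P}(X_{0+}=i_j\mid X_0=y)=\frac{y-i_{j-1}}{i_j-i_{j-1}}$, $\mathbb{P}(X_{0+}=i_{j-1}\mid X_0=y)=\frac{i_j-y}{i_j-i_{j-1}}$. *)

(* Defs.v *)
From HB Require Import structures.
From mathcomp Require Import all_boot all_order all_algebra.
From mathcomp Require Import all_classical all_reals all_analysis.
Import Order.TTheory GRing.Theory Num.Theory.
Import numFieldNormedType.Exports.

Set Implicit Arguments.
Unset Strict Implicit.
Unset Printing Implicit Defensive.

Local Open Scope classical_set_scope.
Local Open Scope ring_scope.

Section gamma_density.
Context {R : realType}.

Definition Gamma (a : R) : R :=
  \int[@lebesgue_measure R]_(x in `]0, +oo[) (x `^ (a - 1) * expR (- x)).

Definition gamma_time_pdf (r : nat) (t x : R) : R :=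
  if 0 <= x then
    (Gamma r%:R)^-1 * (r%:R / t) ^+ r * x ^+ r.-1 * expR (- (r%:R * x / t))
  else 0.

Definition has_density d (T : measurableType d) (P : probability T R)
    (Y : T -> R) (f : R -> R) : Prop :=
  forall B : set R, measurable B ->
    P (Y @^-1` B) = (\int[lebesgue_measure]_(x in B) (f x)%:E)%E.

End gamma_density.

(* Throughout, a process is a function X : R -> T -> R of which only the      *)
(* times t >= 0 are ever considered.                                          *)
Section processes.
Context {R : realType} {d : measure_display} {T : measurableType d}.
Implicit Types (P : probability T R) (X : R -> T -> R) (A B : set T).

(* Junk value 0 when P B = 0: all uses are guarded by 0 < P B. *)
Definition cprob P A B : R := fine (P (A `&` B)) / fine (P B).

Definition natural_filtration X (s : R) : set (set T) :=
  <<s [set A | exists2 u : R, 0 <= u <= s &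
       exists2 B : set R, measurable B & A = X u @^-1` B] >>.

Definition process_sigma_algebra X : set (set T) :=
  <<s [set A | exists2 u : R, 0 <= u &
       exists2 B : set R, measurable B & A = X u @^-1` B] >>.

Definition independent_process_time P X (tau : T -> R) : Prop :=
  forall (A : set T) (B : set R), process_sigma_algebra X A -> measurable B ->
    P (A `&` tau @^-1` B) = (P A * P (tau @^-1` B))%E.

Definition at_state X (t x : R) : set T := [set w | X t w = x].

(* {X_{s+u} = x for all 0 <= u <= v} *)
Definition stays_at X (s v x : R) : set T :=
  [set w | forall u : R, 0 <= u <= v -> X (s + u) w = x].

(* {X_{0+} = x} *)
Definition jumps_at_0_to X (x : R) : set T :=
  [set w | X u w @[u --> 0^'+] --> x].

(* E[X_t | F_s] = X_s, through the defining identity of the conditional       *)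
(* expectation with respect to the natural filtration.                        *)
Definition martingale P X : Prop :=
  (forall t : R, 0 <= t -> P.-integrable setT (EFin \o X t)) /\
  (forall (s t : R) (A : set T), 0 <= s -> s <= t -> natural_filtration X s A ->
    (\int[P]_(w in A) (X t w)%:E = \int[P]_(w in A) (X s w)%:E)%E).

Definition markov P X : Prop :=
  forall (s h x y : R) (A : set T), 0 <= s -> 0 <= h ->
    natural_filtration X s A -> (0 < P (A `&` at_state X s x))%E ->
    cprob P (at_state X (s + h) y) (A `&` at_state X s x) =
    cprob P (at_state X (s + h) y) (at_state X s x).

Definition time_homogeneous P X : Prop :=
  forall s s' h x y : R, 0 <= s -> 0 <= s' -> 0 <= h ->
    (0 < P (at_state X s x))%E -> (0 < P (at_state X s' x))%E ->
    cprob P (at_state X (s + h) y) (at_state X s x) =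
    cprob P (at_state X (s' + h) y) (at_state X s' x).

(* X_0 may be any point of [i_1, i_M]; the process lives on S at positive     *)
(* times. When X_0 is not in S it jumps at time 0, so right-continuity is     *)
(* only asked at t > 0, together with the existence of X_{0+}. Regularity of  *)
(* the paths makes stays_at, jumps_at_0_to and {X_tau = x} measurable.        *)
Definition chain_paths (M : nat) (i : 'I_M -> R) X : Prop :=
  [/\ forall t : R, 0 <= t -> measurable_fun setT (X t),
      forall w : T, exists j k : 'I_M, i j <= X 0 w <= i k,
      forall (t : R) (w : T), 0 < t -> exists j : 'I_M, X t w = i j,
      forall (t : R) (w : T), 0 < t -> X u w @[u --> t^'+] --> X t w &
      forall w : T, cvg (X u w @[u --> 0^'+])].

(* States are numbered from 0: the boundary indices are 0 and M.-1, and       *)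
(* l, j, k below are consecutive.                                             *)
Record CMRW_with_rates P (M : nat) (i : 'I_M -> R) X (lambda : 'I_M -> R)
    : Prop := {
  rates_ge0 : forall j : 'I_M, 0 <= lambda j;
  rates_first : forall j : 'I_M, j = 0%N :> nat -> lambda j = 0;
  rates_last : forall j : 'I_M, j = M.-1 :> nat -> lambda j = 0;
  holding : forall (j : 'I_M) (s v : R), 0 <= s -> 0 <= v ->
    (0 < P (at_state X s (i j)))%E ->
    cprob P (stays_at X s v (i j)) (at_state X s (i j)) =
      expR (- (lambda j * v));
  jump_up : forall (l j k : 'I_M) (s : R),
    j = l.+1 :> nat -> k = j.+1 :> nat -> 0 <= s ->
    (0 < P (at_state X s (i j)))%E ->
    h^-1 * cprob P (at_state X (s + h) (i k)) (at_state X s (i j))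
      @[h --> 0^'+] --> (i j - i l) / (i k - i l) * lambda j;
  jump_down : forall (l j k : 'I_M) (s : R),
    j = l.+1 :> nat -> k = j.+1 :> nat -> 0 <= s ->
    (0 < P (at_state X s (i j)))%E ->
    h^-1 * cprob P (at_state X (s + h) (i l)) (at_state X s (i j))
      @[h --> 0^'+] --> (i k - i j) / (i k - i l) * lambda j;
  (* P(X_{0+} = . | X_0 = y) is a regular conditional probability, since the  *)
  (* law of X_0 need not have an atom at y: the formulas are integrated over  *)
  (* {X_0 \in B}. Taking B = [set y] gives the elementary version.            *)
  initial_up : forall (l j : 'I_M) (B : set R), j = l.+1 :> nat ->
    measurable B -> B `<=` `]i l, i j[ ->
    P (jumps_at_0_to X (i j) `&` X 0 @^-1` B) =
      (\int[P]_(w in X 0%R @^-1` B) ((X 0%R w - i l) / (i j - i l))%:E)%E;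
  initial_down : forall (l j : 'I_M) (B : set R), j = l.+1 :> nat ->
    measurable B -> B `<=` `]i l, i j[ ->
    P (jumps_at_0_to X (i l) `&` X 0 @^-1` B) =
      (\int[P]_(w in X 0%R @^-1` B) ((i j - X 0%R w) / (i j - i l))%:E)%E
}.

Definition CMRW P (M : nat) (i : 'I_M -> R) X : Prop :=
  [/\ chain_paths i X, martingale P X, markov P X, time_homogeneous P X &
      exists lambda : 'I_M -> R, CMRW_with_rates P i X lambda].

End processes.

(* (T, P) with its projection onto (T0, P0) is an enlargement of the          *)
(* probability space (T0, P0): a random variable Y on T0 is read on T as      *)
(* Y \o proj, with the same law.                                              *)
Definition enlarges {R : realType} d0 (T0 : measurableType d0)
    (P0 : probability T0 R) d (T : measurableType d) (P : probability T R)
    (proj : T -> T0) : Prop :=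
  measurable_fun setT proj /\
  forall A : set T0, measurable A -> P (proj @^-1` A) = P0 A.

(* Main.v *)
From HB Require Import structures.
From mathcomp Require Import all_boot all_order all_algebra all_fingroup.
From mathcomp Require Import all_classical all_reals all_analysis.
From mathcomp Require Import measurable_realfun.
From mathcomp Require Import ring lra zify.
Require Import Defs.
Import Order.TTheory GRing.Theory Num.Theory.
Import numFieldNormedType.Exports.
Set Implicit Arguments.
Unset Strict Implicit.
Unset Printing Implicit Defensive.
Local Open Scope classical_set_scope.
Local Open Scope ring_scope.

(** Let N be the generator of the walk on the points i_j that leaves each
interior point at rate 1 and moves to the two neighbours with the
probabilities that preserve the mean.  With rates l the walk has generator
L = diag(l) N.  A gamma time of shape r = q + 1 and mean t is a sum of r
independent exponential times of mean s = t / r, and over an exponential time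
of mean s the walk has transition matrix (1 - s L)^-1.  Started from the law
v0, the walk is therefore at a gamma time distributed as v0 (1 - s L)^-r.  Two
things have to be done: choose l such that this law is p, and construct the
walk independently of the given random time.

The rates.  The point e0 forces v0: it is the law on the two points
surrounding e0 with mean e0 ([exists_split_law]).  Let D be the matrix of
distances |i_j - i_k|; (u D)_k is the potential of the measure u at i_k.  The
second differences of |. - i_k| vanish except at i_k, so N D is diagonal, with
positive entries kink_k at interior points ([generator_dist]).  For
u_n = v0 (1 - s L)^-n this gives
  (u_(n+1) D)_k - (u_n D)_k = s kink_k l_k u_(n+1)(k)
([erlang_law_potential]).  If u_r = p, then necessarily
  l_k = ((p D)_k - (u_q D)_k) / (s kink_k p_k).
The right-hand side depends on l through u_q.  Its positive part is a
continuous function of l with values in a bounded cube, and Brouwer's theorem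
gives a fixed point ([exists_rates]).  The positive part does no harm: where
l_k = 0 the potentials at i_k of all the u_n agree with that of v0, which is at
most that of p by Jensen's inequality, and the fixed point equation gives the
converse inequality.  Hence the potentials of xi = u_r - p satisfy
(xi D)_k = s kink_k l_k xi_k at every k, that is, xi (1 - s L) D = 0.  Since D
is injective on vectors of total mass zero ([dist_mx_inj]) and 1 - s L is
invertible, xi = 0 ([fixpoint_rates]).

Brouwer's theorem ([brouwer_cube]) comes from Kuhn's triangulation of the
grid {0, ..., m}^N.  A labelling with N bits that is forced on the faces of
the cube must have a simplex along which every bit changes; the number of
such simplices is shown to be odd by a discrete Stokes formula modulo 2
([kuhn_parity]).

The walk.  With La larger than all rates, K = 1 + L / La is a stochastic
matrix, and the transition matrices are the Poisson mixtures of its powers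
([transition]).  The integral of a Poisson weight against the gamma density is
a negative binomial weight, so that averaging the transition matrices over a
gamma time yields the power of the resolvent
([expectation_transition_erlang]).  A chain with these transition matrices is
realised on [0, 1) with Lebesgue measure.  Enumerate the nonnegative rational
times; cutting [0, 1) successively into intervals whose lengths are the
finite-dimensional probabilities defines the chain at the rational times.  Its
expected number of changes along the rationals of [0, K] is at most La K, so
almost surely there are finitely many, right limits exist, and they define a
right-continuous chain with the correct finite-dimensional laws
([chain_fdd]).  All the defining properties of the martingale walk follow from
these laws and from right-continuity ([walk_CMRW]).  Finally, the product of
this probability space with the one carrying the random time makes the two
independent, and Fubini's formula computes the law at the random time
([embedding_law]). *)

(** * Parity of Kuhn's triangulation *)

Section mod2.
Variables (R : comNzRingType) (addRR : forall x : R, x + x = 0).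

(** Multiplication by an odd permutation exchanges the even and the odd ones, so that
equal terms cancel in pairs in characteristic 2. *)
Lemma sum_perm_swap0 n (t : 'S_n) (G : 'S_n -> R) :
  odd_perm t -> (forall s, G (s * t)%g = G s) -> \sum_s G s = 0.
Proof.
move=> todd Gt.
rewrite (bigID (fun s : 'S_n => odd_perm s)) /=.
rewrite [X in _ + X](reindex_inj (mulIg t)) /=.
rewrite [X in _ + X](eq_big (fun s : 'S_n => odd_perm s) (fun s => G s)).
- exact: addRR.
- by move=> s; rewrite odd_permM todd addbT negbK.
- by move=> s _; exact: Gt.
Qed.

Section grid.
Variable N : nat.
Implicit Types (x y : {ffun 'I_N -> nat}) (s : 'S_N).

(** The k-th vertex of the simplex (x, s) of Kuhn's triangulation of the cube with
lowest corner x: coordinate c is raised by one at step s c. *)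
Definition kuhn_vertex x s (k : nat) : {ffun 'I_N -> nat} :=
  [ffun c => (x c + (s c < k))%N].

End grid.

Definition cons_coord (T : Type) N (c0 : 'I_N.+1) (a : T) (x : {ffun 'I_N -> T}) :
  {ffun 'I_N.+1 -> T} := [ffun c => if unlift c0 c is Some c' then x c' else a].

Lemma cons_coordK T N (c0 : 'I_N.+1) (a : T) (x : {ffun 'I_N -> T}) c :
  cons_coord c0 a x (lift c0 c) = x c.
Proof. by rewrite ffunE liftK. Qed.

Lemma cons_coord0 T N (c0 : 'I_N.+1) (a : T) (x : {ffun 'I_N -> T}) :
  cons_coord c0 a x c0 = a.
Proof. by rewrite ffunE unlift_none. Qed.

Lemma sum_cons_coord (V : nmodType) N (T : finType) (c0 : 'I_N.+1) (F : {ffun 'I_N.+1 -> T} -> V) :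
  \sum_x F x = \sum_(x' : {ffun 'I_N -> T}) \sum_(a : T) F (cons_coord c0 a x').
Proof.
rewrite pair_big /= (reindex (fun p => cons_coord c0 p.2 p.1)) //=.
exists (fun x => ([ffun c => x (lift c0 c)], x c0)).
  by move=> [x' a] _ /=; congr pair; [apply/ffunP => c; rewrite ffunE cons_coordK | rewrite cons_coord0].
move=> x _ /=; apply/ffunP => c; rewrite ffunE.
by case: unliftP => [c' ->|->]; rewrite ?ffunE.
Qed.

(** A permutation is determined by the preimage c0 of j and by what it does to the
other points; applied to the first and to the last step, this turns a sum over
simplices into a sum over faces orthogonal to the direction c0. *)
Lemma sum_perm_lift (V : nmodType) N (j : 'I_N.+1) (F : 'S_N.+1 -> V) :
  \sum_s F s = \sum_(c0 : 'I_N.+1) \sum_(s : 'S_N) F (lift_perm c0 j s).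
Proof.
rewrite pair_big /= (reindex (fun p : 'I_N.+1 * 'S_N => lift_perm p.1 j p.2)) //=.
apply/onW_bij/inj_card_bij; last by rewrite card_prod card_ord !card_Sn factS.
move=> [c s] [c' s'] /= e.
have ec : c = c'.
  by apply: (@perm_inj _ (lift_perm c' j s')); rewrite lift_perm_id -e lift_perm_id.
subst c'; congr pair; apply/permP => k.
by apply: (@lift_inj _ j); rewrite -!(lift_perm_lift c) e.
Qed.

(** Omitting the vertex i.+1 or the vertex i from the chain of vertices changes only
the factor i.  The sum of the two products is the product in which that factor
jumps from i to i.+2, an expression in which the vertex i.+1 does not occur. *)
Lemma prod_diff_telescope n (a : 'I_n -> nat -> R) (i : nat) : (i < n)%N ->
  \prod_(k < n) (if (k < i.+1)%N then a k k.+1 + a k k else a k k.+2 + a k k.+1)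
  + \prod_(k < n) (if (k < i)%N then a k k.+1 + a k k else a k k.+2 + a k k.+1)
  = \prod_(k < n) (if (k < i)%N then a k k.+1 + a k k
                   else if (k == i :> nat) then a k k.+2 + a k k
                   else a k k.+2 + a k k.+1).
Proof.
move=> lin; pose i0 := Ordinal lin.
rewrite (bigD1 i0) //= [X in _ + X](bigD1 i0) //= [RHS](bigD1 i0) //= ltnSn ltnn eqxx.
set P1 := \prod_(_ < n | _) _; set P2 := \prod_(_ < n | _) _.
set P3 := \prod_(_ < n | _) _.
have e1 : P1 = P3.
  apply: eq_bigr => k; rewrite -val_eqE /= => ki.
  by rewrite ltnS leq_eqVlt (negPf ki).
have e2 : P2 = P3.
  by apply: eq_bigr => k; rewrite -val_eqE /= => ki; rewrite (negPf ki).
rewrite e1 e2 -mulrDl; congr (_ * _).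
by rewrite -[RHS]addr0 -(addRR (a i0 i.+1)); ring.
Qed.

Lemma kuhn_vertex0 N (x : {ffun 'I_N -> nat}) s : kuhn_vertex x s 0 = x.
Proof. by apply/ffunP => c; rewrite ffunE ltn0 addn0. Qed.

(** Exchanging two consecutive steps moves a single vertex of the simplex. *)
Lemma kuhn_vertex_swap N (x : {ffun 'I_N -> nat}) s (i : nat) (i0 i1 : 'I_N) k :
  i0 = i :> nat -> i1 = i.+1 :> nat -> k != i.+1 ->
  kuhn_vertex x (s * tperm i0 i1)%g k = kuhn_vertex x s k.
Proof.
move=> e0 e1 ki; apply/ffunP => c; rewrite !ffunE permM; congr (_ + nat_of_bool _)%N.
by case: tpermP => [->|->|//]; rewrite ?e0 ?e1; apply/idP/idP; move: ki; lia.
Qed.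

Section stokes.
Variables (N : nat) (f : 'I_N.+1 -> {ffun 'I_N.+1 -> nat} -> R).
Implicit Types (x : {ffun 'I_N.+1 -> nat}) (s : 'S_N.+1).

Definition jump x s (k : 'I_N.+1) := f k (kuhn_vertex x s k.+1) + f k (kuhn_vertex x s k).

Let a x s (k : 'I_N) j := f (lift ord0 k) (kuhn_vertex x s j).
Let P x s i := \prod_(k < N) (if (k < i)%N then a x s k k.+1 + a x s k k
                              else a x s k k.+2 + a x s k k.+1).

(** The product over the face opposite to the vertex i does not depend on i once it
is summed over all simplices of a cube: two consecutive values differ by a sum
that is invariant under the exchange of the steps i and i.+1. *)
Lemma sum_shift_face x (i : nat) : (i <= N)%N ->
  \sum_s f ord0 x * P x s i = \sum_s f ord0 x * P x s 0.
Proof.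
elim: i => // i IH iN; rewrite -{}IH 1?ltnW //.
suff H : \sum_s f ord0 x * P x s i.+1 + \sum_s f ord0 x * P x s i = 0.
  by rewrite -[LHS]addr0 -[X in _ + X = _](addRR (\sum_s f ord0 x * P x s i)) addrA H add0r.
rewrite -big_split /=.
have i0P : (i < N.+1)%N by lia.
have i1P : (i.+1 < N.+1)%N by lia.
apply: (@sum_perm_swap0 _ (tperm (Ordinal i0P) (Ordinal i1P))
  (fun s => f ord0 x * P x s i.+1 + f ord0 x * P x s i)).
  by rewrite odd_tperm -val_eqE /= neq_ltn ltnSn.
move=> s; rewrite -!mulrDr; congr (_ * _).
rewrite /P !prod_diff_telescope //; apply: eq_bigr => k _.
have e j : j != i.+1 ->
   a x (s * tperm (Ordinal i0P) (Ordinal i1P))%g k j = a x s k j.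
  by move=> ji; rewrite /a (@kuhn_vertex_swap _ _ _ i).
case: ifPn => ki; first by rewrite !e //; lia.
by case: ifPn => ki'; rewrite !e //; lia.
Qed.

(** The cup product of the 0-cochain f ord0 with the coboundaries of the other
0-cochains, along a chain of N.+1 vertices. *)
Definition face_cochain (y : nat -> {ffun 'I_N.+1 -> nat}) : R :=
  f ord0 (y 0%N) * \prod_(k < N) (f (lift ord0 k) (y k.+1) + f (lift ord0 k) (y k)).

Lemma face_cochain_eq0 y (k : 'I_N) :
  f (lift ord0 k) (y k.+1) = f (lift ord0 k) (y k) -> face_cochain y = 0.
Proof. by move=> e; rewrite /face_cochain (bigD1 k) //= e addRR mul0r mulr0. Qed.

(** Discrete Stokes formula modulo 2: the coboundary of the face cochain, summed over
the simplices of a cube, leaves only the faces obtained by omitting the first or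
the last vertex. *)
Lemma sum_jumps x :
  \sum_s \prod_k jump x s k =
  \sum_s (face_cochain (fun k => kuhn_vertex x s k.+1) + face_cochain (kuhn_vertex x s)).
Proof.
rewrite big_split /= [X in _ + X](_ : _ = \sum_s f ord0 x * P x s N); last first.
  apply: eq_bigr => s _; rewrite /face_cochain kuhn_vertex0; congr (_ * _).
  by apply: eq_bigr => k _; rewrite ltn_ord.
rewrite sum_shift_face // -big_split /=; apply: eq_bigr => s _.
by rewrite big_ord_recl /= /jump kuhn_vertex0 -mulrDl.
Qed.

(** The vertices before the last step, when the last step is in direction c0, stay on
the lower face orthogonal to c0; the analogous fact for the first step and
the upper face follows. *)
Lemma face_vertex_last c0 (y : {ffun 'I_N -> nat}) b (s : 'S_N) k : (k <= N)%N ->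
  kuhn_vertex (cons_coord c0 b y) (lift_perm c0 ord_max s) k =
  cons_coord c0 b (kuhn_vertex y s k).
Proof.
move=> kN; apply/ffunP => c; rewrite ffunE; case: (unliftP c0 c) => [c' ->|->].
  rewrite !cons_coordK lift_perm_lift ffunE; congr (_ + nat_of_bool _)%N.
  by rewrite lift_max.
by rewrite !cons_coord0 lift_perm_id /= ltnNge kN addn0.
Qed.

Lemma face_vertex_first c0 (y : {ffun 'I_N -> nat}) b (s : 'S_N) k :
  kuhn_vertex (cons_coord c0 b y) (lift_perm c0 ord0 s) k.+1 =
  cons_coord c0 b.+1 (kuhn_vertex y s k).
Proof.
apply/ffunP => c; rewrite ffunE; case: (unliftP c0 c) => [c' ->|->].
  by rewrite !cons_coordK lift_perm_lift ffunE lift0 ltnS.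
by rewrite !cons_coord0 lift_perm_id /= addn1.
Qed.
End stokes.

Definition ord_nat N m (x : {ffun 'I_N -> 'I_m}) : {ffun 'I_N -> nat} := [ffun c => x c : nat].

Lemma sum_consecutive (u : nat -> R) m : \sum_(b < m) (u b.+1 + u b) = u m + u 0%N.
Proof.
elim: m => [|m IH]; first by rewrite big_ord0 addRR.
by rewrite big_ord_recr IH /= -[RHS]addr0 -(addRR (u m)); ring.
Qed.

(** Adjacent cubes share a face, which contributes twice and cancels modulo 2.  Only
the two outer faces in each direction remain. *)
Lemma sum_jumps_boundary N m (f : 'I_N.+1 -> {ffun 'I_N.+1 -> nat} -> R) :
  \sum_(x : {ffun 'I_N.+1 -> 'I_m}) \sum_s \prod_k jump f (ord_nat x) s k =
  \sum_(c0 : 'I_N.+1) \sum_(x : {ffun 'I_N -> 'I_m}) \sum_s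
    (face_cochain f (fun k => cons_coord c0 m (kuhn_vertex (ord_nat x) s k)) +
     face_cochain f (fun k => cons_coord c0 0%N (kuhn_vertex (ord_nat x) s k))).
Proof.
have fcE (y z : nat -> {ffun 'I_N.+1 -> nat}) :
    (forall k, (k <= N)%N -> y k = z k) -> face_cochain f y = face_cochain f z.
  move=> yz; rewrite /face_cochain yz //; congr (_ * _); apply: eq_bigr => k _.
  by rewrite !yz // ltnW.
under eq_bigr do rewrite sum_jumps big_split /= (sum_perm_lift ord0)
  [X in _ + X](sum_perm_lift ord_max) -big_split /=.
rewrite exchange_big; apply: eq_bigr => c0 _ /=.
under eq_bigr do rewrite -big_split /=.
rewrite (sum_cons_coord c0); apply: eq_bigr => x _.
rewrite exchange_big; apply: eq_bigr => s _ /=.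
rewrite -(sum_consecutive (fun b => face_cochain f
  (fun k => cons_coord c0 b (kuhn_vertex (ord_nat x) s k)))).
apply: eq_bigr => b _.
have -> : ord_nat (cons_coord c0 b x) = cons_coord c0 (b : nat) (ord_nat x).
  by apply/ffunP => c; rewrite !ffunE; case: unlift => [c'|]; rewrite ?ffunE.
congr (_ + _); apply: fcE => k kN; first by rewrite face_vertex_first.
by rewrite face_vertex_last.
Qed.

(** Induction on the dimension.  On an outer face orthogonal to a direction c other
than ord0 the cochain f c is constant, hence its coboundary vanishes there; on the
lower face orthogonal to ord0 the cochain f ord0 vanishes.  Only the upper face
orthogonal to ord0 remains, where the claim is the one in dimension N. *)
Lemma kuhn_parity N m (f : 'I_N -> {ffun 'I_N -> nat} -> R) :
  (forall k (y : {ffun 'I_N -> nat}), y k = 0%N -> f k y = 0) ->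
  (forall k (y : {ffun 'I_N -> nat}), y k = m -> f k y = 1) ->
  \sum_(x : {ffun 'I_N -> 'I_m}) \sum_(s : 'S_N)
     \prod_k (f k (kuhn_vertex (ord_nat x) s k.+1) + f k (kuhn_vertex (ord_nat x) s k)) = 1.
Proof.
elim: N f => [|N IH] f f0 f1.
  under eq_bigr do under eq_bigr do rewrite big_ord0.
  by rewrite !sumr_const card_Sn card_ffun !card_ord expn0.
transitivity (\sum_(x : {ffun 'I_N.+1 -> 'I_m}) \sum_s \prod_k jump f (ord_nat x) s k) => //.
rewrite sum_jumps_boundary big_ord_recl [X in _ + X]big1 ?addr0; last first.
  move=> c _; apply: big1 => x _; apply: big1 => s _.
  rewrite !(@face_cochain_eq0 _ f _ c) ?addr0 //.
    by rewrite !(f0 _ (cons_coord _ 0 _)) ?cons_coord0.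
  by rewrite !(f1 _ (cons_coord _ m _)) ?cons_coord0.
rewrite -[RHS](IH (fun k y => f (lift ord0 k) (cons_coord ord0 m y))).
- apply: eq_bigr => x _; apply: eq_bigr => s _.
  rewrite /face_cochain f1 ?cons_coord0 // mul1r f0 ?cons_coord0 // mul0r addr0.
  by [].
- by move=> k y yk; apply: f0; rewrite cons_coordK.
- by move=> k y yk; apply: f1; rewrite cons_coordK.
Qed.
End mod2.

(** Since the number of simplices along which every label changes is odd, there is at
least one; all its vertices lie in the same cube. *)
Lemma kuhn_cell N m (l : 'I_N -> {ffun 'I_N -> nat} -> bool) :
  (forall k (y : {ffun 'I_N -> nat}), y k = 0%N -> ~~ l k y) ->
  (forall k (y : {ffun 'I_N -> nat}), y k = m -> l k y) ->
  exists x : {ffun 'I_N -> nat}, (forall k, x k < m)%N /\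
    forall k, exists y z : {ffun 'I_N -> nat},
      [/\ forall c, (x c <= y c <= (x c).+1)%N, forall c, (x c <= z c <= (x c).+1)%N,
          ~~ l k y & l k z].
Proof.
move=> l0 l1.
have F2 (u : 'F_2) : u + u = 0 by apply: addrr_pchar2; rewrite pchar_Fp.
have [x /existsP[s xs]|no] := pickP (fun x : {ffun 'I_N -> 'I_m} => [exists s : 'S_N,
   [forall k, l k (kuhn_vertex (ord_nat x) s k.+1) (+) l k (kuhn_vertex (ord_nat x) s k)]]).
  have vx k c : (ord_nat x c <= kuhn_vertex (ord_nat x) s k c <= (ord_nat x c).+1)%N.
    by rewrite [kuhn_vertex _ _ _ _]ffunE; case: ltnP => _; lia.
  exists (ord_nat x); split=> [k|k]; first by rewrite ffunE.
  move/forallP: xs => /(_ k).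
  case lk1: (l k (kuhn_vertex _ _ k.+1)); case lk: (l k (kuhn_vertex _ _ k)) => // _.
    by exists (kuhn_vertex (ord_nat x) s k), (kuhn_vertex (ord_nat x) s k.+1); rewrite lk.
  by exists (kuhn_vertex (ord_nat x) s k.+1), (kuhn_vertex (ord_nat x) s k); rewrite lk1.
have := @kuhn_parity _ F2 N m (fun k y => (l k y)%:R).
rewrite big1 => [|x _]; last first.
  apply: big1 => s _; apply/eqP/prodf_eq0.
  have /negbT := no x; rewrite negb_exists => /forallP/(_ s).
  rewrite negb_forall => /existsP[k kx]; exists k => //.
  by move: kx; case: (l k _); case: (l k _); rewrite ?F2 ?addr0.
move=> H; have /eqP : (0 : 'F_2) = 1.
  by apply: H => k y yk; [rewrite (negPf (l0 _ _ yk))|rewrite l1].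
by [].
Qed.

(** * Brouwer's fixed point theorem on a cube *)

Section brouwer.
Variables (R : realType) (N : nat) (C : R).
Hypothesis C0 : 0 <= C.

Definition cube : set 'rV[R]_N := [set x | forall c, 0 <= x 0 c <= C].

Lemma compact_cube : compact cube.
Proof.
rewrite (_ : cube = [set x : 'rV[R]_N | forall c, `[0, C]%classic (x ord0 c)]).
  by apply: (@rV_compact _ _ (fun=> `[0, C]%classic)) => c; exact: segment_compact.
by apply/seteqP; split => x /= Hx c; have := Hx c; rewrite /= in_itv.
Qed.

Lemma mx_ballE (x y : 'rV[R]_N) e : 0 < e ->
  (forall c, `|x 0 c - y 0 c| < e) -> ball x e y.
Proof. by move=> e0 H; split => // i c; rewrite (ord1 i); exact: H. Qed.

Variable G : 'I_N -> 'rV[R]_N -> R.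
Hypothesis Gc : forall k, continuous (G k).
Hypothesis Gcube : forall k x, cube x -> 0 <= G k x <= C.

(** Label a grid point in direction k by whether G does not increase its k-th
coordinate.  The values of the label on the outer faces are imposed, and they
are compatible with the sign of G k x - x k because G maps the cube to itself. *)
Lemma approximate_fixpoint (n : nat) : exists x : 'rV[R]_N, cube x /\
  forall k, exists y z : 'rV[R]_N,
   [/\ cube y /\ y 0 k <= G k y, cube z /\ G k z <= z 0 k,
      forall c, `|x 0 c - y 0 c| <= C / n.+1%:R &
      forall c, `|x 0 c - z 0 c| <= C / n.+1%:R].
Proof.
pose pt (y : {ffun 'I_N -> nat}) : 'rV[R]_N := \row_c (C * ((y c)%:R / n.+1%:R)).
pose l k (y : {ffun 'I_N -> nat}) := (0 < y k)%N && ((n.+1 <= y k)%N || (G k (pt y) <= pt y 0 k)).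
have n0 : (0 : R) < n.+1%:R by rewrite ltr0n.
have ptcube (y : {ffun 'I_N -> nat}) : (forall c, (y c <= n.+1)%N) -> cube (pt y).
  move=> yn c; rewrite mxE mulr_ge0 ?divr_ge0 ?ler0n //=.
  by rewrite ler_piMr // ler_pdivrMr // mul1r ler_nat.
have ptdist (x y : {ffun 'I_N -> nat}) c :
    (x c <= y c <= (x c).+1)%N -> `|pt x 0 c - pt y 0 c| <= C / n.+1%:R.
  move=> /andP[xy yx]; rewrite !mxE -mulrBr -mulrBl normrM (ger0_norm C0).
  rewrite ler_wpM2l // normrM (ger0_norm (_ : 0 <= n.+1%:R^-1)) ?invr_ge0 ?ler0n //.
  rewrite ler_piMl ?invr_ge0 ?ler0n // distrC -natrB // normr_nat.
  by rewrite (_ : 1 = 1%:R) // ler_nat leq_subLR addn1.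
have [|k y ykn|x [xn cell]] := @kuhn_cell N n.+1 l.
- by move=> k y yk; rewrite /l yk.
- by rewrite /l ykn leqnn.
exists (pt x); split; first by apply: ptcube => c; exact: ltnW.
move=> k; have [y [z [xy xz ly lz]]] := cell k.
have yn c : (y c <= n.+1)%N by have := xn c; have /andP[] := xy c; lia.
have zn c : (z c <= n.+1)%N by have := xn c; have /andP[] := xz c; lia.
have /andP[Gy0 _] := Gcube k (ptcube _ yn).
have /andP[_ Gz1] := Gcube k (ptcube _ zn).
exists (pt y), (pt z); split.
- split; first exact: ptcube.
  move: ly; rewrite /l negb_and -eqn0Ngt negb_or => /orP[/eqP yk0|/andP[_]].
    by rewrite [X in X <= _]mxE yk0 mul0r mulr0.
  by rewrite -ltNge => /ltW.
- split; first exact: ptcube.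
  move: lz => /andP[_ /orP[nz|//]].
  have -> : pt z 0 k = C; last by [].
  rewrite mxE (_ : z k = n.+1); last by apply/eqP; rewrite eqn_leq zn.
  by rewrite divff ?mulr1 // gt_eqF.
- by move=> c; exact: ptdist.
- by move=> c; exact: ptdist.
Qed.

(** At a cluster point x of approximate fixed points, G k - x k takes values >= 0
and values <= 0 in every neighbourhood. *)
Lemma brouwer_cube : exists x, cube x /\ forall k, G k x = x 0 k.
Proof.
have [u uP] := choice approximate_fixpoint.
have [x [xcube xcl]] : cube `&` cluster (u @ \oo) !=set0.
  by apply: compact_cube; exists 0%N => // n _; have [] := uP n.
exists x; split => // k.
pose H (x : 'rV[R]_N) := G k x - x 0 k.
have Hc : continuous H.
  by move=> y; apply: continuousB; [exact: Gc|exact: coord_continuous].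
suff contra (A : set R) : open A -> A (H x) ->
    exists y z, [/\ A (H y), A (H z), 0 <= H y & H z <= 0].
  have [H0|H0|/eqP] := ltgtP (H x) 0; last by rewrite subr_eq0 => /eqP.
    have [y [_ [/= yA _ y0 _]]] := contra [set t | t < 0] (@open_lt _ _) H0.
    by have := lt_le_trans yA y0; rewrite ltxx.
  have [_ [z [/= _ zA _ z0]]] := contra [set t | 0 < t] (@open_gt _ _) H0.
  by have := lt_le_trans zA z0; rewrite ltxx.
move=> Aopen Ax.
have /nbhs_ballP[e /= e0 eA] : nbhs x (H @^-1` A) by apply: Hc; exact: open_nbhs_nbhs.
have e20 : 0 < e / 2 by rewrite divr_gt0.
have [m _ mP] : \forall n \near \oo, C / n.+1%:R < e / 2.
  have [m mP] : exists m : nat, C / (e / 2) < m.+1%:R.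
    exists (Num.truncn (C / (e / 2))); exact: truncnS_gt.
  exists m => // n /= mn; rewrite ltr_pdivrMr ?ltr0n // mulrC -ltr_pdivrMr //.
  by apply: lt_le_trans mP _; rewrite ler_nat.
have [_ [[n mn <-] xe]] : (u @` [set n | (m <= n)%N]) `&` ball x (e / 2) !=set0.
  apply: xcl; last exact: nbhsx_ballx.
  by exists m => // n /= mn; exists n.
have [_ /(_ k)[y [z [[_ Gy] [_ Gz] uy uz]]]] := uP n.
have close (w : 'rV[R]_N) : (forall c, `|u n 0 c - w 0 c| <= C / n.+1%:R) -> ball x e w.
  move=> uw; apply: mx_ballE => // c.
  rewrite -(subrK (u n 0 c) (x 0 c)) -addrA (le_lt_trans (ler_normD _ _)) //.
  rewrite (splitr e) ltr_leD //; first exact: (xe.2 0 c).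
  by rewrite (le_trans (uw c)) // ltW // mP.
exists y, z; split; [exact/eA/close|exact/eA/close| |].
- by rewrite subr_ge0.
- by rewrite subr_le0.
Qed.
End brouwer.

(** * Continuity of matrix operations *)

Section continuous_matrix.
Variables (R : realType) (T : topologicalType).
Implicit Types (f g : T -> R).

Lemma continuous_sumf (I : finType) (F : I -> T -> R) :
  (forall k, continuous (F k)) -> continuous (fun x => \sum_k F k x).
Proof. by move=> Fc; apply: continuous_big => // x; exact: add_continuous. Qed.

Lemma continuous_prodf (I : finType) (F : I -> T -> R) :
  (forall k, continuous (F k)) -> continuous (fun x => \prod_k F k x).
Proof. by move=> Fc; apply: continuous_big => // x; exact: mul_continuous. Qed.

Lemma continuous_mulf f g : continuous f -> continuous g -> continuous (fun x => f x * g x).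
Proof. by move=> fc gc x; apply: continuousM; [exact: fc|exact: gc]. Qed.

Lemma continuous_addf f g : continuous f -> continuous g -> continuous (fun x => f x + g x).
Proof. by move=> fc gc x; apply: continuousD; [exact: fc|exact: gc]. Qed.

Lemma continuous_cstf (c : R) : continuous (fun _ : T => c).
Proof. by move=> x; exact: cst_continuous. Qed.

(** Continuity of each entry is what the determinant and cofactor formulas use, and
it avoids the topology of spaces of matrices of arbitrary shape. *)
Definition entrywise_continuous m n (A : T -> 'M[R]_(m, n)) :=
  forall j k, continuous (fun x => A x j k).

Lemma continuous_mulmx m n p (A : T -> 'M[R]_(m, n)) (B : T -> 'M[R]_(n, p)) :
  entrywise_continuous A -> entrywise_continuous B ->
  entrywise_continuous (fun x => A x *m B x).
Proof.
move=> Ac Bc j k; rewrite (_ : (fun x => _) = fun x => \sum_c A x j c * B x c k).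
  by apply: continuous_sumf => c; apply: continuous_mulf.
by apply/funext => x; rewrite mxE.
Qed.

Lemma continuous_det n (A : T -> 'M[R]_n) :
  entrywise_continuous A -> continuous (fun x => \det (A x)).
Proof.
move=> Ac; apply: continuous_sumf => s; apply: continuous_mulf.
  exact: continuous_cstf.
by apply: continuous_prodf => j; exact: Ac.
Qed.

Lemma continuous_invmx n (A : T -> 'M[R]_n) :
  (forall x, A x \in unitmx) -> entrywise_continuous A ->
  entrywise_continuous (fun x => invmx (A x)).
Proof.
move=> Au Ac j k.
rewrite (_ : (fun x => _) = fun x => (\det (A x))^-1 * cofactor (A x) k j).
  apply: continuous_mulf.
    move=> x; apply: (@continuousV _ _ (fun x => \det (A x))); last exact: continuous_det.
    by have := Au x; rewrite unitmxE unitfE.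
  apply: continuous_mulf; first exact: continuous_cstf.
  apply: continuous_det => c d.
  rewrite (_ : (fun x => _) = fun x => A x (lift k c) (lift j d)); first exact: Ac.
  by apply/funext => x; rewrite !mxE.
by apply/funext => x; rewrite /invmx Au !mxE.
Qed.
End continuous_matrix.

(** * The mean-preserving generator and its potential *)

Section rates.
Variables (R : realType) (m : nat).
Variable i : 'I_m.+2 -> R.
Hypothesis hi : forall j k : 'I_m.+2, (j < k)%N -> i j < i k.

(** The states as a function on natural numbers, so that neighbouring states can be
written with successor and predecessor. *)
Definition pos (n : nat) : R := i (inord n).
Definition inner_state (j : 'I_m.+2) := (0 < j < m.+1)%N.

Lemma pos_ord (j : 'I_m.+2) : pos j = i j.
Proof. by rewrite /pos inord_val. Qed.

Lemma pos_lt n n' : (n < n')%N -> (n' <= m.+1)%N -> pos n < pos n'.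
Proof. by move=> nn' n'm; apply: hi; rewrite !inordK //; lia. Qed.

Lemma pos_le n n' : (n <= n')%N -> (n' <= m.+1)%N -> pos n <= pos n'.
Proof.
rewrite leq_eqVlt => /orP[/eqP -> //|nn'] n'm; exact/ltW/pos_lt.
Qed.

Definition up (j : 'I_m.+2) := (pos j - pos j.-1) / (pos j.+1 - pos j.-1).
Definition down (j : 'I_m.+2) := (pos j.+1 - pos j) / (pos j.+1 - pos j.-1).

(** The generator N with all interior rates equal to 1. *)
Definition unit_generator : 'M[R]_m.+2 := \matrix_(j, k)
  if inner_state j then up j * (k == j.+1 :> nat)%:R + down j * (k == j.-1 :> nat)%:R
    - (k == j)%:R
  else 0.

Lemma inner_gaps j : inner_state j -> 0 < pos j - pos j.-1 /\ 0 < pos j.+1 - pos j.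
Proof. by move=> /andP[j0 jm]; rewrite !subr_gt0; split; apply: pos_lt; lia. Qed.

Lemma up_gt0 j : inner_state j -> 0 < up j.
Proof. by move=> /inner_gaps[? ?]; rewrite divr_gt0 //; lra. Qed.

Lemma down_gt0 j : inner_state j -> 0 < down j.
Proof. by move=> /inner_gaps[? ?]; rewrite divr_gt0 //; lra. Qed.

Lemma up_down j : inner_state j -> up j + down j = 1.
Proof. by move=> /inner_gaps[? ?]; rewrite /up /down; field; lra. Qed.

Lemma sum_eq_nat (f : 'I_m.+2 -> R) n : (n < m.+2)%N ->
  \sum_(k < m.+2) (k == n :> nat)%:R * f k = f (inord n).
Proof.
move=> nm; rewrite (bigD1 (inord n)) //= inordK // eqxx mul1r big1 ?addr0 // => k kn.
rewrite (_ : (k == n :> nat) = false) ?mul0r //; apply/negP => /eqP e.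
by move/negP: kn; apply; rewrite -e inord_val.
Qed.

Lemma unit_generator_sum (f : 'I_m.+2 -> R) j :
  \sum_k unit_generator j k * f k =
  if inner_state j then up j * f (inord j.+1) + down j * f (inord j.-1) - f j else 0.
Proof.
under eq_bigr do rewrite mxE.
case: ifPn => jin; last by rewrite big1 // => k _; rewrite mul0r.
have /andP[j0 jm] := jin.
under eq_bigr do rewrite mulrBl mulrDl -(mulrA (up j)) -(mulrA (down j)).
rewrite sumrB big_split /= -!mulr_sumr !sum_eq_nat ?inord_val //.
  exact: ltn_ord.
by rewrite (leq_ltn_trans (leq_pred _)) // ltn_ord.
Qed.

Lemma unit_generator_sum1 j : \sum_k unit_generator j k = 0.
Proof.
have := unit_generator_sum (fun=> 1) j.
under eq_bigr do rewrite mulr1.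
by move=> ->; case: ifP => // jin; rewrite !mulr1 up_down // subrr.
Qed.

Lemma unit_generator_mean j : \sum_k unit_generator j k * i k = 0.
Proof.
rewrite unit_generator_sum; case: ifP => // /inner_gaps[? ?].
by rewrite -/(pos _) -/(pos _) -(pos_ord j) /up /down; field; lra.
Qed.

Lemma unit_generator_off j k : k != j -> 0 <= unit_generator j k.
Proof.
move=> /negPf kj; rewrite mxE kj subr0; case: ifP => // jin.
by rewrite addr_ge0 // mulr_ge0 ?ler0n // ltW ?up_gt0 ?down_gt0.
Qed.

Lemma unit_generator_diag j : -1 <= unit_generator j j <= 0.
Proof.
rewrite mxE eqxx (_ : (j == j.+1 :> nat) = false); last by lia.
case: ifPn => [/andP[j0 _]|_]; last lra.
rewrite (_ : (j == j.-1 :> nat) = false); last by lia.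
by rewrite !mulr0n !mulr0 !add0r mulr1n; lra.
Qed.

Definition dist_mx : 'M[R]_m.+2 := \matrix_(j, k) `|i j - i k|.

(** The second difference at i_k, in the sense of the generator, of the function
|. - i_k|; the boundary points do not move. *)
Definition kink (k : 'I_m.+2) : R := if inner_state k then
  2 * (pos k - pos k.-1) * (pos k.+1 - pos k) / (pos k.+1 - pos k.-1) else 0.

Lemma kink_gt0 k : inner_state k -> 0 < kink k.
Proof.
move=> kin; rewrite /kink kin; have [? ?] := inner_gaps kin.
by rewrite divr_gt0 //; [rewrite !mulr_gt0|lra].
Qed.

Lemma kink_ge0 k : 0 <= kink k.
Proof.
by have [kin|kin] := boolP (inner_state k); [exact/ltW/kink_gt0|rewrite /kink (negPf kin)].
Qed.

Lemma i_le (j k : 'I_m.+2) : (j <= k)%N -> i j <= i k.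
Proof. by move=> jk; rewrite -!pos_ord pos_le // -ltnS. Qed.

(** The function |. - i_k| is affine on each side of i_k, and the generator kills the
functions that are affine near a point. *)
Lemma generator_dist j k :
  (unit_generator *m dist_mx) j k = kink j * (j == k)%:R.
Proof.
rewrite mxE; under eq_bigr do rewrite [dist_mx _ _]mxE.
rewrite unit_generator_sum /kink; case: ifP => [jin|]; last by rewrite mul0r.
rewrite -/(pos _) -/(pos _) -(pos_ord j) -(pos_ord k).
have [g1 g2] := inner_gaps jin; have /andP[j0 jm] := jin.
have [<-|jk] := eqVneq j k.
  rewrite subrr normr0 subr0 mulr1 (ltr0_norm (_ : pos j.-1 - pos j < 0)); last by lra.
  by rewrite (gtr0_norm g2) /up /down; field; lra.
rewrite mulr0; have [kj|kj] := leqP k j.-1.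
  have ? : pos k <= pos j.-1 by apply: pos_le; lia.
  by rewrite !ger0_norm; [rewrite /up /down; field|..]; lra.
have ? : pos j.+1 <= pos k.
  by apply: pos_le; [move: jk; rewrite -val_eqE /=|have := ltn_ord k]; lia.
by rewrite !ler0_norm; [rewrite /up /down; field|..]; lra.
Qed.

(** The difference of the potentials at two consecutive points is an affine function
of the mass carried by the points up to the first one.  Zero total mass and
zero potential force all these cumulated masses to vanish. *)
Lemma dist_mx_inj (z : 'rV[R]_m.+2) :
  \sum_j z 0 j = 0 -> z *m dist_mx = 0 -> z = 0.
Proof.
move=> z1 zD.
pose F n := \sum_(j < m.+2 | (j < n)%N) z 0 j.
have FS (n : 'I_m.+2) : F n.+1 = F n + z 0 n.
  rewrite /F (bigD1 n) //= addrC; congr (_ + _); apply: eq_bigl => j.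
  by rewrite ltnS ltn_neqAle andbC.
have F0 n : (n <= m.+2)%N -> F n = 0.
  case: n => [|n] nm; first by rewrite /F big1.
  move: nm; rewrite ltnS leq_eqVlt => /orP[/eqP->|nm].
    by rewrite -z1; apply: eq_bigl => j; rewrite ltn_ord.
  have g0 : 0 < pos n.+1 - pos n by rewrite subr_gt0 pos_lt.
  have /rowP zD' := zD.
  have := zD' (inord n.+1); have := zD' (inord n); rewrite !mxE => e0 e1.
  have : \sum_j z 0 j * ((pos n.+1 - pos n) * (2 * (j < n.+1)%:R - 1)) = 0.
    transitivity (\sum_j (z 0 j * dist_mx j (inord n.+1) - z 0 j * dist_mx j (inord n))).
      apply: eq_bigr => j _; rewrite -mulrBr; congr (_ * _).
      rewrite !mxE -/(pos _) -/(pos _) -(pos_ord j).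
      case: ltnP => jn.
        have ? : pos j <= pos n by apply: pos_le => //; lia.
        by rewrite /= mulr1n !ler0_norm; lra.
      have ? : pos n.+1 <= pos j by apply: pos_le => //; have := ltn_ord j; lia.
      by rewrite /= mulr0n !ger0_norm; lra.
    by rewrite sumrB e0 e1 subrr.
  under eq_bigr do rewrite mulrCA mulrBr mulr1 (mulrCA (z 0 _)).
  rewrite -mulr_sumr sumrB z1 subr0 -mulr_sumr => /eqP.
  rewrite !mulf_eq0 (gt_eqF g0) pnatr_eq0 /= => /eqP <-.
  rewrite /F big_mkcond /=; apply: eq_bigr => j _.
  by case: ltnP => _; rewrite ?mulr1 ?mulr0.
apply/rowP => j; have := FS j; rewrite !F0 ?add0r ?mxE //.
by rewrite ltnW // ltn_ord.
Qed.
End rates.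

(** * Rates that embed a given law *)

Section resolvent.
Variables (R : realType) (m : nat) (i : 'I_m.+2 -> R).
Hypothesis hi : forall j k : 'I_m.+2, (j < k)%N -> i j < i k.
Variables (s : R).
Hypothesis s0 : 0 < s.
Implicit Types (l : 'I_m.+2 -> R) (v : 'rV[R]_m.+2).

Definition generator l : 'M[R]_m.+2 := \matrix_(j, k) (l j * unit_generator i j k).
Definition inv_resolvent l : 'M[R]_m.+2 := 1%:M - s *: generator l.
Definition resolvent l : 'M[R]_m.+2 := invmx (inv_resolvent l).

Lemma generator_sum1 l j : \sum_k generator l j k = 0.
Proof.
under eq_bigr do rewrite mxE.
by rewrite -mulr_sumr (unit_generator_sum1 hi) mulr0.
Qed.

(** Minimum principle: at a point where x is minimal the generator is nonnegative,
so (1 - s L) x is at most x there. *)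
Lemma inv_resolvent_min l (x : 'cV[R]_m.+2) : (forall j, 0 <= l j) ->
  (forall j, 0 <= (inv_resolvent l *m x) j 0) -> forall j, 0 <= x j 0.
Proof.
move=> l0 Bx j0; case: (@Order.TotalTheory.arg_minP _ _ _ j0 predT (fun j => x j 0)) => // j _ jmin.
apply: le_trans (jmin j0 isT); apply: le_trans (Bx j) _.
rewrite mulmxBl mul1mx -scalemxAl !mxE gerBl mulr_ge0 ?(ltW s0) //.
rewrite (_ : \sum_k _ = \sum_k generator l j k * (x k 0 - x j 0)).
  apply: sumr_ge0 => k _; have [->|kj] := eqVneq k j; first by rewrite subrr mulr0.
  by rewrite mulr_ge0 ?subr_ge0 ?jmin // mxE mulr_ge0 // (unit_generator_off hi).
under [RHS]eq_bigr do rewrite mulrBr.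
by rewrite sumrB -mulr_suml generator_sum1 mul0r subr0.
Qed.

Lemma inv_resolvent_unit l : (forall j, 0 <= l j) -> inv_resolvent l \in unitmx.
Proof.
move=> l0; rewrite unitmxE unitfE -det_tr; apply/negP => /det0P[v v0 vB].
move/negP: v0; apply; apply/eqP/rowP => j; rewrite mxE.
have Bv : inv_resolvent l *m v^T = 0.
  by apply: trmx_inj; rewrite trmx_mul trmxK vB trmx0.
apply/eqP; rewrite eq_le; apply/andP; split; last first.
  have := @inv_resolvent_min l v^T l0; rewrite Bv => /(_ _ j); rewrite mxE; apply.
  by move=> ?; rewrite mxE.
have := @inv_resolvent_min l (- v^T) l0; rewrite mulmxN Bv => /(_ _ j).
by rewrite !mxE oppr_ge0; apply=> ?; rewrite oppr0 mxE.
Qed.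

Lemma resolvent_ge0 l : (forall j, 0 <= l j) -> forall j k, 0 <= resolvent l j k.
Proof.
move=> l0 j k.
have := @inv_resolvent_min l (col k (resolvent l)) l0.
rewrite colE mulmxA mulmxV ?inv_resolvent_unit // mul1mx => /(_ _ j); rewrite -colE mxE; apply=> c.
by rewrite !mxE ler0n.
Qed.

Lemma resolvent_sum1 l : (forall j, 0 <= l j) ->
  resolvent l *m (const_mx 1 : 'cV_m.+2) = const_mx 1.
Proof.
move=> l0; apply: (can_inj (mulKmx (inv_resolvent_unit l0))).
rewrite mulmxA mulmxV ?inv_resolvent_unit // mul1mx.
rewrite mulmxBl mul1mx -scalemxAl (_ : generator l *m _ = 0) ?scaler0 ?subr0 //.
apply/colP => j; rewrite !mxE; under eq_bigr do rewrite [const_mx _ _ _]mxE mulr1.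
exact: generator_sum1.
Qed.

Variable v0 : 'rV[R]_m.+2.
Hypothesis v0_ge0 : forall j, 0 <= v0 0 j.

(** The law, after n independent exponential times of mean s, of the walk with rates l
started from v0. *)
Definition erlang_law l n : 'rV[R]_m.+2 := v0 *m (resolvent l) ^+ n.

Lemma erlang_lawS l n : erlang_law l n.+1 = erlang_law l n *m resolvent l.
Proof. by rewrite /erlang_law exprSr mulmxA. Qed.

Lemma erlang_law_step l n : (forall j, 0 <= l j) ->
  erlang_law l n.+1 *m inv_resolvent l = erlang_law l n.
Proof. by move=> l0; rewrite erlang_lawS mulmxKV // inv_resolvent_unit. Qed.

Lemma erlang_law_ge0 l n j : (forall j, 0 <= l j) -> 0 <= erlang_law l n 0 j.
Proof.
move=> l0; elim: n j => [|n IH] j; first by rewrite /erlang_law expr0 mulmx1.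
by rewrite erlang_lawS mxE sumr_ge0 // => k _; rewrite mulr_ge0 // resolvent_ge0.
Qed.

Lemma erlang_law_sum1 l n : (forall j, 0 <= l j) ->
  \sum_j erlang_law l n 0 j = \sum_j v0 0 j.
Proof.
move=> l0; have sumE (u : 'rV[R]_m.+2) : \sum_j u 0 j = (u *m (const_mx 1 : 'cV_m.+2)) 0 0.
  by rewrite mxE; apply: eq_bigr => k _; rewrite mxE mulr1.
elim: n => [|n <-]; first by rewrite /erlang_law expr0 mulmx1.
by rewrite !sumE erlang_lawS -mulmxA resolvent_sum1.
Qed.

Lemma generator_mul_dist l (u : 'rV[R]_m.+2) k :
  (u *m generator l *m dist_mx i) 0 k = u 0 k * l k * kink i k.
Proof.
have -> : generator l = diag_mx (\row_j l j) *m unit_generator i.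
  by apply/matrixP => j c; rewrite mul_diag_mx !mxE.
rewrite -!mulmxA mxE (bigD1 k) //= mul_diag_mx [X in _ * X]mxE (generator_dist hi) eqxx.
rewrite big1 ?addr0; first by rewrite !mxE mulr1 !mulrA.
move=> j /negPf jk; rewrite [X in _ * X]mxE (generator_dist hi) jk.
by rewrite !mulr0.
Qed.

(** The key identity: an exponential step raises the potential at k in proportion
to the rate and the final mass at k, and to these only. *)
Lemma erlang_law_potential l n k : (forall j, 0 <= l j) ->
  (erlang_law l n.+1 *m dist_mx i) 0 k - (erlang_law l n *m dist_mx i) 0 k =
  s * (erlang_law l n.+1 0 k * l k * kink i k).
Proof.
move=> l0; rewrite -generator_mul_dist -[in X in _ - X](erlang_law_step _ l0).
by rewrite mulmxBr mulmx1 mulmxBl -scalemxAr -scalemxAl !mxE; ring.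
Qed.

Variable p : 'rV[R]_m.+2.
Hypothesis p0 : forall j, 0 < p 0 j.
Hypothesis sum_v0_p : \sum_j v0 0 j = \sum_j p 0 j.
Hypothesis dist_le : forall k, (v0 *m dist_mx i) 0 k <= (p *m dist_mx i) 0 k.
Hypothesis dist_eq : forall k, ~~ inner_state k ->
  (v0 *m dist_mx i) 0 k = (p *m dist_mx i) 0 k.

Let D := dist_mx i.

(** The potentials of xi = erlang_law l n.+1 - p satisfy xi D = xi (s L) D, and both D, on
vectors of mass zero, and 1 - s L are injective. *)
Lemma fixpoint_rates l n : (forall j, 0 <= l j) -> (forall j, ~~ inner_state j -> l j = 0) ->
  (forall k, inner_state k ->
    l k * (s * kink i k * p 0 k) = Num.max 0 ((p *m D) 0 k - (erlang_law l n *m D) 0 k)) ->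
  erlang_law l n.+1 = p.
Proof.
move=> l0 lext lfix.
have potential0 k j : l k = 0 -> (erlang_law l j *m D) 0 k = (v0 *m D) 0 k.
  move=> lk; elim: j => [|j <-]; first by rewrite /erlang_law expr0 mulmx1.
  by apply/eqP; rewrite -subr_eq0 erlang_law_potential // lk mulr0 mul0r mulr0.
pose xi := erlang_law l n.+1 - p.
have xik k : xi 0 k = erlang_law l n.+1 0 k - p 0 k by rewrite mxE [X in _ + X]mxE.
have key k : (xi *m D) 0 k = s * (xi 0 k * l k * kink i k).
  have xiE : (xi *m D) 0 k = (erlang_law l n.+1 *m D) 0 k - (p *m D) 0 k.
    by rewrite mulmxBl !mxE.
  have [lk0|lk0] := eqVneq (l k) 0.
    rewrite xiE potential0 // lk0 mulr0 mul0r mulr0; apply/eqP; rewrite subr_eq0.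
    have [kin|kext] := boolP (inner_state k); last by rewrite dist_eq.
    rewrite eq_le dist_le /=; have := lfix _ kin; rewrite lk0 mul0r potential0 // => /esym/eqP.
    by rewrite eq_maxl subr_le0.
  have kin : inner_state k by apply: contraNT lk0 => kext; rewrite lext.
  have lkp : 0 < l k by rewrite lt_neqAle eq_sym lk0 l0.
  have := lfix _ kin; rewrite /Num.max; case: ifP => _; last first.
    move=> /eqP; rewrite !mulf_eq0 (negPf lk0) (gt_eqF s0) (gt_eqF (kink_gt0 hi kin)).
    by rewrite (gt_eqF (p0 _)).
  move=> e; have := erlang_law_potential n k l0; rewrite -/D => e2.
  rewrite xiE xik; transitivity (((erlang_law l n.+1 *m D) 0 k - (erlang_law l n *m D) 0 k) -
    ((p *m D) 0 k - (erlang_law l n *m D) 0 k)); first by ring.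
  by rewrite e2 -e; ring.
suff : xi = 0 by move/eqP; rewrite subr_eq0 => /eqP.
suff xiB : xi *m inv_resolvent l = 0.
  by rewrite -(mulmxK (inv_resolvent_unit l0) xi) xiB mul0mx.
apply: (dist_mx_inj hi).
  have e u : \sum_j (u *m inv_resolvent l) 0 j = \sum_j u 0 j.
    rewrite mulmxBr mulmx1 -scalemxAr.
    under eq_bigr do rewrite !mxE; rewrite sumrB -mulr_sumr exchange_big /=.
    rewrite [X in s * X]big1 ?mulr0 ?subr0 // => j _.
    by rewrite -mulr_sumr generator_sum1 mulr0.
  rewrite e; under eq_bigr do rewrite xik.
  by rewrite sumrB erlang_law_sum1 // sum_v0_p subrr.
apply/rowP => k; rewrite mulmxBr mulmx1 mulmxBl -scalemxAr -scalemxAl.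
rewrite mxE [X in _ + X]mxE [X in _ - X]mxE generator_mul_dist -/D key.
by rewrite subrr mxE.
Qed.

(** Brouwer's theorem is applied with absolute values as rates, so that the map is
defined and continuous on all vectors. *)
Lemma exists_rates n : exists l : 'I_m.+2 -> R, [/\ forall j, 0 <= l j,
  forall j, ~~ inner_state j -> l j = 0 & erlang_law l n.+1 = p].
Proof.
pose W k := if inner_state k then (s * kink i k * p 0 k)^-1 else 0.
pose L (x : 'rV[R]_m.+2) (j : 'I_m.+2) := `|x 0 j|.
pose G k (x : 'rV[R]_m.+2) :=
  W k * Num.max 0 ((p *m D) 0 k - (erlang_law (L x) n *m D) 0 k).
have W0 k : 0 <= W k.
  rewrite /W; case: ifP => // kin; rewrite invr_ge0 !mulr_ge0 ?(ltW s0) ?(ltW (p0 _)) //.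
  exact: kink_ge0.
have D0 j k : 0 <= D j k by rewrite mxE normr_ge0.
have pD0 k : 0 <= (p *m D) 0 k.
  by rewrite mxE sumr_ge0 // => j _; rewrite mulr_ge0 // ltW.
have L0 x j : 0 <= L x j by exact: normr_ge0.
(* The excess of the potential of p over that of a measure is at most the potential
of p itself, whatever the rates; this bounds the side of the cube. *)
pose C := \sum_k W k * (p *m D) 0 k.
have C0 : 0 <= C by apply: sumr_ge0 => k _; rewrite mulr_ge0.
have [k|k x _|x [xcube xfix]] := @brouwer_cube R m.+2 C C0 G.
- have Lc j : continuous (fun x => L x j).
    move=> x; apply: (@continuous_comp _ _ _ (fun x : 'rV[R]_m.+2 => x 0 j) Num.norm).
      exact: coord_continuous.
    exact: norm_continuous.
  have Bc : entrywise_continuous (fun x => inv_resolvent (L x)).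
    move=> j c; rewrite (_ : (fun x => _) =
      fun x => (1%:M : 'M[R]_m.+2) j c + (- (s * unit_generator i j c)) * L x j).
      apply: continuous_addf; first exact: continuous_cstf.
      by apply: continuous_mulf; [exact: continuous_cstf|exact: Lc].
    by apply/funext => x; rewrite !mxE; ring.
  have Ec j : entrywise_continuous (fun x => erlang_law (L x) j).
    elim: j => [|j IH].
      move=> a b; rewrite (_ : (fun x => _) = fun=> v0 a b); first exact: continuous_cstf.
      by apply/funext => x; rewrite /erlang_law expr0 mulmx1.
    rewrite (_ : (fun x => _) = fun x => erlang_law (L x) j *m resolvent (L x)).
      apply: continuous_mulmx => //; apply: continuous_invmx => // x.
      exact: inv_resolvent_unit.
    by apply/funext => x; rewrite erlang_lawS.
  apply: continuous_mulf; first exact: continuous_cstf.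
  pose F (x : 'rV[R]_m.+2) := (p *m D) 0 k - (erlang_law (L x) n *m D) 0 k.
  have Fc : continuous F.
    move=> x; apply: (@continuousB _ _ _ (fun=> (p *m D) 0 k)); first exact: cst_continuous.
    apply: continuous_mulmx; first exact: Ec.
    by move=> a b; exact: continuous_cstf.
  rewrite (_ : (fun x => _) = fun x => 2^-1 * (F x + `|F x|)).
    apply: continuous_mulf; first exact: continuous_cstf.
    apply: continuous_addf => // x.
    by apply: (@continuous_comp _ _ _ F Num.norm); [exact: Fc|exact: norm_continuous].
  apply/funext => x; rewrite -/(F x) /Num.max; case: ltP => F0.
    by rewrite gtr0_norm //; field.
  by rewrite ler0_norm // subrr mulr0.
- rewrite mulr_ge0 ?le_max ?lexx //=.
  apply: (@le_trans _ _ (W k * (p *m D) 0 k)).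
    rewrite ler_wpM2l // ge_max pD0 gerBl mxE sumr_ge0 // => j _.
    by rewrite mulr_ge0 // erlang_law_ge0.
  by rewrite /C (bigD1 k) //= lerDl sumr_ge0 // => j _; rewrite mulr_ge0.
have Lx : L x = x 0.
  by apply/funext => j; rewrite /L ger0_norm //; have /andP[] := xcube j.
exists (L x); split => // [j jext|].
  by rewrite Lx -xfix /G /W (negPf jext) mul0r.
apply: fixpoint_rates => // [j jext|k kin].
  by rewrite Lx -xfix /G /W (negPf jext) mul0r.
rewrite [in LHS]Lx -xfix /G /W kin mulrAC mulVf ?mul1r //.
by rewrite !mulf_neq0 ?gt_eqF ?(kink_gt0 hi).
Qed.

End resolvent.

(** * The jump at time zero *)

Section initial_law.
Variables (R : realType) (m : nat) (i : 'I_m.+2 -> R).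
Hypothesis hi : forall j k : 'I_m.+2, (j < k)%N -> i j < i k.

(** The law to which the walk jumps at time 0.  If e0 is a state it is the point
mass at e0.  No state lies strictly between its two atoms, so at
the states its potential is that of the point mass at e0, the least among the laws
with mean e0. *)
Record split_law (e0 : R) (v0 : 'rV[R]_m.+2) : Prop := SplitLaw {
  split_ge0 : forall j, 0 <= v0 0 j;
  split_sum1 : \sum_j v0 0 j = 1;
  split_mean : \sum_j v0 0 j * i j = e0;
  split_dist : forall k, (v0 *m dist_mx i) 0 k = `|e0 - i k|;
  split_mid : forall l j : 'I_m.+2, j = l.+1 :> nat -> i l < e0 < i j ->
    v0 0 j = (e0 - i l) / (i j - i l) /\ v0 0 l = (i j - e0) / (i j - i l);
  split_state : forall j, e0 = i j -> v0 0 j = 1 }.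

Lemma exists_split_law e0 : pos i 0 <= e0 <= pos i m.+1 -> exists v0, split_law e0 v0.
Proof.
move=> /andP[e0ge e0le].
have [n nm /andP[en en1]] : exists2 n, (n <= m)%N & pos i n <= e0 <= pos i n.+1.
  have [k] := @ex_minnP (fun n => e0 <= pos i n.+1) (ex_intro _ m e0le).
  move=> ek kmin; exists k; first exact: kmin.
  rewrite ek andbT; case: k kmin {ek} => // k kmin.
  by rewrite leNgt; apply/negP => /ltW/kmin; rewrite ltnn.
have gap0 : 0 < pos i n.+1 - pos i n by rewrite subr_gt0 (pos_lt hi).
pose a := (pos i n.+1 - e0) / (pos i n.+1 - pos i n).
pose b := (e0 - pos i n) / (pos i n.+1 - pos i n).
have a0 : 0 <= a by rewrite divr_ge0 ?(ltW gap0) // subr_ge0.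
have b0 : 0 <= b by rewrite divr_ge0 ?(ltW gap0) // subr_ge0.
have ab : a + b = 1 by rewrite /a /b; field; lra.
have abe : a * pos i n + b * pos i n.+1 = e0 by rewrite /a /b; field; lra.
pose v : 'rV[R]_m.+2 := \row_k ((k == n :> nat)%:R * a + (k == n.+1 :> nat)%:R * b).
have vsum (f : 'I_m.+2 -> R) : \sum_k v 0 k * f k = a * f (inord n) + b * f (inord n.+1).
  under eq_bigr do rewrite mxE mulrDl !(mulrAC _ _ (f _)).
  by rewrite big_split /= -!mulr_suml !sum_eq_nat ?(mulrC (f _)) //; lia.
exists v; split.
- by move=> j; rewrite mxE addr_ge0 // mulr_ge0 // ler0n.
- have := vsum (fun=> 1); under eq_bigr do rewrite mulr1.
  by move=> ->; rewrite !mulr1.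
- by rewrite (vsum i); exact: abe.
- move=> k; rewrite mxE; under eq_bigr do rewrite [dist_mx _ _ _]mxE.
  rewrite (vsum (fun j => `|i j - i k|)) -/(pos i _) -/(pos i _) -(pos_ord i k).
  have [kn|kn] := leqP k n.
    have ? : pos i k <= pos i n by apply: (pos_le hi) => //; lia.
    rewrite !ger0_norm; [|lra..].
    by rewrite -abe -[in RHS](mul1r (pos i k)) -ab; ring.
  have ? : pos i n.+1 <= pos i k by apply: (pos_le hi) => //; rewrite -ltnS.
  rewrite !ler0_norm; [|lra..].
  by rewrite -abe -[in RHS](mul1r (pos i k)) -ab; ring.
- move=> l j jl /andP[le ej].
  have nl : n = l.
    move: le ej; rewrite -!(pos_ord i) => le ej; apply/eqP; rewrite eqn_leq.
    apply/andP; split; rewrite leqNgt; apply/negP => nl.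
      have : pos i j <= pos i n by apply: (pos_le hi); [rewrite jl|rewrite ltnW].
      by lra.
    have : pos i n.+1 <= pos i l by apply: (pos_le hi) => //; rewrite -ltnS ltn_ord.
    by lra.
  rewrite !mxE nl jl !eqxx /a /b nl -!(pos_ord i) jl.
  rewrite (gtn_eqF (ltnSn l)) (ltn_eqF (ltnSn l)).
  by rewrite !mul0r ?add0r ?addr0 !mul1r.
- move=> j ej.
  have [jn|jn|jn] := ltngtP j n.
  + have : pos i j < pos i n by apply: (pos_lt hi) => //; lia.
    by move: en; rewrite ej -(pos_ord i); lra.
  + have jn1 : j = n.+1 :> nat.
      apply/eqP; rewrite eqn_leq jn andbT leqNgt; apply/negP => jn1.
      have : pos i n.+1 < pos i j by apply: (pos_lt hi) => //; rewrite -ltnS.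
      by move: en1; rewrite ej -(pos_ord i); lra.
    rewrite mxE jn1 eqxx (_ : (n.+1 == n) = false); last by lia.
    rewrite mul0r add0r mul1r /b ej -(pos_ord i) jn1 divff //; lra.
  + rewrite mxE jn eqxx (_ : (n == n.+1) = false); last by lia.
    rewrite mul0r addr0 mul1r /a ej -(pos_ord i) jn divff //; lra.
Qed.

Variables (p : 'I_m.+2 -> R) (e0 : R).
Hypothesis hp : forall j, 0 < p j.
Hypothesis hp1 : \sum_j p j = 1.
Hypothesis he0 : e0 = \sum_j i j * p j.

Lemma barycenter_bounds : pos i 0 <= e0 <= pos i m.+1.
Proof.
have e c : pos i c = \sum_j pos i c * p j by rewrite -mulr_sumr hp1 mulr1.
rewrite he0; apply/andP; split; rewrite [pos i _]e; apply: ler_sum => j _;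
  rewrite ler_wpM2r ?(ltW (hp _)) // -(pos_ord i j) (pos_le hi) //.
  by rewrite -ltnS ltn_ord.
by rewrite -ltnS ltn_ord.
Qed.

(** The potential of p is at least |e0 - i_k| by Jensen's inequality, with equality at
the two extreme points, where |. - i_k| is affine on the whole range. *)
Theorem exists_split_rates (s : R) (n : nat) : 0 < s ->
  exists (v0 : 'rV[R]_m.+2) (l : 'I_m.+2 -> R),
    [/\ split_law e0 v0, forall j, 0 <= l j, forall j, ~~ inner_state j -> l j = 0 &
     forall j, erlang_law i s v0 l n.+1 0 j = p j].
Proof.
move=> s0; have [v0 v0P] := exists_split_law barycenter_bounds.
pose P : 'rV[R]_m.+2 := \row_j p j.
have PE k : (P *m dist_mx i) 0 k = \sum_j p j * `|i j - i k|.
  by rewrite mxE; apply: eq_bigr => j _; rewrite !mxE.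
have devE k : \sum_j p j * (i j - i k) = e0 - i k.
  under eq_bigr do rewrite mulrBr; rewrite sumrB -mulr_suml hp1 mul1r he0.
  by congr (_ - _); apply: eq_bigr => j _; rewrite mulrC.
have [||k|k kext|l [l0 lext lP]] := @exists_rates _ _ _ hi s s0 v0 (split_ge0 v0P) P _ _ _ _ n.
- by move=> j; rewrite mxE.
- by rewrite (split_sum1 v0P) -hp1; apply: eq_bigr => j _; rewrite mxE.
- rewrite (split_dist v0P) PE -devE (le_trans (ler_norm_sum _ _ _)) //.
  by apply: ler_sum => j _; rewrite normrM gtr0_norm.
- rewrite (split_dist v0P) PE -devE.
  have [k0|km] : k = 0%N :> nat \/ k = m.+1 :> nat.
    by move: kext; rewrite /inner_state; have := ltn_ord k; lia.
    have ik j : 0 <= i j - i k by rewrite subr_ge0 (i_le hi) // k0.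
    rewrite ger0_norm; last by apply: sumr_ge0 => j _; rewrite mulr_ge0 // ltW.
    by apply: eq_bigr => j _; rewrite ger0_norm.
  have ik j : i j - i k <= 0 by rewrite subr_le0 (i_le hi) // km -ltnS.
  rewrite ler0_norm; last first.
    by rewrite sumr_le0 // => j _; rewrite mulr_ge0_le0 // ltW.
  by rewrite -sumrN; apply: eq_bigr => j _; rewrite ler0_norm // mulrN.
- exists v0, l; split => // j; by rewrite lP mxE.
Qed.
End initial_law.

(** * Uniformization of the semigroup *)

Section poisson.
Variable R : realType.

Definition poisson_weight (u : R) (n : nat) : R := expR (- u) * exp_coeff u n.

Lemma poisson_weight_ge0 u n : 0 <= u -> 0 <= poisson_weight u n.
Proof. by move=> u0; rewrite mulr_ge0 ?expR_ge0 // exp_coeff_ge0. Qed.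

Lemma cvg_poisson_weight u : series (poisson_weight u) @ \oo --> (1 : R).
Proof.
rewrite -(expRxMexpNx_1 u) mulrC.
rewrite (_ : series _ = fun n => expR (- u) * series (exp_coeff u) n).
  by apply: cvgMr; exact: is_cvg_series_exp_coeff.
by apply/funext => n; rewrite /series /= mulr_sumr.
Qed.

Lemma poisson_weightD u v k :
  poisson_weight (u + v) k = \sum_(0 <= i < k.+1) poisson_weight u i * poisson_weight v (k - i).
Proof.
rewrite /poisson_weight opprD expRD /exp_coeff /= addrC exprDn mulr_suml mulr_sumr big_mkord.
apply: eq_bigr => -[j /=]; rewrite ltnS => jk _.
rewrite -mulr_natr -(bin_fact jk) !natrM.
have f0 n : (n`!%:R : R) != 0 by rewrite pnatr_eq0 -lt0n fact_gt0.
have b0 : ('C(k, j)%:R : R) != 0 by rewrite pnatr_eq0 -lt0n bin_gt0.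
by field; rewrite b0 !f0.
Qed.
End poisson.

Section semigroup.
Variables (R : realType) (m : nat) (K : 'M[R]_m.+1) (La : R).
Hypothesis K_ge0 : forall j k, 0 <= K j k.
Hypothesis K_sum1 : forall j, \sum_k K j k = 1.
Hypothesis La0 : 0 <= La.

Definition uniformized_sum (N : nat) (t : R) : 'M[R]_m.+1 :=
  \sum_(0 <= n < N) poisson_weight (La * t) n *: K ^+ n.

(** Uniformization: K is the transition matrix of a discrete chain that is moved at the
events of a Poisson process of rate La. *)
Definition transition (t : R) : 'M[R]_m.+1 :=
  \matrix_(j, k) limn (fun N => uniformized_sum N t j k).

Lemma pow_ge0 n j k : 0 <= (K ^+ n) j k.
Proof.
elim: n j k => [|n IH] j k; first by rewrite expr0 mxE ler0n.
by rewrite exprS mxE sumr_ge0 // => c _; rewrite mulr_ge0.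
Qed.

Lemma pow_harmonic (f : 'I_m.+1 -> R) : (forall j, \sum_k K j k * f k = f j) ->
  forall n j, \sum_k (K ^+ n) j k * f k = f j.
Proof.
move=> Kf; elim=> [|n IH] j.
  rewrite (bigD1 j) //= expr0 mxE eqxx mul1r big1 ?addr0 // => k /negPf kj.
  by rewrite mxE eq_sym kj mul0r.
under eq_bigr do rewrite exprS mxE mulr_suml.
rewrite exchange_big /= -[RHS]Kf; apply: eq_bigr => c _.
by under eq_bigr do rewrite -mulrA; rewrite -mulr_sumr IH.
Qed.

Lemma pow_sum1 n j : \sum_k (K ^+ n) j k = 1.
Proof.
have := @pow_harmonic (fun=> 1) _ n j; under eq_bigr do rewrite mulr1.
by apply=> c; under eq_bigr do rewrite mulr1.
Qed.

Lemma pow_le1 n j k : (K ^+ n) j k <= 1.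
Proof. by rewrite -(pow_sum1 n j) (bigD1 k) //= lerDl sumr_ge0 // => c _; rewrite pow_ge0. Qed.

Lemma uniformized_sumE N t j k : uniformized_sum N t j k =
  \sum_(0 <= n < N) poisson_weight (La * t) n * (K ^+ n) j k.
Proof. by rewrite /uniformized_sum summxE; apply: eq_bigr => n _; rewrite !mxE. Qed.

Section nonneg_time.
Variable t : R.
Hypothesis t0 : 0 <= t.
Let w_ge0 n : 0 <= poisson_weight (La * t) n.
Proof. by rewrite poisson_weight_ge0 // mulr_ge0. Qed.

Lemma cvg_transition j k :
  (fun N => uniformized_sum N t j k) @ \oo --> transition t j k.
Proof.
rewrite mxE.
suff : cvgn (fun N => uniformized_sum N t j k) by [].
rewrite (_ : (fun N => _) = series (fun n => poisson_weight (La * t) n * (K ^+ n) j k)).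
  apply: (@series_le_cvg _ _ (poisson_weight (La * t))) => //.
  - by move=> n; rewrite mulr_ge0 // pow_ge0.
  - by move=> n; rewrite ler_piMr // pow_le1.
  - by apply/cvg_ex; exists 1; exact: cvg_poisson_weight.
by apply/funext => N; rewrite uniformized_sumE.
Qed.

Lemma uniformized_sum_le N N' j k : (N <= N')%N ->
  uniformized_sum N t j k <= uniformized_sum N' t j k.
Proof.
move=> NN'; rewrite !uniformized_sumE (big_cat_nat (leq0n _) NN') //= lerDl sumr_ge0 // => n _.
by rewrite mulr_ge0 // pow_ge0.
Qed.

Lemma uniformized_sum_le_transition N j k : uniformized_sum N t j k <= transition t j k.
Proof.
rewrite mxE; apply: (@nondecreasing_cvgn_le _ (fun N => uniformized_sum N t j k)).
  by move=> a b ab; exact: uniformized_sum_le.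
by apply/cvg_ex; exists (transition t j k); exact: cvg_transition.
Qed.

Lemma uniformized_sum_ge0 N j k : 0 <= uniformized_sum N t j k.
Proof. by rewrite uniformized_sumE sumr_ge0 // => n _; rewrite mulr_ge0 // pow_ge0. Qed.

Lemma transition_ge0 j k : 0 <= transition t j k.
Proof. exact: le_trans (uniformized_sum_ge0 0 j k) (uniformized_sum_le_transition _ _ _). Qed.

(** Functions fixed by K are fixed by all its Poisson mixtures; with f = 1 this is
conservation of mass, and with f the identity it is the martingale property. *)
Lemma transition_harmonic (f : 'I_m.+1 -> R) : (forall j, \sum_k K j k * f k = f j) ->
  forall j, \sum_k transition t j k * f k = f j.
Proof.
move=> Kf j.
have cv1 : (fun N => \sum_k uniformized_sum N t j k * f k) @ \oo -->
    \sum_k transition t j k * f k.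
  apply: cvg_big => [|k _]; first exact: add_continuous.
  by apply: cvgMl; exact: cvg_transition.
have cv2 : (fun N => \sum_k uniformized_sum N t j k * f k) @ \oo --> f j.
  rewrite (_ : (fun N => _) = fun N => series (poisson_weight (La * t)) N * f j).
    by rewrite -[X in _ --> X]mul1r; apply: cvgMl; exact: cvg_poisson_weight.
  apply/funext => N; under eq_bigr do rewrite uniformized_sumE mulr_suml.
  rewrite exchange_big /= /series /= mulr_suml; apply: eq_bigr => n _.
  by under eq_bigr do rewrite -mulrA; rewrite -mulr_sumr pow_harmonic.
exact: cvg_unique cv1 cv2.
Qed.

Lemma transition_sum1 j : \sum_k transition t j k = 1.
Proof.
have := @transition_harmonic (fun=> 1) _ j; under eq_bigr do rewrite mulr1.
by apply=> c; under eq_bigr do rewrite mulr1.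
Qed.

Lemma transition_le1 j k : transition t j k <= 1.
Proof. by rewrite -(transition_sum1 j) (bigD1 k) //= lerDl sumr_ge0 // => c _; exact: transition_ge0. Qed.

End nonneg_time.

(** Cauchy products of nonnegative series: the square of partial sums is contained in
a triangle of twice the size. *)
Lemma sum_square_le_triangle (c : nat -> nat -> R) N : (forall a b, 0 <= c a b) ->
  \sum_(0 <= a < N) \sum_(0 <= b < N) c a b <=
  \sum_(0 <= k < N + N) \sum_(0 <= a < k.+1) c a (k - a)%N.
Proof.
move=> c0.
have -> : \sum_(0 <= k < N + N) \sum_(0 <= a < k.+1) c a (k - a)%N =
    \sum_(0 <= a < N + N) \sum_(a <= k < N + N) c a (k - a)%N.
  rewrite (eq_big_nat _ _ (F2 := fun k => \sum_(0 <= a < N + N | (a <= k)%N) c a (k - a)%N)).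
    rewrite (exchange_big_dep_nat predT) //=; apply: eq_big_nat => a /andP[_ aN].
    by rewrite [RHS](big_nat_widenl _ 0%N).
  by move=> k /andP[_ kN]; rewrite (big_nat_widen _ _ (N + N)).
rewrite (big_cat_nat (leq0n _) (leq_addr N N)) //= -[leLHS]addr0; apply: lerD; last first.
  by rewrite sumr_ge0 // => a _; rewrite sumr_ge0.
rewrite !big_nat; apply: ler_sum => a /andP[_ aN].
rewrite -{2}(add0n a) big_addn.
under [X in _ <= X]eq_bigr do rewrite addnK.
rewrite (@big_cat_nat _ _ _ N 0 (N + N - a)) //=; last by lia.
by rewrite lerDl sumr_ge0.
Qed.

(** The inequality between the entries comes from comparing partial sums.  As both
sides have row sums 1, it is an equality. *)
Lemma transitionD s t : 0 <= s -> 0 <= t ->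
  transition (s + t) = transition s *m transition t.
Proof.
move=> s0 t0; have st0 := addr_ge0 s0 t0.
have le_st j k : (transition s *m transition t) j k <= transition (s + t) j k.
  have cv : (fun N => (uniformized_sum N s *m uniformized_sum N t) j k) @ \oo -->
      (transition s *m transition t) j k.
    rewrite mxE (_ : (fun N => _) =
      fun N => \sum_c uniformized_sum N s j c * uniformized_sum N t c k).
      apply: cvg_big => [|c _]; first exact: add_continuous.
      by apply: cvgM; exact: cvg_transition.
    by apply/funext => N; rewrite mxE.
  rewrite -(cvg_lim _ cv) //; apply: limr_le; first by apply/cvg_ex; eexists; exact: cv.
  apply: nearW => N; apply: le_trans (uniformized_sum_le_transition st0 (N + N) j k).
  have -> : uniformized_sum N s *m uniformized_sum N t = \sum_(0 <= a < N) \sum_(0 <= b < N)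
      (poisson_weight (La * s) a * poisson_weight (La * t) b) *: K ^+ (a + b).
    rewrite /uniformized_sum mulmx_suml; apply: eq_bigr => a _.
    rewrite mulmx_sumr; apply: eq_bigr => b _.
    by rewrite -scalemxAl -scalemxAr scalerA exprD.
  rewrite uniformized_sumE summxE.
  under eq_bigr do rewrite summxE.
  under [X in _ <= X]eq_bigr do rewrite mulrDr poisson_weightD mulr_suml.
  pose c a b := poisson_weight (La * s) a * poisson_weight (La * t) b * (K ^+ (a + b)) j k.
  have c0 a b : 0 <= c a b.
    by rewrite mulr_ge0 ?pow_ge0 // mulr_ge0 // poisson_weight_ge0 // mulr_ge0.
  apply: le_trans (le_trans (sum_square_le_triangle N c0) _).
    by apply: ler_sum => a _; apply: ler_sum => b _; rewrite mxE.
  apply: ler_sum => n _; rewrite !big_nat; apply: ler_sum => a /andP[_]; rewrite ltnS => an.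
  by rewrite /c subnKC.
apply/matrixP => j k; apply/eqP; rewrite -subr_eq0.
have : \sum_k (transition (s + t) j k - (transition s *m transition t) j k) == 0.
  rewrite sumrB transition_sum1 // subr_eq0; apply/eqP.
  under eq_bigr do rewrite mxE; rewrite exchange_big /=.
  under eq_bigr do rewrite -mulr_sumr transition_sum1 // mulr1.
  by rewrite transition_sum1.
by rewrite psumr_eq0 => [/allP/(_ k)|c _]; [apply; rewrite mem_index_enum|rewrite subr_ge0].
Qed.

Lemma transition0 : transition 0 = 1%:M.
Proof.
apply/matrixP => j k.
suff cv : (fun N => uniformized_sum N 0 j k) @ \oo --> (1%:M : 'M[R]_m.+1) j k.
  by rewrite [LHS]mxE (cvg_lim _ cv).
apply: cvg_near_cst; exists 1%N => // N /= N1.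
rewrite uniformized_sumE mulr0 (big_cat_nat (leq0n _) N1) //= big_nat1 expr0.
rewrite big_nat big1 ?addr0 => [|n /andP[n1 _]].
  by rewrite /poisson_weight /exp_coeff /= oppr0 expR0 expr0 fact0 divr1 !mul1r.
by rewrite /poisson_weight /exp_coeff /= expr0n eqn0Ngt n1 mul0r mulr0 mul0r.
Qed.

(** The lower bound on the holding probability: K j j ^+ n is the probability of the
path that stays at j. *)
Lemma transition_diag_ge t j : 0 <= t -> expR (- (La * (1 - K j j) * t)) <= transition t j j.
Proof.
move=> t0.
have Kjj n : K j j ^+ n <= (K ^+ n) j j.
  elim: n => [|n IH]; first by rewrite !expr0 mxE eqxx.
  rewrite !exprS mxE (bigD1 j) //=; apply: le_trans (ler_wpM2l (K_ge0 j j) IH) _.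
  by rewrite lerDl sumr_ge0 // => c _; rewrite mulr_ge0 // pow_ge0.
have -> : - (La * (1 - K j j) * t) = - (La * t) + La * t * K j j by ring.
rewrite expRD.
have cv : (fun N => expR (- (La * t)) * series (exp_coeff (La * t * K j j)) N) @ \oo -->
    expR (- (La * t)) * expR (La * t * K j j).
  by apply: cvgMr; exact: is_cvg_series_exp_coeff.
rewrite -(cvg_lim _ cv) //; apply: limr_le; first by apply/cvg_ex; eexists; exact: cv.
apply: nearW => N; apply: le_trans (uniformized_sum_le_transition t0 N j j).
rewrite uniformized_sumE /series /= mulr_sumr; apply: ler_sum => n _.
rewrite /poisson_weight -[X in _ <= X]mulrA ler_wpM2l ?expR_ge0 //.
by rewrite /exp_coeff /= exprMn mulrAC ler_wpM2l // divr_ge0 ?ler0n // exprn_ge0 // mulr_ge0.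
Qed.

(** The contribution of two or more Poisson events is at most (La t)^2. *)
Lemma transition_first_order t j k : 0 <= t ->
  expR (- (La * t)) * ((j == k)%:R + La * t * K j k) <= transition t j k <=
  expR (- (La * t)) * ((j == k)%:R + La * t * K j k) + (La * t) ^+ 2.
Proof.
move=> t0; set u := La * t.
have u0 : 0 <= u by rewrite mulr_ge0.
have two N : \sum_(0 <= n < N.+2) poisson_weight u n * (K ^+ n) j k =
    expR (- u) * ((j == k)%:R + u * K j k) +
    \sum_(0 <= n < N) poisson_weight u n.+2 * (K ^+ n.+2) j k.
  rewrite big_nat_recl // big_nat_recl //= addrA; congr (_ + _).
  rewrite /poisson_weight /exp_coeff /= !expr0 !expr1 fact0 divr1 (_ : 1`! = 1%N) // divr1.
  by rewrite mxE mulr1 -mulrA -mulrDr.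
have two1 N : \sum_(0 <= n < N) poisson_weight u n.+2 <= u ^+ 2.
  have : \sum_(0 <= n < N.+2) poisson_weight u n <= 1.
    rewrite -/(series (poisson_weight u) N.+2).
    rewrite -(cvg_lim _ (@cvg_poisson_weight R u)) //; apply: nondecreasing_cvgn_le.
      apply/nondecreasing_seqP => n; rewrite /series /= big_nat_recr //= lerDl.
      exact: poisson_weight_ge0.
    by apply/cvg_ex; exists 1; exact: cvg_poisson_weight.
  rewrite big_nat_recl // big_nat_recl // /poisson_weight.
  rewrite {1 2}/exp_coeff /= expr0 expr1 fact0 divr1 (_ : 1`! = 1%N) // divr1 mulr1.
  rewrite addrA => H; rewrite -subr_ge0.
  have := expR_ge1Dx (- u) => e1.
  have : (1 - u) * (1 + u) <= expR (- u) * (1 + u).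
    by rewrite ler_wpM2r // addr_ge0.
  by move: H; set S := \sum_(_ <= _ < _) _; rewrite !expr2; nra.
apply/andP; split.
  apply: le_trans (uniformized_sum_le_transition t0 2 j k).
  by rewrite uniformized_sumE -/u two big_geq // addr0.
rewrite -(cvg_lim _ (@cvg_transition _ t0 j k)) //; apply: limr_le.
  by apply/cvg_ex; eexists; exact: cvg_transition.
apply: nearW => N; apply: le_trans (uniformized_sum_le t0 j k (leqW (leqnSn N))) _.
rewrite uniformized_sumE -/u two lerD2l; apply: le_trans (two1 N).
by apply: ler_sum => n _; rewrite ler_piMr ?pow_le1 // poisson_weight_ge0.
Qed.

(** The quadratic error is negligible when the bound is applied 2^k times with step
v / 2^k.  It is this upper bound that identifies the holding time law. *)
Lemma transition_diag_le t j : 0 <= t ->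
  transition t j j <= expR (- (La * (1 - K j j) * t)) + (La * t) ^+ 2.
Proof.
move=> t0; have /andP[_] := transition_first_order j j t0.
move/le_trans; apply; rewrite lerD2r eqxx.
have -> : - (La * (1 - K j j) * t) = - (La * t) + La * t * K j j by ring.
by rewrite expRD ler_wpM2l ?expR_ge0 // expR_ge1Dx.
Qed.

Lemma transition_stay t j : 0 <= t -> 1 - La * t <= transition t j j.
Proof.
move=> t0; apply: le_trans (transition_diag_ge j t0).
apply: le_trans (expR_ge1Dx _); rewrite lerD2l lerN2 -mulrA ler_wpM2l // ler_piMl //.
by rewrite gerBl.
Qed.

(** In time h the chain moves with probability at most La h. *)
Lemma transition_lipschitz s h j k : 0 <= s -> 0 <= h ->
  `|transition (s + h) j k - transition s j k| <= La * h.
Proof.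
move=> s0 h0; rewrite (addrC s h) transitionD // mxE (bigD1 j) //=.
have a1 := transition_stay j h0.
have b1 : transition h j j + \sum_(c | c != j) transition h j c = 1.
  by rewrite -(transition_sum1 h0 j) [RHS](bigD1 j).
have ps0 c := transition_ge0 s0 c k; have ps1 c := transition_le1 s0 c k.
have S0 : 0 <= \sum_(c | c != j) transition h j c * transition s c k.
  by rewrite sumr_ge0 // => c _; rewrite mulr_ge0 // transition_ge0.
have S1 : \sum_(c | c != j) transition h j c * transition s c k <=
    \sum_(c | c != j) transition h j c.
  by apply: ler_sum => c _; rewrite ler_piMr // transition_ge0.
have d1 := transition_le1 h0 j j.
have := ps0 j; have := ps1 j; move: b1 S0 S1 a1 d1.
set S := \sum_(_ | _) _; set S' := \sum_(_ | _) _.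
move: (transition h j j) (transition s j k) => x y.
by rewrite ler_norml; nra.
Qed.

Lemma transition_rate j k : j != k ->
  h^-1 * transition h j k @[h --> 0^'+] --> La * K j k.
Proof.
move=> jk.
have cvl : expR (- (La * h)) * (La * K j k) @[h --> 0^'+] --> La * K j k.
  have e : La * K j k = expR (- (La * 0)) * (La * K j k).
    by rewrite mulr0 oppr0 expR0 mul1r.
  rewrite [X in _ --> X]e.
  apply: cvgMl; apply: cvg_at_right_filter.
  have cont : continuous (fun h : R => - (La * h)).
    move=> x; apply: cvgN; apply: cvgM; first exact: cvg_cst.
    exact: cvg_id.
  apply: (@continuous_comp _ _ _ (fun h => - (La * h)) (@expR R) 0); first exact: cont.
  exact: continuous_expR.
have cvr : expR (- (La * h)) * (La * K j k) + La ^+ 2 * h @[h --> 0^'+] --> La * K j k.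
  have e : La * K j k = La * K j k + La ^+ 2 * 0 by rewrite mulr0 addr0.
  rewrite [X in _ --> X]e.
  by apply: cvgD cvl _; apply: cvg_at_right_filter; apply: cvgM; [exact: cvg_cst|exact: cvg_id].
apply: (squeeze_cvgr _ cvl cvr).
near=> h; have h0 : 0 < h by near: h; exact: nbhs_right_gt.
have := transition_first_order j k (ltW h0); rewrite (negPf jk) add0r => /andP[lo hi].
apply/andP; split.
  rewrite -(ler_pM2l h0) mulVKf ?gt_eqF //; apply: le_trans lo.
  by rewrite le_eqVlt; apply/orP; left; apply/eqP; ring.
rewrite -(ler_pM2l h0) mulVKf ?gt_eqF //; apply: le_trans hi _.
by rewrite le_eqVlt; apply/orP; left; apply/eqP; ring.
Unshelve. all: by end_near. Qed.

End semigroup.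

(** * Integration against the gamma density *)

Section density.
Context (R : realType).
Local Notation mu := (@lebesgue_measure R).
Import HBNNSimple.

(** A change of measure for nonnegative functions, from indicator functions to simple
functions and then by monotone convergence. *)
Lemma ge0_integral_density (nu : {measure set (measurableTypeR R) -> \bar R})
    (f : measurableTypeR R -> R) (h : measurableTypeR R -> \bar R) :
  (forall x, 0 <= f x) -> measurable_fun setT f ->
  (forall B, measurable B -> nu B = (\int[mu]_(x in B) (f x)%:E)%E) ->
  measurable_fun setT h -> (forall x, (0 <= h x)%E) ->
  (\int[nu]_x h x = \int[mu]_x (h x * (f x)%:E))%E.
Proof.
move=> f0 mf nuE mh h0.
have mfE : measurable_fun setT (EFin \o f) by exact/measurable_EFinP.
have nnsfunE (g : {nnsfun measurableTypeR R >-> R}) :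
    (\int[nu]_x (g x)%:E = \int[mu]_x ((g x)%:E * (f x)%:E))%E.
  transitivity (\sum_(k \in range g) k%:E * \int[mu]_x ((\1_(g @^-1` [set k]) x)%:E * (f x)%:E))%E.
    under eq_integral do rewrite fimfunE -fsumEFin//.
    rewrite ge0_integral_fsum//; last 2 first.
    - by move=> y; exact/measurable_EFinP/measurable_funM.
    - by move=> y x _; rewrite nnfun_muleindic_ge0.
    apply: eq_fsbigr => r _; rewrite integralZl_indic_nnsfun// integral_indic//= setIT.
    rewrite nuE//; congr (_ * _)%E; rewrite integral_mkcond; apply: eq_integral => x _.
    by rewrite patchE indicE; case: ifP => _; rewrite ?mul1e ?mul0e.
  under [RHS]eq_integral.
    move=> x _; rewrite fimfunE -fsumEFin// ge0_mule_fsuml; last first.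
      by move=> r; rewrite EFinM nnfun_muleindic_ge0.
    over.
  rewrite ge0_integral_fsum//; last 2 first.
  - move=> y; apply: emeasurable_funM => //; by apply/measurable_EFinP; apply: measurable_funM.
  - by move=> y x _; rewrite mule_ge0 ?lee_fin// -lee_fin EFinM nnfun_muleindic_ge0.
  apply: eq_fsbigr => r _.
  have [r0|r0] := leP 0 r; last first.
    rewrite (preimage_nnfun0 _ r0).
    transitivity (0%E : \bar R); last symmetry.
      by rewrite [X in (_ * X)%E]integral0_eq ?mule0 // => x _; rewrite indicE in_set0 mul0e.
    by rewrite integral0_eq // => x _; rewrite indicE in_set0 mulr0 mul0e.
  rewrite -ge0_integralZl_EFin//.
  - by apply: eq_integral => x _; rewrite EFinM muleA.
  - by move=> x _; rewrite mule_ge0 ?lee_fin// indicE ler0n.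
  - apply: emeasurable_funM => //; exact/measurable_EFinP.
pose h_ := nnsfun_approx measurableT mh.
transitivity (limn (fun n => \int[nu]_x (h_ n x)%:E))%E.
  rewrite -monotone_convergence//=.
  - apply: eq_integral => x _; apply/esym/cvg_lim => //=.
    by apply: cvg_nnsfun_approx => // y _; exact: h0.
  - by move=> n; exact/measurable_EFinP.
  - by move=> n x _; rewrite lee_fin.
  - by move=> x _ a b ab; rewrite lee_fin//; exact/lefP/nd_nnsfun_approx.
rewrite (_ : (fun n => _) = fun n => (\int[mu]_x ((h_ n x)%:E * (f x)%:E))%E); last first.
  by apply/funext => n; exact: nnsfunE.
rewrite -monotone_convergence//=.
- apply: eq_integral => x _; apply/cvg_lim => //=.
  apply: cvgeZr => //; apply: cvg_nnsfun_approx => // y _; exact: h0.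
- by move=> n; apply: emeasurable_funM => //; exact/measurable_EFinP.
- by move=> n x _; rewrite mule_ge0// lee_fin.
- move=> x _ a b ab; rewrite lee_wpmul2r ?lee_fin//; exact/lefP/nd_nnsfun_approx.
Qed.
End density.

Section gamma_integral.
Context (R : realType).
Local Notation mu := (@lebesgue_measure R).
Variable c : R.
Hypothesis c0 : 0 < c.

(** Repeated integration by parts of x^n exp (- c x). *)
Fixpoint gamma_primitive (n : nat) (x : R) : R :=
  - (x ^+ n * expR (- c * x)) / c + (if n is k.+1 then n%:R / c * gamma_primitive k x else 0).

Lemma is_derive_gamma_primitive n (x : R) :
  is_derive x 1 (gamma_primitive n) (x ^+ n * expR (- c * x)).
Proof.
have c1 : c != 0 by rewrite gt_eqF.
have dlin : is_derive x 1 (fun y : R => - c * y) (- c).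
  by apply: is_derive_eq; rewrite /GRing.scale /= mulr1.
have dexp : is_derive x 1 (fun y : R => expR (- c * y)) (expR (- c * x) * - c).
  exact: (is_derive1_comp (is_derive_expR (- c * x)) dlin).
have dmon k : is_derive x 1 (fun y : R => - (y ^+ k * expR (- c * y)) / c)
    ((x ^+ k * expR (- c * x)) - k%:R / c * (x ^+ k.-1 * expR (- c * x))).
  have dX : is_derive x 1 (fun y : R => y ^+ k) (k%:R * x ^+ k.-1).
    rewrite (_ : (fun y : R => y ^+ k) = (id : R -> R) ^+ k); last by rewrite exprfctE.
    by apply: is_derive_eq; rewrite /GRing.scale /= mulr1.
  have -> : (fun y : R => - (y ^+ k * expR (- c * y)) / c) =
      (- c^-1) \*: ((fun y : R => y ^+ k) * (fun y => expR (- c * y))).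
    by apply/funext => y; rewrite mulNr mulrC -mulNr.
  apply: is_derive_eq.
  by rewrite /GRing.scale /=; field.
elim: n => [|n IH] /=.
  have dm := dmon 0%N.
  rewrite (_ : (fun y => _) = (fun y : R => - (y ^+ 0 * expR (- c * y)) / c) + cst 0) //.
  apply: is_derive_eq.
  by rewrite mul0r mul0r subr0 addr0.
have dm := dmon n.+1.
rewrite (_ : (fun y => _) = (fun y : R => - (y ^+ n.+1 * expR (- c * y)) / c) +
  (n.+1%:R / c) \*: gamma_primitive n) //.
apply: is_derive_eq.
by rewrite /GRing.scale /= subrK.
Qed.

Lemma cvg_monomial_expN n : x ^+ n * expR (- c * x) @[x --> +oo] --> (0 : R).
Proof.
(* The bound y <= exp y at y = c x / (n + 1), raised to the power n + 1. *)
pose C : R := (n.+1%:R / c) ^+ n.+1.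
apply: (@squeeze_cvgr _ _ _ _ (fun=> 0) (fun x => C * x^-1)).
- near=> x; have x0 : 0 < x by near: x; exact: nbhs_pinfty_gt.
  apply/andP; split; first by rewrite mulr_ge0 ?expR_ge0 // exprn_ge0 // ltW.
  rewrite mulNr expRN ler_pdivrMr ?expR_gt0 // mulrAC -ler_pdivrMr ?invr_gt0 // invrK -exprSr.
  have {1}-> : c * x = n.+1%:R * (c * x / n.+1%:R).
    by rewrite [RHS]mulrC divfK // pnatr_eq0.
  rewrite expRM_natl.
  have -> : x ^+ n.+1 = C * (c * x / n.+1%:R) ^+ n.+1.
    by rewrite -exprMn; congr (_ ^+ _); field; apply/andP; split; [rewrite nat1r pnatr_eq0|rewrite gt_eqF].
  rewrite ler_wpM2l ?exprn_ge0 ?divr_ge0 ?ler0n ?(ltW c0) //.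
  rewrite lerXn2r ?nnegrE ?expR_ge0 ?divr_ge0 ?mulr_ge0 ?ler0n ?(ltW c0) ?(ltW x0) //.
  by apply: le_trans (expR_ge1Dx _); rewrite lerDr.
- exact: cvg_cst.
- rewrite -[X in _ --> X](mulr0 C); apply: cvgMr.
  apply/gtr0_cvgV0; last exact: cvg_id.
  exact: nbhs_pinfty_gt.
Unshelve. all: by end_near. Qed.

Lemma cvg_gamma_primitive n : gamma_primitive n x @[x --> +oo] --> (0 : R).
Proof.
have e k : (fun x => - (x ^+ k * expR (- c * x)) / c) @ +oo --> (0 : R).
  rewrite -[X in _ --> X](mul0r c^-1) -oppr0; apply: cvgMl; apply: cvgN.
  exact: cvg_monomial_expN.
elim: n => [|n IH] /=.
  by under eq_fun do rewrite addr0; exact: e.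
rewrite -[X in _ --> X](addr0 0); apply: cvgD; first exact: (e n.+1).
by rewrite -[X in _ --> X](mulr0 (n.+1%:R / c)); apply: cvgMr.
Qed.

Lemma gamma_primitive0 n : gamma_primitive n 0 = - (n`!%:R / c ^+ n.+1).
Proof.
have c1 : c != 0 by rewrite gt_eqF.
elim: n => [|n IH] /=; first by rewrite mulr0 expR0 expr0 fact0 expr1 addr0 mul1r mulNr.
rewrite IH expr0n /= mul0r oppr0 mul0r add0r factS natrM !exprS; field.
by rewrite c1 expf_neq0.
Qed.

Lemma continuous_monomial_exp n : continuous (fun x : R => x ^+ n * expR (- c * x)).
Proof.
apply: continuous_mulf; first exact: exprn_continuous.
move=> x; apply: (@continuous_comp _ _ _ (fun x => - c * x) (@expR R)).
  exact: mulrl_continuous.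
exact: continuous_expR.
Qed.

Lemma integral_monomial_exp n :
  (\int[mu]_(x in `[0%R, +oo[) (x ^+ n * expR (- c * x))%:E = (n`!%:R / c ^+ n.+1)%:E)%E.
Proof.
have cP : continuous (gamma_primitive n).
  by move=> x; apply: differentiable_continuous; apply/derivable1_diffP;
    apply: ex_derive; exact: is_derive_gamma_primitive.
rewrite (@ge0_continuous_FTC2y _ _ (gamma_primitive n) 0 0).
- by rewrite gamma_primitive0 EFinN oppeK add0e.
- by move=> x x0; rewrite mulr_ge0 ?expR_ge0 // exprn_ge0.
- by apply: continuous_subspaceT; exact: continuous_monomial_exp.
- exact: cvg_gamma_primitive.
- by move=> x _; apply: ex_derive; exact: is_derive_gamma_primitive.
- by apply: cvg_at_right_filter; exact: cP.
- by move=> x _; rewrite derive1E; apply: derive_val; exact: is_derive_gamma_primitive.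
Qed.
End gamma_integral.

(** * The law at a gamma time *)

Section negative_binomial.
Variables (R : realType) (m : nat) (K : 'M[R]_m.+1) (La s : R).
Hypothesis K_ge0 : forall j k, 0 <= K j k.
Hypothesis K_sum1 : forall j, \sum_k K j k = 1.
Hypothesis La0 : 0 <= La.
Hypothesis s0 : 0 < s.

Let th := (1 + s * La)^-1.
Let sLa0 : 0 <= s * La. Proof. by rewrite mulr_ge0 // ltW. Qed.
Let th1 : 1 - th = s * La * th.
Proof. by rewrite /th; field; have := sLa0; lra. Qed.
Let th_ge0 : 0 <= th. Proof. by rewrite invr_ge0 addr_ge0. Qed.
Let th1_ge0 : 0 <= 1 - th. Proof. by rewrite th1 mulr_ge0. Qed.

(** The negative binomial weight: the probability of n Poisson events of rate La before
a gamma time of shape q and scale s. *)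
Definition nb_weight (q n : nat) : R :=
  'C((n + q).-1, n)%:R * (1 + s * La)^-1 ^+ q * (1 - (1 + s * La)^-1) ^+ n.

Lemma nb_weight_ge0 q n : 0 <= nb_weight q n.
Proof. by rewrite mulr_ge0 ?exprn_ge0 // mulr_ge0 ?ler0n // exprn_ge0. Qed.

Lemma nb_weight0 q : nb_weight q 0 = th ^+ q.
Proof. by rewrite /nb_weight bin0 expr0 mulr1 mul1r. Qed.

(** The current exponential stage ends before the next Poisson event or sees it. *)
Lemma nb_weightS q n :
  nb_weight q.+1 n.+1 = th * nb_weight q n.+1 + (1 - th) * nb_weight q.+1 n.
Proof.
rewrite /nb_weight addSn addnS /= -/th binS natrD !exprS; ring.
Qed.

Lemma nb_weight_sum_le1 q N : \sum_(0 <= n < N) nb_weight q n <= 1.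
Proof.
elim: q N => [|q IHq] N.
  case: N => [|N]; first by rewrite big_geq.
  rewrite big_nat_recl // nb_weight0 expr0 big_nat big1 ?addr0 // => n _.
  by rewrite /nb_weight addn0 /= bin_small // !mul0r.
elim: N => [|N IHN]; first by rewrite big_geq.
rewrite big_nat_recl // nb_weight0.
under eq_bigr do rewrite nb_weightS.
rewrite big_split /= -!mulr_sumr addrA exprS -mulrDr.
have := IHq N.+1; rewrite big_nat_recl // nb_weight0.
move: IHN; set A := \sum_(_ <= _ < _) _; set B := \sum_(_ <= _ < _) _ => A1 B1.
have := ler_wpM2l th_ge0 B1; have := ler_wpM2l th1_ge0 A1; lra.
Qed.

Lemma cvg_nb_weight q : nb_weight q @ \oo --> (0 : R).
Proof.
apply: cvg_series_cvg_0; apply: nondecreasing_is_cvgn.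
  by apply/nondecreasing_seqP => n; rewrite /series /= big_nat_recr //= lerDl nb_weight_ge0.
by exists 1 => _ [N _ <-]; exact: nb_weight_sum_le1.
Qed.

Variable v : 'rV[R]_m.+1.
Hypothesis v_ge0 : forall j, 0 <= v 0 j.

Definition nb_sum q N : 'rV[R]_m.+1 := \sum_(0 <= n < N) nb_weight q n *: (v *m K ^+ n).
(** This is 1 - s La (K - 1), that is, the matrix 1 - s L for the generator L = La (K - 1). *)
Definition uniform_inv_resolvent : 'M[R]_m.+1 := (1 + s * La)%:M - (s * La) *: K.

(** One more exponential stage amounts to dividing by 1 - s L, up to the last term of the
partial sum. *)
Lemma nb_sum_step q N : nb_sum q.+1 N.+1 *m uniform_inv_resolvent =
  nb_sum q N.+1 - (s * La * nb_weight q.+1 N) *: (v *m K ^+ N.+1).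
Proof.
have rec : nb_sum q.+1 N.+1 = th *: nb_sum q N.+1 + (1 - th) *: (nb_sum q.+1 N *m K).
  rewrite /nb_sum big_nat_recl // nb_weight0.
  under eq_bigr do rewrite nb_weightS scalerDl.
  rewrite big_split /= [in RHS]big_nat_recl // nb_weight0 scalerDr scalerA -exprS -addrA.
  congr (_ + _); congr (_ + _).
    by rewrite scaler_sumr; apply: eq_bigr => n _; rewrite scalerA.
  rewrite mulmx_suml scaler_sumr; apply: eq_bigr => n _.
  by rewrite -scalemxAl scalerA exprSr mulmxA.
have last_term : nb_sum q.+1 N = nb_sum q.+1 N.+1 - nb_weight q.+1 N *: (v *m K ^+ N).
  by rewrite /nb_sum big_nat_recr //= addrK.
have vK : v *m K ^+ N *m K = v *m K ^+ N.+1 by rewrite exprSr mulmxA.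
rewrite last_term mulmxBl -scalemxAl vK scalerBr scalerA in rec.
have sL1 : (1 + s * La) * th = 1 by rewrite /th mulfV // gt_eqF // ltr_pwDl.
have sL2 : (1 + s * La) * (1 - th) = s * La by rewrite mulrBr mulr1 sL1; ring.
rewrite /uniform_inv_resolvent mulmxBr mul_mx_scalar -scalemxAr [in X in X - _]rec.
rewrite !scalerDr scalerN !scalerA sL1 scale1r mulrA sL2.
by rewrite addrA addrAC addrK.
Qed.

Lemma pow_bounded n j : `|(v *m K ^+ n) 0 j| <= \sum_k v 0 k.
Proof.
rewrite mxE ger0_norm; last by apply: sumr_ge0 => k _; rewrite mulr_ge0 // pow_ge0.
by apply: ler_sum => k _; rewrite ler_piMr // (pow_le1 K_ge0 K_sum1).
Qed.

Lemma cvg_nb_sum q j : uniform_inv_resolvent \in unitmx ->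
  (fun N => nb_sum q N 0 j) @ \oo --> (v *m (invmx uniform_inv_resolvent) ^+ q) 0 j.
Proof.
move=> Bu; rewrite -cvg_shiftS /=; elim: q j => [|q IH] j.
  apply: cvg_near_cst; apply: nearW => N.
  rewrite /nb_sum big_nat_recl // nb_weight0 !expr0 scale1r big_nat big1 ?addr0 // => n _.
  by rewrite /nb_weight addn0 /= bin_small // !mul0r scale0r.
rewrite exprSr mulmxA mxE.
rewrite (_ : (fun N => _) = fun N => \sum_k (nb_sum q N.+1 0 k -
    s * La * nb_weight q.+1 N * (v *m K ^+ N.+1) 0 k) * invmx uniform_inv_resolvent k j).
  apply: cvg_big => [|k _]; first exact: add_continuous.
  apply: cvgMl; rewrite -[X in _ --> X]subr0; apply: cvgB; first exact: IH.
  apply: (@squeeze_cvgr _ _ _ _ (fun N => - (s * La * (\sum_k v 0 k) * nb_weight q.+1 N))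
    (fun N => s * La * (\sum_k v 0 k) * nb_weight q.+1 N)).
  - apply: nearW => N; rewrite -ler_norml normrM [X in X * _]ger0_norm; last first.
      by rewrite mulr_ge0 // nb_weight_ge0.
    by rewrite mulrAC ler_wpM2r ?nb_weight_ge0 // ler_wpM2l // pow_bounded.
  - rewrite -[X in _ --> X]oppr0 -[X in - X](mulr0 (s * La * (\sum_k v 0 k))).
    apply: cvgN; apply: cvgMr.
    exact: cvg_nb_weight.
  - rewrite -[X in _ --> X](mulr0 (s * La * (\sum_k v 0 k))); apply: cvgMr.
    exact: cvg_nb_weight.
apply/funext => N; rewrite -(mulmxK Bu (nb_sum q.+1 N.+1)) nb_sum_step mxE.
by apply: eq_bigr => k _; rewrite !mxE.
Qed.

End negative_binomial.

Section erlang_time.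
Variables (R : realType) (m : nat) (K : 'M[R]_m.+1) (La : R).
Hypothesis K_ge0 : forall j k, 0 <= K j k.
Hypothesis K_sum1 : forall j, \sum_k K j k = 1.
Hypothesis La0 : 0 <= La.
Variables (q : nat) (t : R).
Hypothesis t0 : 0 < t.
Local Notation mu := (@lebesgue_measure R).
Local Notation c := (q.+1%:R / t).
Local Notation s := (t / q.+1%:R).

Let c0 : 0 < c. Proof. by rewrite divr_gt0 // ltr0n. Qed.
Let s0 : 0 < s. Proof. by rewrite divr_gt0 // ltr0n. Qed.

Lemma gamma_time_pdf_ge0 x : 0 <= gamma_time_pdf q.+1 t x.
Proof.
rewrite /gamma_time_pdf; case: ifP => // x0.
rewrite mulr_ge0 ?expR_ge0 // mulr_ge0 ?exprn_ge0 // mulr_ge0 ?exprn_ge0 ?(ltW c0) //.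
rewrite invr_ge0 /Gamma; apply: Rintegral_ge0 => y _.
by rewrite mulr_ge0 ?expR_ge0 // powR_ge0.
Qed.

Lemma gamma_time_pdfE (g : R -> \bar R) :
  (\int[mu]_x (g x * (gamma_time_pdf q.+1 t x)%:E) =
   \int[mu]_(x in `[0%R, +oo[) (g x *
    ((Gamma q.+1%:R)^-1 * c ^+ q.+1 * (x ^+ q * expR (- c * x)))%:E))%E.
Proof.
rewrite [RHS]integral_mkcond; apply: eq_integral => x _.
rewrite patchE /gamma_time_pdf; case: ifPn => x0.
  rewrite ifT; last by rewrite inE /= in_itv /= x0.
  by rewrite mulrA mulNr (mulrAC _ t^-1).
by rewrite mule0 ifF // memNset //= in_itv /= andbT; exact/negP.
Qed.

Lemma measurable_gamma_time_pdf :
  measurable_fun setT (gamma_time_pdf q.+1 t : measurableTypeR R -> R).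
Proof.
apply: measurable_fun_if => //.
- exact: measurable_fun_ler.
- apply/measurable_funTS/measurable_funM.
    by apply: measurable_funM => //; apply: measurable_funX.
  apply: measurableT_comp => //; apply: measurableT_comp => //.
  by apply: measurable_funM => //; apply: measurable_funM.
Qed.

Context d0 (T0 : measurableType d0) (P0 : probability T0 R) (tau : {RV P0 >-> R}).
Hypothesis tau_ge0 : forall w, 0 <= tau w.
Hypothesis tau_density : has_density P0 tau (gamma_time_pdf q.+1 t).

Let kappa := (Gamma q.+1%:R)^-1 * c ^+ q.+1.

(** A density has total mass 1, which determines the normalizing constant. *)
Lemma gamma_normalization : kappa = c ^+ q.+1 / q`!%:R.
Proof.
have := @tau_density setT measurableT; rewrite preimage_setT probability_setT.
rewrite (_ : \int[mu]_(x in setT) _ = \int[mu]_x (1 * (gamma_time_pdf q.+1 t x)%:E))%E; last first.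
  by apply: eq_integral => x _; rewrite mul1e.
rewrite (gamma_time_pdfE (fun=> 1%E)); under eq_integral do rewrite mul1e EFinM.
rewrite -/kappa ge0_integralZl_EFin //=; last 3 first.
- by move=> x /=; rewrite in_itv /= andbT => x0; rewrite lee_fin mulr_ge0 ?expR_ge0 ?exprn_ge0.
- apply/measurable_EFinP/measurable_funTS; apply: continuous_measurable_fun.
  exact: continuous_monomial_exp.
- rewrite mulr_ge0 ?exprn_ge0 ?(ltW c0) // invr_ge0; apply: Rintegral_ge0 => y _.
  by rewrite mulr_ge0 ?expR_ge0 // powR_ge0.
rewrite integral_monomial_exp // -EFinM => -[e].
have f0 : (q`!%:R : R) != 0 by rewrite pnatr_eq0 -lt0n fact_gt0.
have cq : c ^+ q.+1 != 0 by rewrite expf_neq0 // gt_eqF.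
have X0 : q`!%:R / c ^+ q.+1 != 0 by rewrite mulf_neq0 // invr_neq0.
by rewrite -[LHS](mulfK X0) -e div1r invf_div.
Qed.

Variable v : 'rV[R]_m.+1.
Hypothesis v_ge0 : forall j, 0 <= v 0 j.

Let vK_ge0 n j : 0 <= (v *m K ^+ n) 0 j.
Proof. by rewrite mxE sumr_ge0 // => k _; rewrite mulr_ge0 // pow_ge0. Qed.

Let H (j : 'I_m.+1) (x : measurableTypeR R) : \bar R :=
  (\sum_(n <oo) ((v *m K ^+ n) 0 j * poisson_weight (La * Num.max 0 x) n)%:E)%E.

Let H_transition j x : 0 <= x -> H j x = ((v *m transition K La x) 0 j)%:E.
Proof.
move=> x0; rewrite /H (max_idPr x0); apply/cvg_lim => //.
have cv : (fun N => \sum_k v 0 k * uniformized_sum K La N x k j) @ \oo -->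
    (v *m transition K La x) 0 j.
  rewrite mxE; apply: cvg_big => [|k _]; first exact: add_continuous.
  by apply: cvgMr; exact: cvg_transition.
rewrite (_ : (fun N => _) = EFin \o (fun N => \sum_k v 0 k * uniformized_sum K La N x k j)).
  by apply: cvg_EFin cv; apply: nearW.
apply/funext => N /=; rewrite sumEFin; congr EFin.
under [RHS]eq_bigr do rewrite uniformized_sumE mulr_sumr.
rewrite exchange_big /=; apply: eq_bigr => n _.
by rewrite mxE mulr_suml; apply: eq_bigr => k _; rewrite mulrAC mulrA.
Qed.

Let poisson_gamma n : (\int[mu]_(x in `[0%R, +oo[)
    ((poisson_weight (La * Num.max 0 x) n)%:E * (kappa * (x ^+ q * expR (- c * x)))%:E) =
  (nb_weight La s q.+1 n)%:E)%E.
Proof.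
have cL0 : 0 < c + La by rewrite ltr_pwDl.
transitivity (\int[mu]_(x in `[0%R, +oo[)
   ((kappa * La ^+ n / n`!%:R)%:E * (x ^+ (n + q) * expR (- (c + La) * x))%:E))%E.
  apply: eq_integral => x; rewrite inE /= in_itv /= andbT => x0.
  rewrite -!EFinM (max_idPr x0) /poisson_weight /exp_coeff /= exprMn exprD; congr EFin.
  have -> : - (c + La) * x = - (La * x) + - c * x by ring.
  by rewrite expRD; ring.
have kappa0 : 0 <= kappa by rewrite gamma_normalization divr_ge0 ?exprn_ge0 ?(ltW c0).
rewrite ge0_integralZl_EFin //=; last 3 first.
- by move=> x /=; rewrite in_itv /= andbT => x0; rewrite lee_fin mulr_ge0 ?expR_ge0 ?exprn_ge0.
- apply/measurable_EFinP/measurable_funTS; apply: continuous_measurable_fun.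
  exact: continuous_monomial_exp.
- by rewrite divr_ge0 ?ler0n // mulr_ge0 // exprn_ge0.
rewrite integral_monomial_exp // -EFinM /nb_weight addnS /= gamma_normalization; congr EFin.
have th : (1 + s * La)^-1 = c / (c + La).
  rewrite -[s]invf_div; move: c0 cL0; move: c => y y0 yL.
  by field; rewrite !gt_eqF // addrC.
have th1 : 1 - (1 + s * La)^-1 = La / (c + La) 
  by rewrite th; move: cL0; move: c => y yL; field; rewrite gt_eqF.
rewrite th1 th {th th1}; move: cL0; move: c => y yL.
rewrite -(bin_fact (leq_addl n q)) addnK !natrM !expr_div_n (addnC n q) -addSn exprD.
have f0 k : (k`!%:R : R) != 0 by rewrite pnatr_eq0 -lt0n fact_gt0.
have x0 k : (y + La) ^+ k != 0 by rewrite expf_neq0 // gt_eqF.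
rewrite (_ : 'C(q + n, n) = 'C(q + n, q)); last by rewrite -bin_sub ?leq_addl // addnK.
move: (y ^+ q.+1) (La ^+ n) => C L; move: (x0 q.+1) (x0 n).
move: ((y + La) ^+ q.+1) ((y + La) ^+ n) => X Y X0 Y0.
by field; rewrite X0 Y0 !f0.
Qed.

Let term_ge0 j n x :
  (0 <= ((v *m K ^+ n) 0 j * poisson_weight (La * Num.max 0 x) n)%:E)%E.
Proof. by rewrite lee_fin mulr_ge0 // poisson_weight_ge0 // mulr_ge0 // le_max lexx. Qed.

Let mpois n : measurable_fun [set: measurableTypeR R]
  (fun x : R => (poisson_weight (La * Num.max 0 x) n)%:E).
Proof.
apply/measurable_EFinP.
apply: (@measurableT_comp _ _ _ _ _ _ (fun y => poisson_weight (La * y) n)); last first.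
  exact: measurable_maxr.
apply: measurable_funM.
  by apply: measurableT_comp => //; apply: measurableT_comp => //; exact: measurable_funM.
by apply: measurable_funM => //; apply: measurable_funX; exact: measurable_funM.
Qed.

Let mterm j n : measurable_fun [set: measurableTypeR R]
  (fun x : R => ((v *m K ^+ n) 0 j * poisson_weight (La * Num.max 0 x) n)%:E).
Proof. by under eq_fun do rewrite EFinM; apply: emeasurable_funM. Qed.

Let mH j : measurable_fun setT (H j).
Proof. by apply: ge0_emeasurable_sum => // n x _ _; exact: term_ge0. Qed.

Let mtau : measurable_fun [set: T0] (tau : T0 -> measurableTypeR R).
Proof. by have := @measurable_funPT _ _ _ _ tau. Qed.

Lemma measurable_transition_time j :
  measurable_fun setT (fun w => ((v *m transition K La (tau w)) 0 j)%:E).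
Proof.
rewrite (_ : (fun w => _) = H j \o tau); first exact: measurableT_comp (mH j) mtau.
by apply/funext => w; rewrite /= H_transition.
Qed.

(** Integrating the Poisson mixture term by term against the gamma density gives the
negative binomial mixture of the powers of K, which sums to a power of the resolvent. *)
Theorem expectation_transition_erlang j : uniform_inv_resolvent K La s \in unitmx ->
  (\int[P0]_w ((v *m transition K La (tau w)) 0 j)%:E =
   ((v *m (invmx (uniform_inv_resolvent K La s)) ^+ q.+1) 0 j)%:E)%E.
Proof.
move=> Bu.
have kappa0 : 0 <= kappa by rewrite gamma_normalization divr_ge0 ?exprn_ge0 ?(ltW c0).
have H0 x : (0 <= H j x)%E by apply: nneseries_ge0 => n _ _; exact: term_ge0.
transitivity (\int[P0]_w (H j \o tau) w)%E.
  by apply: eq_integral => w _; rewrite /= H_transition.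
pose tau' : {mfun T0 >-> measurableTypeR R} :=
  HB.pack (tau : T0 -> measurableTypeR R) (isMeasurableFun.Build _ _ _ _ _ mtau).
rewrite -(ge0_integral_distribution tau' (mH j) H0).
have dens := @ge0_integral_density R (distribution P0 tau') (gamma_time_pdf q.+1 t) (H j)
  gamma_time_pdf_ge0 measurable_gamma_time_pdf (fun B mB => @tau_density B mB) (mH j) H0.
rewrite [LHS]dens.
rewrite gamma_time_pdfE -/kappa.
transitivity (\int[mu]_(x in `[0%R, +oo[) \sum_(n <oo)
   (((v *m K ^+ n) 0 j)%:E * ((poisson_weight (La * Num.max 0 x) n)%:E *
     (kappa * (x ^+ q * expR (- c * x)))%:E)))%E.
  apply: eq_integral => x; rewrite inE /= in_itv /= andbT => x0.
  have k0 : (0 <= (kappa * (x ^+ q * expR (- c * x)))%:E)%E.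
    by rewrite lee_fin mulr_ge0 // mulr_ge0 ?expR_ge0 ?exprn_ge0.
  rewrite /H muleC -nneseriesZl //; apply: eq_eseriesr => n _.
  by rewrite muleC EFinM muleA.
have mexp : measurable_fun setT (fun x : measurableTypeR R => (kappa * (x ^+ q * expR (- c * x)))%:E).
  apply/measurable_EFinP; apply: measurable_funM => //.
  by apply: continuous_measurable_fun; exact: continuous_monomial_exp.
rewrite integral_nneseries //; last 2 first.
- move=> n; apply: measurable_funTS; apply: emeasurable_funM => //.
  exact: emeasurable_funM.
- move=> n x /=; rewrite in_itv /= andbT => x0; rewrite lee_fin mulr_ge0 // mulr_ge0 //.
    by rewrite poisson_weight_ge0 // mulr_ge0 // le_max lexx.
  by rewrite mulr_ge0 // mulr_ge0 ?expR_ge0 ?exprn_ge0.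
apply/cvg_lim => //.
rewrite (_ : (fun N => _) = EFin \o (fun N => nb_sum K La s v q.+1 N 0 j)).
  apply: cvg_EFin; first exact: nearW.
  exact: cvg_nb_sum.
apply/funext => N /=; rewrite /nb_sum summxE -sumEFin; apply: eq_bigr => n _.
rewrite ge0_integralZl_EFin //.
- by rewrite poisson_gamma -EFinM [in RHS]mxE mulrC.
- move=> x /=; rewrite in_itv /= andbT => x0; rewrite lee_fin mulr_ge0 //.
    by rewrite poisson_weight_ge0 // mulr_ge0 // le_max lexx.
  by rewrite mulr_ge0 // mulr_ge0 ?expR_ge0 ?exprn_ge0.
- by apply: measurable_funTS; apply: emeasurable_funM.
Qed.
End erlang_time.

(** * Random letters from nested intervals *)

Section unit_probability.
Variable R : realType.

Definition unit_lebesgue : set (measurableTypeR R) -> \bar R :=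
  mrestr (@lebesgue_measure R) (measurable_itv `[0, 1[).

HB.instance Definition _ := Measure.on unit_lebesgue.

Lemma unit_lebesgue_setT : unit_lebesgue setT = 1%E.
Proof.
by rewrite /unit_lebesgue /mrestr setTI lebesgue_measure_itv /= lte01 sube0.
Qed.

HB.instance Definition _ := Measure_isProbability.Build _ _ _ unit_lebesgue unit_lebesgue_setT.
End unit_probability.

Section nested_intervals.
Variables (R : realType) (n : nat).
Notation letter_t := 'I_n.+1.
Variable c : seq letter_t -> R.
Hypothesis c_ge0 : forall w, 0 <= c w.
Hypothesis c_nil : c [::] = 1.
Hypothesis c_sum : forall w, c w = \sum_z c (z :: w).

(** A word w stands for the interval of length c w starting at left_end w.  The words are
written with the most recent letter first; the intervals of the words z :: w cut
that of w from left to right. *)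
Fixpoint left_end (w : seq letter_t) : R :=
  if w is z :: w' then left_end w' + \sum_(y < n.+1 | (y < z)%N) c (y :: w') else 0.

Definition in_cell (u : R) w := left_end w <= u < left_end w + c w.

(** The first k letters of the nested intervals that contain u; outside [0, 1), which
no interval meets, all letters are the default one. *)
Fixpoint digits (u : R) (k : nat) : seq letter_t :=
  if k is k'.+1 then
    let w := digits u k' in odflt ord0 [pick z | in_cell u (z :: w)] :: w
  else [::].

Definition letter (k : nat) (u : R) : letter_t := head ord0 (digits u k.+1).

Lemma size_digits u k : size (digits u k) = k.
Proof. by elim: k => //= k ->. Qed.

Let partial_sum w (j : nat) : R := \sum_(y < n.+1 | (y < j)%N) c (y :: w).

Let partial_sumS w (z : letter_t) : partial_sum w z.+1 = partial_sum w z + c (z :: w).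
Proof.
rewrite /partial_sum (bigD1 z) //= addrC; congr (_ + _).
by apply: eq_bigl => y; rewrite ltnS ltn_neqAle andbC.
Qed.

Let partial_sum_le w a b : (a <= b)%N -> partial_sum w a <= partial_sum w b.
Proof.
move=> ab; rewrite /partial_sum [leRHS](bigID (fun y : letter_t => (y < a)%N)) /=.
rewrite (eq_bigl (fun y : letter_t => (y < b)%N && (y < a)%N)).
  by rewrite lerDl sumr_ge0.
by move=> y; case: ltnP => ya; rewrite ?andbF // (leq_trans ya).
Qed.

Let partial_sum_all w : partial_sum w n.+1 = c w.
Proof. by rewrite c_sum; apply: eq_bigl => y; rewrite ltn_ord. Qed.

Lemma in_cellE u z w : in_cell u (z :: w) =
  (left_end w + partial_sum w z <= u < left_end w + partial_sum w z.+1).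
Proof. by rewrite /in_cell /= partial_sumS addrA. Qed.

Lemma in_cell_sub u z w : in_cell u (z :: w) -> in_cell u w.
Proof.
rewrite in_cellE /in_cell -(partial_sum_all w) => /andP[zu uz]; apply/andP; split.
  by apply: le_trans zu; rewrite lerDl sumr_ge0.
by apply: lt_le_trans uz _; rewrite lerD2l partial_sum_le.
Qed.

Lemma in_cell_inj u z z' w : in_cell u (z :: w) -> in_cell u (z' :: w) -> z = z'.
Proof.
rewrite !in_cellE => /andP[zu uz] /andP[zu' uz']; apply/val_inj/eqP => /=.
rewrite eqn_leq; apply/andP; split; rewrite leqNgt; apply/negP => lt.
  have : left_end w + partial_sum w z'.+1 <= left_end w + partial_sum w z.
    by rewrite lerD2l partial_sum_le.
  by lra.
have : left_end w + partial_sum w z.+1 <= left_end w + partial_sum w z'.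
  by rewrite lerD2l partial_sum_le.
by lra.
Qed.

Lemma in_cell_ex u w : in_cell u w -> exists z, in_cell u (z :: w).
Proof.
move=> /andP[wu]; rewrite -(partial_sum_all w) => uw.
have [k] := @ex_minnP (fun j => u < left_end w + partial_sum w j) (ex_intro _ n.+1 uw).
case: k => [|k] uk kmin.
  by move: uk; rewrite /partial_sum big1 // addr0; lra.
have kn : (k < n.+1)%N by apply: kmin.
exists (Ordinal kn); rewrite in_cellE uk andbT leNgt; apply/negP => /kmin.
by rewrite ltnn.
Qed.

Lemma digits_in_cell u k w : size w = k -> in_cell u w -> digits u k = w.
Proof.
elim: k w => [|k IH] [|z w] //= [wk] uz; rewrite (IH w) ?(in_cell_sub uz) //.
case: pickP => [z' uz' /=|/(_ z)]; last by rewrite uz.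
by rewrite (in_cell_inj uz uz').
Qed.

Lemma in_cell_digits u k : 0 <= u < 1 -> in_cell u (digits u k).
Proof.
move=> u01; elim: k => [|k IH] /=; first by rewrite /in_cell /= c_nil add0r.
by case: pickP => [z //|no]; have [z] := in_cell_ex IH; rewrite no.
Qed.

Lemma in_cell_unit u w : in_cell u w -> 0 <= u < 1.
Proof.
elim: w => [|z w IH]; first by rewrite /in_cell /= c_nil add0r.
by move/in_cell_sub.
Qed.

Lemma digits_outside u k : ~~ (0 <= u < 1) -> digits u k = nseq k ord0.
Proof.
move=> u01; elim: k => //= k ->; case: pickP => // z uz.
by move/negP: u01; case; exact: in_cell_unit uz.
Qed.

Lemma digits_eqE w : [set u | digits u (size w) = w] `&` [set` `[0%R, 1%R[] =
  [set` `[left_end w, left_end w + c w[].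
Proof.
apply/seteqP; split => u /=; rewrite !in_itv /=.
  by move=> [e u01]; have := in_cell_digits (size w) u01; rewrite e.
by move=> uw; split; [exact: digits_in_cell|exact: in_cell_unit uw].
Qed.

Lemma measurable_digits_eq w :
  measurable [set u : measurableTypeR R | digits u (size w) = w].
Proof.
rewrite -(setIT [set _ | _]) -(setUv [set` `[0%R, 1%R[]) setIUr; apply: measurableU.
  by rewrite digits_eqE; exact: measurable_itv.
have [e|ne] := eqVneq (nseq (size w) ord0) w.
  rewrite setIidr; first by apply: measurableC; exact: measurable_itv.
  by move=> u /=; rewrite in_itv /= => /negP u01; rewrite digits_outside.
rewrite (_ : _ `&` _ = set0) //; apply/seteqP; split => // u /=; rewrite in_itv /=.
by move=> [+ /negP u01]; rewrite digits_outside // => e; move: ne; rewrite e eqxx.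
Qed.

Lemma measurable_digits k (Q : set (seq letter_t)) :
  measurable [set u : measurableTypeR R | Q (digits u k)].
Proof.
pose cell (o : option (seq letter_t)) : set (measurableTypeR R) := if o is Some w then
  if `[< size w = k /\ Q w >] then [set u : measurableTypeR R | digits u (size w) = w]
  else set0 else set0.
have mcell o : measurable (cell o).
  case: o => [w|] /=; last exact: measurable0.
  by case: ifP => _; [exact: measurable_digits_eq|exact: measurable0].
rewrite (_ : [set _ | _] = \bigcup_j cell (unpickle j)).
  by apply: bigcup_measurable => j _; exact: mcell.
apply/seteqP; split => [u /= Qu|u [j _]].
  have Cu : cell (unpickle (pickle (digits u k))) u.
    by rewrite pickleK /cell size_digits ifT //; exact/asboolP.
  by exists (pickle (digits u k)).
move: (unpickle j) => [w|//]; rewrite /cell; case: ifP => // /asboolP[<- Qw] /= e.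
by rewrite e.
Qed.

Lemma unit_lebesgue_digits w :
  unit_lebesgue [set u | digits u (size w) = w] = (c w)%:E.
Proof.
rewrite /unit_lebesgue /mrestr digits_eqE lebesgue_measure_itv /= lte_fin.
have := c_ge0 w; rewrite le_eqVlt => /orP[/eqP <-|c0].
  by rewrite addr0 ltxx.
by rewrite ltrDl c0 -EFinD addrC addKr.
Qed.
End nested_intervals.

(** * Finite-dimensional laws and the chain at rational times *)

Lemma measure_fibers d (T : measurableType d) (R : realType)
    (mu : {measure set T -> \bar R}) n (Y : T -> 'I_n) (A : set T) :
  measurable A -> (forall z, measurable [set w | Y w = z]) ->
  mu A = (\sum_z mu (A `&` [set w | Y w = z]))%E.
Proof.
move=> mA mY; rewrite -(measure_bigsetU_ord _ predT); last 2 first.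
- by move=> z; exact: measurableI.
- by move=> z z' _ _ [w [[_ /= <-] [_ /= <-]]].
congr (mu _); rewrite -(bigcup_pred predT); apply/seteqP; split => w.
  by move=> Aw; exists (Y w).
by move=> [z _ []].
Qed.

Section path_weight.
Variables (R : realType) (n : nat).
Notation state := 'I_n.+1.
Variable p : R -> 'M[R]_n.+1.
Hypothesis p_ge0 : forall t, 0 <= t -> forall x y, 0 <= p t x y.
Hypothesis p_sum1 : forall t, 0 <= t -> forall x, \sum_y p t x y = 1.
Hypothesis p0 : p 0 = 1%:M.
Hypothesis pD : forall s t, 0 <= s -> 0 <= t -> p (s + t) = p s *m p t.
Variable v0 : state -> R.
Hypothesis v0_ge0 : forall x, 0 <= v0 x.
Hypothesis v0_sum1 : \sum_x v0 x = 1.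

Implicit Types (l : seq (R * state)).

Fixpoint path_weight_from (x : state) (t : R) l : R :=
  if l is (t', y) :: l' then p (t' - t) x y * path_weight_from y t' l' else 1.

(** The finite-dimensional probability that a chain with transition matrices p and initial
law v0 visits the states listed in l at the given times. *)
Definition path_weight l : R := \sum_x v0 x * path_weight_from x 0 l.

Definition chronological (t : R) l := path <=%R t (map fst l).

(** Summing over the state at an intermediate time is the Chapman-Kolmogorov equation;
this is the consistency of the finite-dimensional laws. *)
Lemma path_weight_from_insert x t l1 q l2 (z0 : state) :
  chronological t (l1 ++ (q, z0) :: l2) ->
  \sum_z path_weight_from x t (l1 ++ (q, z) :: l2) = path_weight_from x t (l1 ++ l2).
Proof.
rewrite /chronological; elim: l1 x t => [|[t' y] l1 IH] x t /=; last first.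
  by move=> /andP[_ lP]; rewrite -mulr_sumr IH.
move=> /andP[tq]; case: l2 => [|[t' y] l2] /=.
  by under eq_bigr do rewrite mulr1; rewrite p_sum1 // subr_ge0.
move=> /andP[qt' _]; under eq_bigr do rewrite mulrA.
rewrite -mulr_suml; congr (_ * _).
rewrite (_ : t' - t = (q - t) + (t' - q)); last by ring.
by rewrite [in RHS]pD ?subr_ge0 // mxE.
Qed.

Lemma path_weight_insert l1 q l2 (z0 : state) : chronological 0 (l1 ++ (q, z0) :: l2) ->
  \sum_z path_weight (l1 ++ (q, z) :: l2) = path_weight (l1 ++ l2).
Proof.
move=> lP; rewrite exchange_big /=; apply: eq_bigr => x _.
by rewrite -mulr_sumr (path_weight_from_insert _ lP).
Qed.

Lemma path_weight_from_ge0 x t l : chronological t l -> 0 <= path_weight_from x t l.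
Proof.
rewrite /chronological; elim: l x t => [|[t' y] l IH] x t //= /andP[tt' lP].
by rewrite mulr_ge0 ?IH // p_ge0 // subr_ge0.
Qed.

Lemma path_weight_ge0 l : chronological 0 l -> 0 <= path_weight l.
Proof.
by move=> lP; apply: sumr_ge0 => x _; rewrite mulr_ge0 // path_weight_from_ge0.
Qed.

Lemma path_weight_nil : path_weight [::] = 1.
Proof. by rewrite /path_weight; under eq_bigr do rewrite mulr1. Qed.

(** Two visits at the same time are contradictory unless the states agree, because p 0
is the identity. *)
Lemma path_weight_from_dup x t l1 q y z l2 :
  path_weight_from x t (l1 ++ (q, y) :: (q, z) :: l2) =
  if y == z then path_weight_from x t (l1 ++ (q, y) :: l2) else 0.
Proof.
elim: l1 x t => [|[t' y'] l1 IH] x t /=.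
  rewrite subrr p0 mxE; have [->|yz] := eqVneq y z; first by rewrite mul1r.
  by rewrite mul0r mulr0.
by rewrite IH; case: eqP => // _; rewrite mulr0.
Qed.

Lemma path_weight_dup l1 q y z l2 :
  path_weight (l1 ++ (q, y) :: (q, z) :: l2) =
  if y == z then path_weight (l1 ++ (q, y) :: l2) else 0.
Proof.
rewrite /path_weight; under eq_bigr do rewrite path_weight_from_dup.
by case: eqP => // _; rewrite big1 // => x _; rewrite mulr0.
Qed.

Lemma path_weight_from_rcons x t l q y h z :
  path_weight_from x t (rcons (rcons l (q, y)) (q + h, z)) =
  path_weight_from x t (rcons l (q, y)) * p h y z.
Proof.
elim: l x t => [|[t' y'] l IH] x t /=; last by rewrite IH mulrA.
by rewrite mulr1 addrAC subrr add0r mulr1.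
Qed.

Lemma path_weight_rcons l q y h z :
  path_weight (rcons (rcons l (q, y)) (q + h, z)) =
  path_weight (rcons l (q, y)) * p h y z.
Proof.
by rewrite /path_weight mulr_suml; apply: eq_bigr => x _; rewrite path_weight_from_rcons mulrA.
Qed.

Section enumerated_times.
Variable tm : nat -> R.
Hypothesis tm_ge0 : forall k, 0 <= tm k.
Implicit Types (f : nat -> option state).

(** Indices are ordered by their time, ties being broken by the index; the tie-break is what
makes the order antisymmetric, so that sorted lists of indices are unique. *)
Definition earlier (k k' : nat) := (tm k < tm k') || ((tm k == tm k') && (k <= k')%N).

Lemma earlier_total : total earlier.
Proof.
move=> k k'; rewrite /earlier; have [lt|lt|e] := ltgtP (tm k) (tm k'); rewrite ?orbT //=.
exact: leq_total.
Qed.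

Lemma earlier_trans : transitive earlier.
Proof.
move=> b a c; rewrite /earlier => /orP[ab|/andP[/eqP -> ab]] /orP[bc|/andP[/eqP <- bc]].
- by rewrite (lt_trans ab bc).
- by rewrite ab.
- by rewrite bc.
- by rewrite eqxx (leq_trans ab bc) orbT.
Qed.

Lemma earlier_anti : antisymmetric earlier.
Proof.
move=> a b /andP[]; rewrite /earlier; have [lt|lt|e] //= := ltgtP (tm a) (tm b).
by move=> ab ba; apply/eqP; rewrite eqn_leq ab.
Qed.

Lemma earlier_le a b : earlier a b -> tm a <= tm b.
Proof. by move=> /orP[/ltW //|/andP[/eqP -> _]]. Qed.

Definition schedule N := sort earlier (iota 0 N).

Definition constraints f (s : seq nat) : seq (R * state) :=
  pmap (fun k => omap (fun z => (tm k, z)) (f k)) s.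

(** The probability of the visits prescribed by the partial assignment f of states to the
first N times, taken in chronological order; f k = None leaves the k-th time free. *)
Definition assignment_weight f N := path_weight (constraints f (schedule N)).

Lemma schedule_sorted N : sorted earlier (schedule N).
Proof. exact: sort_sorted earlier_total _. Qed.

Lemma schedule_uniq N : uniq (schedule N).
Proof. by rewrite sort_uniq iota_uniq. Qed.

Lemma mem_schedule N k : (k \in schedule N) = (k < N)%N.
Proof. by rewrite mem_sort mem_iota. Qed.

Lemma constraints_cat f s1 s2 : constraints f (s1 ++ s2) = constraints f s1 ++ constraints f s2.
Proof. exact: pmap_cat. Qed.

Lemma eq_constraints f g s : {in s, f =1 g} -> constraints f s = constraints g s.
Proof.
elim: s => //= k s IH fg; rewrite fg ?mem_head // IH // => j js.
by rewrite fg // in_cons js orbT.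
Qed.

Lemma constraints_times f s : map fst (constraints f s) = map tm [seq k <- s | isSome (f k)].
Proof. by elim: s => //= k s IH; case: (f k) => [z|] /=; rewrite ?IH. Qed.

Lemma constraints_filter f s : constraints f s = constraints f [seq k <- s | isSome (f k)].
Proof. by elim: s => //= k s IH; case E: (f k) => [z|] /=; rewrite ?E //= IH. Qed.

Lemma constraints_chronological f N : chronological 0 (constraints f (schedule N)).
Proof.
rewrite /chronological constraints_times.
have : sorted earlier [seq k <- schedule N | isSome (f k)].
  by apply: sorted_filter; [exact: earlier_trans|exact: schedule_sorted].
case: [seq _ <- _ | _] => //= k s ks; rewrite tm_ge0 /= path_map.
by apply: sub_path ks => a b; exact: earlier_le.
Qed.

Definition assign f k z := fun j => if j == k then Some z else f j.

(** Leaving a time free is the same as summing over the state at that time. *)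
Lemma assignment_weight_sum f N k : (k < N)%N -> f k = None ->
  \sum_z assignment_weight (assign f k z) N = assignment_weight f N.
Proof.
move=> kN fk.
have ks : k \in schedule N by rewrite mem_schedule.
have us := schedule_uniq N.
have [s1 [s2 es]] : exists s1 s2, schedule N = s1 ++ k :: s2.
  by case/splitPr: ks => s1 s2; exists s1, s2.
have [k1 k2] : k \notin s1 /\ k \notin s2.
  move: us; rewrite es cat_uniq /= => /and3P[_ + /andP[-> _]].
  by rewrite negb_or => /andP[-> _].
have e z : constraints (assign f k z) (schedule N) =
    constraints f s1 ++ (tm k, z) :: constraints f s2.
  rewrite es constraints_cat /= /assign eqxx /=; congr (_ ++ _ :: _); apply: eq_constraints => j js.
    by case: eqP => // jk; move: k1; rewrite -jk js.
  by case: eqP => // jk; move: k2; rewrite -jk js.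
have e0 : constraints f (schedule N) = constraints f s1 ++ constraints f s2.
  by rewrite es constraints_cat /= fk.
rewrite /assignment_weight; under eq_bigr do rewrite e.
rewrite e0; apply: (@path_weight_insert _ _ _ ord0).
rewrite -e; exact: constraints_chronological.
Qed.

Lemma assignment_weight_widen f N : f N = None ->
  assignment_weight f N.+1 = assignment_weight f N.
Proof.
move=> fN; congr path_weight.
rewrite constraints_filter [RHS]constraints_filter; congr constraints.
rewrite /schedule !(filter_sort earlier_total earlier_trans).
by rewrite -[N.+1]addn1 iotaD filter_cat /= add0n fN cats0.
Qed.

Definition word_assignment (w : seq state) : nat -> option state :=
  fun k => if (k < size w)%N then Some (nth ord0 (rev w) k) else None.

Definition word_weight (w : seq state) := assignment_weight (word_assignment w) (size w).

Lemma word_weight_ge0 w : 0 <= word_weight w.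
Proof. exact/path_weight_ge0/constraints_chronological. Qed.

Lemma word_weight_nil : word_weight [::] = 1.
Proof. by rewrite /word_weight /assignment_weight /schedule /= path_weight_nil. Qed.

(** The compatibility that makes the word weights the lengths of nested intervals. *)
Lemma word_weight_sum w : word_weight w = \sum_z word_weight (z :: w).
Proof.
have wN : word_assignment w (size w) = None by rewrite /word_assignment ltnn.
rewrite /word_weight -(assignment_weight_widen wN) -(assignment_weight_sum (ltnSn _) wN).
apply: eq_bigr => z _; congr path_weight; apply: eq_constraints => k.
rewrite mem_schedule ltnS leq_eqVlt /assign /word_assignment /= => /orP[/eqP->|kw].
  by rewrite eqxx ltnSn rev_cons nth_rcons size_rev ltnn eqxx.
by rewrite (ltn_eqF kw) kw (leqW kw) rev_cons nth_rcons size_rev kw.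
Qed.

(** The state at the k-th time tm k: the k-th letter of the expansion of u in the nested
intervals of lengths word_weight. *)
Definition coordinate (k : nat) (u : R) : state := letter word_weight k u.

Lemma measurable_coordinate k (z : state) :
  measurable [set u : measurableTypeR R | coordinate k u = z].
Proof.
exact: (@measurable_digits R n word_weight word_weight_ge0 word_weight_nil word_weight_sum
  k.+1 [set w | head ord0 w = z]).
Qed.

Lemma digits_coordinates u N : digits word_weight u N = rev (mkseq (coordinate^~ u) N).
Proof. by elim: N => //= N IH; rewrite /mkseq -[N.+1]addn1 iotaD map_cat rev_cat -IH. Qed.

Definition agrees f N (u : R) := forall k, (k < N)%N -> forall z, f k = Some z -> coordinate k u = z.

(** Induction on the number of free times: a full assignment describes one interval, and
both sides are additive when a free time is split according to its state. *)
Lemma unit_lebesgue_agrees f N : measurable [set u : measurableTypeR R | agrees f N u] /\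
  unit_lebesgue [set u : measurableTypeR R | agrees f N u] = (assignment_weight f N)%:E.
Proof.
move: {2}(count _ _) (erefl (count (fun k => ~~ f k) (iota 0 N))) => c.
elim: c f => [|c IH] f fc.
  have fS k : (k < N)%N -> f k = Some (odflt ord0 (f k)).
    move=> kN; move/eqP: fc; rewrite -leqn0 leqNgt -has_count => /hasPn/(_ k).
    by rewrite mem_iota /= add0n kN negbK => /(_ isT); case: (f k).
  pose w := rev (mkseq (fun k => odflt ord0 (f k)) N).
  have sw : size w = N by rewrite size_rev size_mkseq.
  have -> : [set u : measurableTypeR R | agrees f N u] =
      [set u | digits word_weight u (size w) = w].
    apply/seteqP; split => u /=; rewrite sw digits_coordinates.
      move=> fu; congr rev; apply/eq_in_map => k; rewrite mem_iota /= add0n => kN.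
      exact: fu (fS k kN).
    move=> /(congr1 rev); rewrite !revK => e k kN z fk.
    have := congr1 (fun s => nth ord0 s k) e.
    by rewrite !nth_mkseq // fk.
  split.
    exact: (measurable_digits_eq word_weight_ge0 word_weight_nil word_weight_sum).
  rewrite (unit_lebesgue_digits word_weight_ge0 word_weight_nil word_weight_sum).
  congr EFin; rewrite /word_weight sw; congr path_weight; apply: eq_constraints => k.
  by rewrite mem_schedule => kN; rewrite /word_assignment sw kN revK nth_mkseq // [RHS]fS.
have /hasP[k] : has (fun k => ~~ f k) (iota 0 N) by rewrite has_count fc.
rewrite mem_iota /= add0n => kN fk.
have fkN : f k = None by case: (f k) fk.
have cz z : count (fun j => ~~ assign f k z j) (iota 0 N) = c.
  apply/eqP; rewrite -eqSS -fc; apply/eqP.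
  have kin : k \in iota 0 N by rewrite mem_iota.
  case/splitPr: kin (iota_uniq 0 N) => s1 s2.
  rewrite cat_uniq /= negb_or => /and3P[_ /andP[ks1 _] /andP[ks2 _]].
  rewrite !count_cat /= {2}/assign eqxx /= fk add0n -addnS add1n; congr (_ + _.+1)%N.
    apply: eq_in_count => j js; rewrite /assign; case: eqP => // jk.
    by move: ks1; rewrite -jk js.
  apply: eq_in_count => j js; rewrite /assign; case: eqP => // jk.
  by move: ks2; rewrite -jk js.
have e z : [set u : measurableTypeR R | agrees (assign f k z) N u] =
    [set u | agrees f N u] `&` [set u | coordinate k u = z].
  apply/seteqP; split => u /=.
    move=> fu; split => [j jN y fj|].
      by apply: fu => //; rewrite /assign; case: eqP => // jk; move: fj; rewrite jk fkN.
    by apply: fu => //; rewrite /assign eqxx.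
  by move=> [fu uk] j jN y; rewrite /assign; case: eqP => [-> [<-]//|_]; exact: fu.
have mf : measurable [set u : measurableTypeR R | agrees f N u].
  rewrite (_ : [set u | _] = \big[setU/set0]_(z in predT) [set u : measurableTypeR R | agrees (assign f k z) N u]).
    by apply: bigsetU_measurable => z _; have [] := IH _ (cz z).
  rewrite -bigcup_pred; apply/seteqP; split => u.
    by move=> fu; exists (coordinate k u) => //; rewrite e.
  by move=> [z _]; rewrite e => -[].
split => //.
rewrite (measure_fibers _ mf (measurable_coordinate k)) -(assignment_weight_sum kN fkN).
by rewrite -sumEFin; apply: eq_bigr => z _; rewrite -e; have [_ H] := IH _ (cz z); exact: H.
Qed.

End enumerated_times.
End path_weight.

Section rational_times.
Variables (R : realType) (n : nat).
Notation state := 'I_n.+1.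
Variable p : R -> 'M[R]_n.+1.
Hypothesis p_ge0 : forall t, 0 <= t -> forall x y, 0 <= p t x y.
Hypothesis p_sum1 : forall t, 0 <= t -> forall x, \sum_y p t x y = 1.
Hypothesis p0 : p 0 = 1%:M.
Hypothesis pD : forall s t, 0 <= s -> 0 <= t -> p (s + t) = p s *m p t.
Variable v0 : state -> R.
Hypothesis v0_ge0 : forall x, 0 <= v0 x.
Hypothesis v0_sum1 : \sum_x v0 x = 1.

(** Negative rationals and the codes of no rational are sent to time 0, so that every
index has a nonnegative time. *)
Definition rat_time (k : nat) : R :=
  if unpickle k is Some q then Num.max 0 (ratr (q : rat)) else 0.

Lemma rat_time_ge0 k : 0 <= rat_time k.
Proof. by rewrite /rat_time; case: (unpickle k : option rat) => [q|//]; rewrite le_max lexx. Qed.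

Lemma rat_time_pickle (q : rat) : 0 <= q -> rat_time (pickle q) = ratr q.
Proof. by move=> q0; rewrite /rat_time pickleK (max_idPr _) // ler0q. Qed.

Definition rat_process (q : rat) (u : R) : state := coordinate p v0 rat_time (pickle q) u.

Lemma measurable_rat_process q z :
  measurable [set u : measurableTypeR R | rat_process q u = z].
Proof. exact: (measurable_coordinate p_ge0 p_sum1 pD v0_ge0 v0_sum1 rat_time_ge0). Qed.

Definition follows (l : seq (rat * state)) : set (measurableTypeR R) :=
  [set u | all (fun x => rat_process x.1 u == x.2) l].

Lemma measurable_follows l : measurable (follows l).
Proof.
elim: l => [|[q z] l IH].
  by rewrite (_ : follows _ = setT) //; apply/seteqP; split.
rewrite (_ : follows _ = [set u | rat_process q u = z] `&` follows l).
  by apply: measurableI => //; exact: measurable_rat_process.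
by apply/seteqP; split => u; rewrite /follows /=; [move=> /andP[/eqP]|move=> [-> ->]; rewrite eqxx].
Qed.

Definition real_times (l : seq (rat * state)) : seq (R * state) :=
  [seq (ratr x.1, x.2) | x <- l].

Let rational_fdd_strict l : all (fun x => 0 <= x.1) l -> sorted <%R (map fst l) ->
  unit_lebesgue (follows l) = (path_weight p v0 (real_times l))%:E.
Proof.
move=> l0 ls.
pose f k : option state := ohead [seq x.2 | x <- l & pickle x.1 == k].
pose N := (\max_(x <- l) pickle x.1).+1.
have ul : uniq (map fst l).
  by apply: (sorted_uniq _ _ ls); [exact: lt_trans|exact: ltxx].
have fP x : x \in l -> f (pickle x.1) = Some x.2.
  move=> xl; rewrite /f.
  have -> : [seq y <- l | pickle y.1 == pickle x.1] = [:: x]; last by [].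
  move: ul xl; elim: l {l0 ls f N} => //= y l IH /andP[yl ul].
  rewrite in_cons => /orP[/eqP ->|xl].
    rewrite eqxx; congr cons; apply/eqP; rewrite -size_eq0 size_filter -leqn0 leqNgt -has_count.
    apply/hasPn => z zl; apply/negP => /eqP/(pcan_inj pickleK) e.
    by move/negP: yl; apply; rewrite -e; exact: map_f.
  case: eqP => [/(pcan_inj pickleK) e|_]; last exact: IH.
  by move/negP: yl; case; rewrite e; exact: map_f.
have fNone k : k \notin [seq pickle x.1 | x <- l] -> f k = None.
  move=> kl; rewrite /f (_ : [seq x <- l | _] = [::]) //.
  apply/eqP; rewrite -size_eq0 size_filter -leqn0 leqNgt -has_count.
  by apply/hasPn => x xl; apply: contra kl => /eqP <-; apply/mapP; exists x.
have pN x : x \in l -> (pickle x.1 < N)%N.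
  by move=> xl; rewrite ltnS (big_rem x) //= leq_maxl.
have -> : follows l = [set u | agrees p v0 rat_time f N u].
  apply/seteqP; split => u; rewrite /follows /agrees /=.
    move=> /allP lu k kN z fk.
    have [/mapP[x xl e]|/fNone] := boolP (k \in [seq pickle x.1 | x <- l]); last by rewrite fk.
    have /eqP := lu x xl; rewrite /rat_process -e => ->.
    by move: fk; rewrite e fP // => -[].
  move=> fu; apply/allP => x xl; apply/eqP; apply: fu; first exact: pN.
  exact: fP.
have [_ ->] := unit_lebesgue_agrees p_ge0 p_sum1 pD v0_ge0 v0_sum1 rat_time_ge0 f N.
congr EFin; rewrite /assignment_weight; congr path_weight.
rewrite constraints_filter.
have -> : [seq k <- schedule rat_time N | isSome (f k)] = [seq pickle x.1 | x <- l].
  apply: (@sorted_eq _ (earlier rat_time)).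
  - exact: earlier_trans.
  - exact: earlier_anti.
  - by apply: sorted_filter; [exact: earlier_trans|exact: schedule_sorted].
  - move: ls l0; case: (l) => //= y l' yl' /andP[y0 l'0].
    elim: l' y yl' y0 l'0 => //= z l' IH y /andP[yz zl] y0 /andP[z0 l'0].
    by rewrite IH // andbT /earlier !rat_time_pickle // ltr_rat yz.
  apply: uniq_perm.
  - by rewrite filter_uniq // schedule_uniq.
  - by rewrite (map_comp pickle fst) map_inj_uniq //; exact: pcan_inj pickleK.
  move=> k; rewrite mem_filter mem_schedule; apply/andP/idP => [[fk _]|/mapP[x xl ->]].
    by apply: contraT => /fNone e; rewrite e in fk.
  by rewrite fP // pN.
rewrite /constraints /real_times.
have : {subset l <= l} by [].
move: {1 3 4}l => l'; elim: l' => //= x l' IH sub.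
rewrite fP ?sub ?mem_head //= IH; last by move=> y yl; rewrite sub // in_cons yl orbT.
by rewrite rat_time_pickle //; apply: (allP l0); rewrite sub ?mem_head.
Qed.

(** Repeated times are removed first, since the visits at an index can be prescribed only
once. *)
Lemma rational_fdd l : all (fun x => 0 <= x.1) l -> sorted <=%R (map fst l) ->
  unit_lebesgue (follows l) = (path_weight p v0 (real_times l))%:E.
Proof.
move: {2}(size l) (leqnn (size l)) => s; elim: s l => [|s IH] l.
  by rewrite leqn0 size_eq0 => /eqP ->; exact: rational_fdd_strict.
move=> ls l0 lsort.
have [|nstrict] := boolP (sorted <%R (map fst l)); first exact: rational_fdd_strict.
have [l1 [q [y [z [l2 e]]]]] : exists l1 q y z l2, l = l1 ++ (q, y) :: (q, z) :: l2.
  move: nstrict lsort; case: (l) => // -[q y] l' /=.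
  elim: l' q y => //= -[q' y'] l' IHl q y; rewrite negb_and => H /andP[qq' l'sort].
  have [->|qne] := eqVneq q q'; first by exists [::], q', y, y', l'.
  move: H; rewrite lt_neqAle qne qq' /= => H.
  have [l1 [a [b [c [l2 ->]]]]] := IHl q' y' H l'sort.
  by exists ((q, y) :: l1), a, b, c, l2.
have fE : follows l = if y == z then follows (l1 ++ (q, y) :: l2) else set0.
  rewrite e; apply/seteqP; split => u; rewrite /follows /= !all_cat /=.
    move=> /and4P[H1 /eqP e1 /eqP e2 H2].
    by rewrite -e1 -e2 eqxx /= all_cat /= H1 e1 eqxx H2.
  case: eqP => // <- /=; rewrite all_cat /= => /and3P[-> -> ->].
  by [].
rewrite fE e /real_times map_cat /= path_weight_dup //.
case: eqP => [yz|_]; last by rewrite measure0.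
rewrite IH; first by rewrite /real_times map_cat.
- by move: ls; rewrite e !size_cat /= !addnS ltnS.
- by move: l0; rewrite e !all_cat /= => /and4P[-> -> _ ->].
- apply: (subseq_sorted le_trans _ lsort); rewrite e !map_cat.
  by apply: cat_subseq => //; exact: subseq_cons.
Qed.

End rational_times.

(** * Finitely many changes *)

Section count_changes.
Variable T : eqType.

Fixpoint nb_changes (x : T) (s : seq T) : nat :=
  if s is y :: s' then (x != y) + nb_changes y s' else 0.

Lemma nb_changes_start x y s : (nb_changes x s <= (x != y) + nb_changes y s)%N.
Proof.
case: s => [|z s] /=; first by rewrite leq0n.
rewrite addnA leq_add2r; have [->|xy] := eqVneq x y => //=.
by apply: leq_trans (leq_b1 _) _.
Qed.

(** A change along a subsequence is witnessed by at least one change between the two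
terms in the full sequence. *)
Lemma nb_changes_subseq x s s' : subseq s s' -> (nb_changes x s <= nb_changes x s')%N.
Proof.
elim: s' x s => [|y s' IH] x s; first by rewrite subseq0 => /eqP ->.
case: s => [|z s] //; rewrite [subseq _ _]/=; case: eqP => [->|_] sub.
  by rewrite /= leq_add2l IH.
apply: leq_trans (nb_changes_start x y _) _.
by rewrite [leqRHS]/= leq_add2l IH.
Qed.
End count_changes.

Section good_set.
Variables (R : realType) (n : nat).
Notation state := 'I_n.+1.
Variable p : R -> 'M[R]_n.+1.
Hypothesis p_ge0 : forall t, 0 <= t -> forall x y, 0 <= p t x y.
Hypothesis p_sum1 : forall t, 0 <= t -> forall x, \sum_y p t x y = 1.
Hypothesis p0 : p 0 = 1%:M.
Hypothesis pD : forall s t, 0 <= s -> 0 <= t -> p (s + t) = p s *m p t.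
Variable La : R.
Hypothesis La0 : 0 <= La.
Hypothesis p_stay : forall t x, 0 <= t -> 1 - La * t <= p t x x.
Variable v0 : state -> R.
Hypothesis v0_ge0 : forall x, 0 <= v0 x.
Hypothesis v0_sum1 : \sum_x v0 x = 1.

Local Notation P1 := (@unit_lebesgue R).
Local Notation Z := (rat_process p v0).
Local Notation Om := (measurableTypeR R).

Let mZ q z : measurable [set u : Om | Z q u = z].
Proof. exact: (measurable_rat_process p_ge0 p_sum1 pD v0_ge0 v0_sum1). Qed.

Lemma measurable_rat_process_neq q q' : measurable [set u : Om | Z q u != Z q' u].
Proof.
rewrite (_ : [set u : Om | _] = \big[setU/set0]_(z in predT)
    ([set u : Om | Z q u = z] `\` [set u | Z q' u = z])).
  by apply: bigsetU_measurable => z _; exact: measurableD.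
rewrite -bigcup_pred; apply/seteqP; split => u /=.
  by move=> /eqP ne; exists (Z q u) => //=; split => // /esym.
by move=> [z _ [/= <- ne]]; apply/eqP => /esym.
Qed.

(** The chain stays where it is during a time h with probability at least 1 - La h. *)
Lemma rat_process_change (q q' : rat) : 0 <= q -> q <= q' ->
  (P1 [set u : Om | Z q u != Z q' u] <= (La * (ratr q' - ratr q))%:E)%E.
Proof.
move=> q0 qq'.
have rq : ratr q <= ratr q' :> R by rewrite ler_rat.
have rq0 : 0 <= ratr q :> R by rewrite ler0q.
have mE : measurable [set u : Om | Z q u = Z q' u].
  rewrite (_ : [set u : Om | _] = ~` [set u : Om | Z q u != Z q' u]).
    by apply: measurableC; exact: measurable_rat_process_neq.
  by apply/seteqP; split => u /= => [->|/negP]; rewrite ?eqxx // negbK => /eqP.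
have -> : [set u : Om | Z q u != Z q' u] = ~` [set u : Om | Z q u = Z q' u].
  by apply/seteqP; split => u /= /eqP.
rewrite probability_setC // (measure_fibers _ mE (mZ q)).
rewrite (eq_bigr (fun z => (path_weight p v0 [:: (ratr q, z); (ratr q', z)])%:E)); last first.
  move=> z _; have := @rational_fdd R n p p_ge0 p_sum1 p0 pD v0 v0_ge0 v0_sum1
    [:: (q, z); (q', z)].
  rewrite /real_times /= => <- //; last 2 first.
  - by rewrite q0 (le_trans q0 qq').
  - by rewrite qq'.
  congr (P1 _); apply/seteqP; split => u; rewrite /follows /=.
    by move=> [e <-]; rewrite -e !eqxx.
  by move=> /and3P[/eqP <- /eqP <- _].
rewrite sumEFin -EFinB lee_fin lerBlDr -lerBlDl /path_weight exchange_big /=.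
have <- : \sum_x v0 x * (\sum_z p (ratr q) x z * (1 - La * (ratr q' - ratr q))) =
    1 - La * (ratr q' - ratr q).
  under eq_bigr do rewrite -mulr_suml p_sum1 // mul1r.
  by rewrite -mulr_suml v0_sum1 mul1r.
apply: ler_sum => x _; rewrite -mulr_sumr ler_wpM2l //.
apply: ler_sum => z _; rewrite subr0 mulr1 ler_wpM2l ?p_ge0 //.
by rewrite p_stay // subr_ge0.
Qed.

Definition changes_along (s : seq rat) (u : R) : nat := nb_changes (Z 0 u) (map (Z^~ u) s).

Let measurable_changes q s :
  measurable_fun setT (fun u : Om => ((nb_changes (Z q u) (map (Z^~ u) s))%:R : R)%:E).
Proof.
elim: s q => [|q' s IH] q /=; first exact: measurable_cst.
under eq_fun do rewrite natrD EFinD; apply: emeasurable_funD; last exact: IH.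
rewrite (_ : (fun u => _) = EFin \o \1_[set u : Om | Z q u != Z q' u]).
  by apply/measurable_EFinP; exact: measurable_indic (measurable_rat_process_neq q q').
by apply/funext => u /=; rewrite indicE mem_setE.
Qed.

(** The bound La times the length of the interval does not depend on how many rational
times are observed. *)
Lemma expected_changes q s : 0 <= q -> path <=%R q s ->
  (\int[P1]_u ((nb_changes (Z q u) (map (Z^~ u) s))%:R : R)%:E <=
   (La * (ratr (last q s) - ratr q))%:E)%E.
Proof.
elim: s q => [|q' s IH] q q0 /=.
  by move=> _; rewrite subrr mulr0 integral0_eq.
move=> /andP[qq' qs]; under eq_integral do rewrite natrD EFinD.
have ind : (fun u => ((Z q u != Z q' u)%:R : R)%:E) = EFin \o \1_[set u : Om | Z q u != Z q' u].
  by apply/funext => u /=; rewrite indicE mem_setE.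
have mind : measurable_fun setT (fun u : Om => ((Z q u != Z q' u)%:R : R)%:E).
  rewrite ind; apply/measurable_EFinP.
  exact: measurable_indic (measurable_rat_process_neq q q').
have mch := measurable_changes q' s.
rewrite ge0_integralD //.
rewrite (_ : La * _ = La * (ratr q' - ratr q) + La * (ratr (last q' s) - ratr q')); last by ring.
rewrite EFinD; apply: leeD; last by apply: IH => //; exact: le_trans qq'.
rewrite ind integral_indic //; last exact: measurable_rat_process_neq.
by rewrite setIT; exact: rat_process_change.
Qed.

(** The sorted rationals of [0, K] whose code is below N; these grids increase with N and
exhaust the rationals of [0, K]. *)
Definition rat_grid (K N : nat) : seq rat :=
  sort <=%R [seq q <- pmap (@pickle_inv rat) (iota 0 N) | (0 <= q) && (q <= K%:R)].

Let enum_uniq N : uniq (pmap (@pickle_inv rat) (iota 0 N)).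
Proof. exact: (pmap_uniq (@pickle_invK rat)) (iota_uniq _ _). Qed.

Lemma rat_grid_uniq K N : uniq (rat_grid K N).
Proof. by rewrite sort_uniq filter_uniq. Qed.

Lemma mem_rat_grid K N q : (q \in rat_grid K N) = [&& 0 <= q, q <= K%:R & (pickle q < N)%N].
Proof.
rewrite mem_sort mem_filter -andbA; do 2 congr (_ && _).
rewrite mem_pmap; apply/mapP/idP => [[k]|qN].
  rewrite mem_iota /= add0n => kN e; suff -> : pickle q = k by [].
  by have := @pickle_invK rat k; rewrite -e.
by exists (pickle q); rewrite ?mem_iota ?pickleK_inv.
Qed.

Lemma rat_grid_sorted K N : sorted <=%R (rat_grid K N).
Proof. exact: sort_sorted le_total _. Qed.

Lemma subseq_rat_grid K N N' : (N <= N')%N -> subseq (rat_grid K N) (rat_grid K N').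
Proof.
move=> NN'; apply: (subseq_sort le_total le_trans).
by rewrite -(subnKC NN') iotaD pmap_cat filter_cat prefix_subseq.
Qed.

Lemma rat_grid_path K N : path <=%R 0 (rat_grid K N).
Proof.
have := rat_grid_sorted K N; have := mem_rat_grid K N.
case: (rat_grid K N) => //= q s /(_ q); rewrite mem_head => /esym/andP[q0 _] qs.
by rewrite q0.
Qed.

Lemma rat_grid_last K N : last 0 (rat_grid K N) <= K%:R.
Proof.
have := mem_last 0 (rat_grid K N); rewrite in_cons => /orP[/eqP ->|]; first exact: ler0n.
by rewrite mem_rat_grid => /and3P[].
Qed.

Lemma sub_rat_grid K s : sorted <%R s -> all (fun q => (0 <= q) && (q <= K%:R)) s ->
  exists N, subseq s (rat_grid K N).
Proof.
move=> ss /allP sK; exists (\max_(q <- s) pickle q).+1; set N := _.+1.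
rewrite (_ : s = [seq q <- rat_grid K N | q \in s]); first exact: filter_subseq.
apply: (@sorted_eq _ <=%R); [exact: le_trans|exact: le_anti|exact: sub_sorted ltW _ ss| |].
  by apply: sorted_filter; [exact: le_trans|exact: rat_grid_sorted].
apply: uniq_perm; [|by rewrite filter_uniq // rat_grid_uniq|move=> q].
  by apply: (sorted_uniq _ _ ss); [exact: lt_trans|exact: ltxx].
rewrite mem_filter mem_rat_grid; apply/idP/andP => [qs|[]//]; split => //.
by have /andP[-> ->] := sK q qs; rewrite ltnS (big_rem q) //= leq_maxl.
Qed.

Lemma changes_grid_le K N N' u : (N <= N')%N ->
  (changes_along (rat_grid K N) u <= changes_along (rat_grid K N') u)%N.
Proof. by move=> NN'; apply/nb_changes_subseq/map_subseq/subseq_rat_grid. Qed.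

Definition good_path : set Om :=
  [set u | forall K, exists B, forall N, (changes_along (rat_grid K N) u <= B)%N].

Lemma measurable_good_path : measurable good_path.
Proof.
rewrite (_ : good_path = \bigcap_K \bigcup_B \bigcap_N
    [set u : Om | (changes_along (rat_grid K N) u <= B)%N]); last first.
  apply/seteqP; split => u /= gu K; last by have [B _ BP] := gu K I; exists B => N; exact: BP.
  by move=> _; have [B BP] := gu K; exists B => // N _; exact: BP.
apply: bigcap_measurable => // K _; apply: bigcup_measurable => B _.
apply: bigcap_measurable => // N _.
rewrite (_ : [set _ | _] = (fun u : Om => ((changes_along (rat_grid K N) u)%:R : R)%:E)
    @^-1` `]-oo, (B%:R : R)%:E]).
  by rewrite -[_ @^-1` _]setTI; apply: measurable_changes => //; exact: emeasurable_itv.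
by apply/seteqP; split => u /=; rewrite in_itv /= lee_fin ler_nat.
Qed.

(** By monotone convergence the total number of changes up to time K has expectation at
most La K, so it is almost surely finite. *)
Lemma good_path_full : P1 good_path = 1%E.
Proof.
suff : P1 (~` good_path) = 0%E.
  move=> e; have : P1 (~` (~` good_path)) = (1 - P1 (~` good_path))%E.
    by apply: probability_setC; apply: measurableC; exact: measurable_good_path.
  by rewrite setCK e sube0.
apply: measure_negligible; first by apply: measurableC; exact: measurable_good_path.
pose g K N (u : Om) : \bar R := ((changes_along (rat_grid K N) u)%:R : R)%:E.
have mg K N : measurable_fun setT (g K N) by exact: measurable_changes.
have g0 K N u : (0 <= g K N u)%E by rewrite lee_fin.
have gnd K u : nondecreasing_seq (g K ^~ u).
  by move=> N N' NN'; rewrite lee_fin ler_nat changes_grid_le.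
pose G K u := limn (g K ^~ u).
have intG K : (\int[P1]_u G K u <= (La * K%:R)%:E)%E.
  have gnd' u : setT u -> nondecreasing_seq (g K ^~ u) by move=> _; exact: gnd.
  rewrite monotone_convergence //.
  apply: lime_le.
    apply: ereal_nondecreasing_is_cvgn => N N' NN'; apply: ge0_le_integral => // u _.
    exact: gnd.
  apply: nearW => N; apply: le_trans (expected_changes (lexx 0) (rat_grid_path K N)) _.
  by rewrite lee_fin ler_wpM2l // rmorph0 subr0 -ratr_nat ler_rat rat_grid_last.
have mG K : measurable_fun setT (G K).
  by apply: emeasurable_fun_cvg (mg K) _ => u _; apply: ereal_nondecreasing_is_cvgn; exact: gnd.
have G0 K u : (0 <= G K u)%E.
  by apply: lime_ge; [apply: ereal_nondecreasing_is_cvgn; exact: gnd|exact: nearW].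
have aeG K : {ae P1, forall u, setT u -> G K u \is a fin_num}.
  apply: integrable_ae => //; apply/integrableP; split; first exact: mG.
  under eq_integral do rewrite gee0_abs //.
  by apply: le_lt_trans (intG K) _; rewrite ltry.
have : P1.-negligible (\bigcup_K ~` [set u | setT u -> G K u \is a fin_num]).
  by apply: negligible_bigcup => K; exact: aeG.
apply: negligibleS => u /= ngu; apply: contrapT => nb; apply: ngu => K.
have Gfin : G K u \is a fin_num.
  by apply: contrapT => nfin; apply: nb; exists K => //= H; apply: nfin; exact: H.
exists (Num.truncn (fine (G K u))).+1 => N.
have : (g K N u <= G K u)%E.
  rewrite /G (cvg_lim _ (ereal_nondecreasing_cvgn (gnd K u))) //.
  by apply: ereal_sup_ubound; exists N.
rewrite -(fineK Gfin) lee_fin => le1; rewrite -(ler_nat R); apply: le_trans le1 _.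
exact/ltW/truncnS_gt.
Qed.

(** Without a right limit at t, arbitrarily many changes can be chained to the right of t,
closing in on t from above. *)
Lemma good_path_right_limit (u t : R) : good_path u -> 0 <= t ->
  exists z m, forall q, t < (ratr q : R) < t + m.+1%:R^-1 -> Z q u = z.
Proof.
move=> gu t0; apply: contrapT => nolim.
(* Without a right limit, the path takes two values arbitrarily close to t on its right. *)
have osc (e : R) : 0 < e -> exists q q', [/\ t < ratr q :> R, q < q', ratr q' < t + e & Z q u != Z q' u].
  move=> e0; have [m me] : exists m : nat, m.+1%:R^-1 < e.
    exists (Num.truncn e^-1); rewrite -[ltRHS]invrK ltf_pV2 ?posrE ?invr_gt0 ?ltr0n //.
    exact: truncnS_gt.
  have m0 : (0 : R) < m.+1%:R^-1 by rewrite invr_gt0 ltr0n.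
  have [q0] : exists q, ratr q \in `]t, (t + m.+1%:R^-1)[ by apply: rat_in_itvoo; rewrite ltrDl.
  rewrite in_itv /= => /andP[tq0 q0m].
  apply: contrapT => noosc; apply: nolim; exists (Z q0 u), m => q /andP[tq qm].
  have [lt|lt|-> //] := ltgtP q q0; apply: contrapT => /eqP ne; apply: noosc.
    by exists q, q0; split => //; apply: lt_trans q0m _; rewrite ltrD2l.
  by exists q0, q; split; rewrite // 1?eq_sym //; apply: lt_trans qm _; rewrite ltrD2l.
(* Two more times, closer to t and with different values, are prepended to a list of
times with N changes. *)
have many N : exists s, [/\ sorted <%R s, all (fun q => t < (ratr q : R) < t + 1) s &
    forall x, (N <= nb_changes x (map (Z^~ u) s))%N].
  elim: N => [|N [s [ss sall sN]]]; first by exists [::].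
  have [e [e0 eP]] : exists e : R, 0 < e /\
      forall q, (ratr q : R) < t + e -> (ratr q : R) < t + 1 /\ (if s is q1 :: _ then q < q1 else true).
    case: s ss sall {sN} => [|q1 s] ss /=; first by exists 1; split => // q ->.
    move=> /andP[/andP[tq1 q1t] _]; exists (ratr q1 - t); split; first by rewrite subr_gt0.
    move=> q; rewrite addrC subrK => qq1; split; first exact: lt_trans q1t.
    by rewrite -(ltr_rat R).
  have [q [q' [tq qq' q'e ne]]] := osc e e0.
  have [q't q's] := eP q' q'e.
  have rqq' : ratr q < ratr q' :> R by rewrite ltr_rat.
  exists [:: q, q' & s]; split => [||x] /=.
  - by rewrite qq'; move: ss q's; case: (s) => //= q1 s' -> ->.
  - by rewrite tq q't sall (lt_trans rqq' q't) (lt_trans tq rqq').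
  - by rewrite ne add1n addnS ltnS (leq_trans (sN (Z q' u))) // leq_addl.
pose K := (Num.truncn (t + 1)).+1.
have [B BP] := gu K; have [s [ss sall sN]] := many B.+1.
have [|N sub] := @sub_rat_grid K s ss.
  apply/allP => q /(allP sall) /andP[tq qt]; rewrite -(ler0q R) -(ler_rat R) ratr_nat.
  rewrite (le_trans t0 (ltW tq)) /=; apply/ltW/(lt_trans qt); exact: truncnS_gt.
have := leq_trans (sN (Z 0 u)) (nb_changes_subseq (Z 0 u) (map_subseq (Z^~ u) sub)).
by move/leq_trans => /(_ _ (BP N)); rewrite ltnn.
Qed.

End good_set.

(** * The right-continuous chain *)

Section cadlag.
Variables (R : realType) (n : nat).
Notation state := 'I_n.+1.
Variable p : R -> 'M[R]_n.+1.
Hypothesis p_ge0 : forall t, 0 <= t -> forall x y, 0 <= p t x y.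
Hypothesis p_sum1 : forall t, 0 <= t -> forall x, \sum_y p t x y = 1.
Hypothesis p0 : p 0 = 1%:M.
Hypothesis pD : forall s t, 0 <= s -> 0 <= t -> p (s + t) = p s *m p t.
Variable La : R.
Hypothesis La0 : 0 <= La.
Hypothesis p_stay : forall t x, 0 <= t -> 1 - La * t <= p t x x.
Hypothesis p_lip : forall s h x y, 0 <= s -> 0 <= h -> `|p (s + h) x y - p s x y| <= La * h.
Variable v0 : state -> R.
Hypothesis v0_ge0 : forall x, 0 <= v0 x.
Hypothesis v0_sum1 : \sum_x v0 x = 1.

Local Notation P1 := (@unit_lebesgue R).
Local Notation Z := (rat_process p v0).
Local Notation Om := (measurableTypeR R).
Local Notation good := (good_path p v0).

Let mZ q z : measurable [set u : Om | Z q u = z].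
Proof. exact: (measurable_rat_process p_ge0 p_sum1 pD v0_ge0 v0_sum1). Qed.

Definition right_limit (t u : R) (z : state) : Prop :=
  exists m, forall q, t < (ratr q : R) < t + m.+1%:R^-1 -> Z q u = z.

Lemma right_limit_unique t u z z' : right_limit t u z -> right_limit t u z' -> z = z'.
Proof.
move=> [m mz] [m' mz'].
have [q] : exists q, (ratr q : R) \in `]t, (t + Num.min m.+1%:R^-1 m'.+1%:R^-1)[.
  by apply: rat_in_itvoo; rewrite ltrDl lt_min !invr_gt0 !ltr0n.
rewrite in_itv /= => /andP[tq qt]; rewrite -(mz q) ?(mz' q) // tq /=; apply: lt_le_trans qt _;
  by rewrite lerD2l ge_min lexx ?orbT.
Qed.

(** On the null set of bad paths the chain is constant, so that every path is right
continuous. *)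
Definition chain (t u : R) : state :=
  if `[< good u >] then odflt ord0 [pick z | `[< right_limit t u z >]] else ord0.

Lemma chain_right_limit t u : good u -> 0 <= t -> right_limit t u (chain t u).
Proof.
move=> gu t0; rewrite /chain asboolT //; case: pickP => [z /asboolP //|no].
have [z [m zm]] := good_path_right_limit gu t0.
by have /asboolP[] := no z; exists m.
Qed.

(** A right limit among finitely many states is attained on an interval to the right. *)
Lemma chain_right_constant t u : 0 <= t ->
  exists2 e : R, 0 < e & forall v, t <= v < t + e -> chain v u = chain t u.
Proof.
move=> t0; have [gu|ngu] := pselect (good u); last first.
  by exists 1 => // v _; rewrite /chain asboolF.
have [m mP] := chain_right_limit gu t0.
have m0 : (0 : R) < m.+1%:R^-1 by rewrite invr_gt0 ltr0n.
exists m.+1%:R^-1 => // v /andP[tv vt].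
have [m' mP'] := chain_right_limit gu (le_trans t0 tv).
have [q] : exists q, (ratr q : R) \in `]v, (Num.min (v + m'.+1%:R^-1) (t + m.+1%:R^-1))[.
  by apply: rat_in_itvoo; rewrite lt_min vt ltrDl invr_gt0 ltr0n.
rewrite in_itv /= lt_min => /and3P[vq qv' qt]; rewrite -(mP' q) ?vq // mP //.
by rewrite (le_lt_trans tv vq).
Qed.

Lemma measurable_right_limit t z : measurable [set u : Om | right_limit t u z].
Proof.
pose cell m (o : option rat) : set Om := if o is Some q then
  if t < (ratr q : R) < t + m.+1%:R^-1 then [set u | Z q u = z] else setT else setT.
have mcell m o : measurable (cell m o).
  by case: o => [q|] //=; case: ifP => _; [exact: mZ|exact: measurableT].
rewrite (_ : [set u : Om | _] = \bigcup_m \bigcap_k cell m (unpickle k)).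
  by apply: bigcup_measurable => m _; apply: bigcap_measurable => // k _; exact: mcell.
apply/seteqP; split => u.
  move=> [m mP]; exists m => // k _; move: (unpickle k) => [q|//].
  by rewrite /cell; case: ifP => // tq; exact: mP.
move=> [m _ mP]; exists m => q tq; have := mP (pickle q) I.
by rewrite pickleK /cell tq.
Qed.

Lemma measurable_chain t z : 0 <= t -> measurable [set u : Om | chain t u = z].
Proof.
move=> t0.
have mgood := measurable_good_path p_ge0 p_sum1 pD v0_ge0 v0_sum1.
rewrite (_ : [set u : Om | _] = (good `&` [set u | right_limit t u z]) `|`
    (~` good `&` (if z == ord0 then setT else set0))).
  apply: measurableU; apply: measurableI => //; first exact: measurable_right_limit.
    exact: measurableC.
  by case: ifP.
apply/seteqP; split => u /=.
  move=> <-; have [gu|ngu] := pselect (good u); [left|right]; split => //.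
    exact: chain_right_limit.
  by rewrite /chain asboolF.
move=> [[gu uz]|[ngu]]; first exact: right_limit_unique (chain_right_limit gu t0) uz.
by rewrite /chain asboolF //; case: eqP => [->|].
Qed.

(** The approximations of different times have the same denominator, which makes the
approximation monotone in the time. *)
Definition rat_above (m : nat) (t : R) : rat := (Num.floor (t * m.+1%:R) + 1)%:~R / m.+1%:R.

Lemma ratr_rat_above m t : ratr (rat_above m t) = (Num.floor (t * m.+1%:R) + 1)%:~R / m.+1%:R :> R.
Proof. by rewrite /rat_above fmorph_div /= ratr_int ratr_nat. Qed.

Lemma rat_above_bounds m t : t < (ratr (rat_above m t) : R) <= t + m.+1%:R^-1.
Proof.
have m0 : (0 : R) < m.+1%:R by rewrite ltr0n.
rewrite ratr_rat_above ltr_pdivlMr // floorD1_gt ler_pdivrMr // mulrDl mulVf ?gt_eqF //.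
by rewrite intrD lerD2r floor_le_tmp.
Qed.

Lemma rat_above_le m s t : s <= t -> rat_above m s <= rat_above m t.
Proof.
move=> st; rewrite ler_pM2r ?invr_gt0 ?ltr0n // ler_int lerD2r le_floor //.
by rewrite ler_wpM2r ?ler0n.
Qed.

Lemma cvg_rat_above (t : R) : (fun m => ratr (rat_above m t) : R) @ \oo --> t.
Proof.
apply: (@squeeze_cvgr _ _ _ _ (fun=> t) (fun m => t + m.+1%:R^-1)).
- by apply: nearW => m; have /andP[/ltW -> ->] := rat_above_bounds m t.
- exact: cvg_cst.
- rewrite -[X in _ --> X]addr0; apply: cvgD; first exact: cvg_cst.
  exact: cvg_harmonic.
Qed.

Lemma p_lip_sym s t x y : 0 <= s -> 0 <= t -> `|p s x y - p t x y| <= La * `|s - t|.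
Proof.
move=> s0 t0; wlog st : s t s0 t0 / t <= s.
  have [st|/ltW ts] := leP t s; first exact.
  by move=> H; rewrite distrC (distrC s); exact: H.
have h0 : 0 <= s - t by rewrite subr_ge0.
by rewrite (ger0_norm h0); have := p_lip x y t0 h0; rewrite (addrC t) subrK.
Qed.

Lemma cvg_p (a : nat -> R) (t : R) x y : (forall m, 0 <= a m) -> 0 <= t -> a @ \oo --> t ->
  (fun m => p (a m) x y) @ \oo --> p t x y.
Proof.
move=> a0 t0 at_; apply/cvgrPdist_le => e e0.
have L0 : 0 < La + 1 by rewrite ltr_wpDl.
have e'0 : 0 < e / (La + 1) by rewrite divr_gt0.
move/cvgrPdist_le : at_ => /(_ _ e'0); apply: filterS => m am.
apply: le_trans (p_lip_sym _ _ t0 (a0 m)) _.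
apply: (@le_trans _ _ ((La + 1) * `|t - a m|)); first by rewrite ler_wpM2r // lerDl.
by rewrite mulrC -ler_pdivlMr.
Qed.

Lemma cvg_path_weight_from x (a : nat -> R) (t : R) l :
  (forall m, path <=%R (a m) (map (fun y => ratr (rat_above m y.1)) l)) ->
  a @ \oo --> t -> chronological t l ->
  (fun m => path_weight_from p x (a m) [seq (ratr (rat_above m y.1) : R, y.2) | y <- l]) @ \oo -->
  path_weight_from p x t l.
Proof.
elim: l x a t => [|[t' y] l IH] x a t /=; first by move=> *; exact: cvg_cst.
move=> H at_; rewrite /chronological /= => /andP[tt' lP].
apply: cvgM; last first.
  by apply: IH => // [m|]; [have /andP[] := H m|exact: cvg_rat_above].
apply: cvg_p; [|by rewrite subr_ge0|].
  by move=> m; have /andP[] := H m; rewrite subr_ge0.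
by apply: cvgB => //; exact: cvg_rat_above.
Qed.

Definition visits (l : seq (R * state)) : set Om := [set u | all (fun x => chain x.1 u == x.2) l].

(** Approximate the times from above by rationals.  The finite-dimensional laws converge
because p is continuous, and almost surely the rational values converge to those of the
chain. *)
Lemma chain_fdd l : chronological 0 l -> measurable (visits l) /\
  P1 (visits l) = (path_weight p v0 l)%:E.
Proof.
move=> lP; have lpos x : x \in l -> 0 <= x.1.
  move=> xl; have := order_path_min le_trans lP; move/allP; apply; exact: map_f.
have mvis : measurable (visits l).
  elim: l lpos {lP} => [|[t z] l IH] lpos.
    by rewrite (_ : visits _ = setT) //; apply/seteqP; split.
  rewrite (_ : visits _ = [set u | chain t u = z] `&` visits l).
    apply: measurableI; first by apply: measurable_chain; apply: (lpos (t, z)); rewrite mem_head.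
    by apply: IH => x xl; apply: lpos; rewrite in_cons xl orbT.
  by apply/seteqP; split => u; rewrite /visits /=; [move=> /andP[/eqP]|move=> [-> ->]; rewrite eqxx].
split => //.
pose lm m := [seq (rat_above m x.1, x.2) | x <- l].
have ra0 m t : 0 <= t -> 0 <= rat_above m t.
  move=> t0; rewrite -(ler0q R) /=; have /andP[lt _] := rat_above_bounds m t.
  exact: le_trans t0 (ltW lt).
have lm_path m : path <=%R 0 (map (fun y : R * state => ratr (rat_above m y.1) : R) l).
  move: lP lpos; case: (l) => //= -[t z] l' /andP[t0 l'P] _.
  rewrite /= ler0q ra0 //=.
  elim: l' t t0 l'P => //= y l' IH t t0 /andP[ty yl].
  by rewrite ler_rat rat_above_le //= IH // (le_trans t0 ty).
have cvW : (fun m => P1 (follows p v0 (lm m))) @ \oo --> (path_weight p v0 l)%:E.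
  rewrite (_ : (fun m => _) = EFin \o
      (fun m => path_weight p v0 [seq (ratr (rat_above m y.1) : R, y.2) | y <- l])).
    apply: cvg_EFin; first exact: nearW.
    apply: cvg_big => [|x _]; first exact: add_continuous.
    apply: cvgMr; apply: cvg_path_weight_from => //.
    exact: cvg_cst.
  apply/funext => m /=; rewrite (@rational_fdd R n p) //.
  - by rewrite /real_times /lm -map_comp.
  - by apply/allP => y /mapP[x xl ->] /=; apply: ra0; exact: lpos.
  - have := path_sorted (lm_path m).
    rewrite (_ : map _ l = map (ratr : rat -> R) (map fst (lm m))); last by rewrite -!map_comp.
    move: (map fst (lm m)) => ll; rewrite sorted_map; apply: sub_sorted => a b /=; by rewrite ler_rat.
have cvV : (fun m => P1 (follows p v0 (lm m))) @ \oo --> P1 (visits l).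
  rewrite (_ : (fun m => _) = fun m => (\int[P1]_u (\1_(follows p v0 (lm m)) u)%:E)%E); last first.
    apply/funext => m; rewrite integral_indic ?setIT //.
    exact: measurable_follows.
  rewrite -[X in _ --> P1 X]setIT -integral_indic //.
  have mfol m : measurable (follows p v0 (lm m)) by exact: measurable_follows.
  have [|||||_ _] := @dominated_convergence _ _ _ P1 setT measurableT
    (fun m u => (\1_(follows p v0 (lm m)) u)%:E) (fun u => (\1_(visits l) u)%:E) (fun=> 1%E).
  - by move=> m; apply/measurable_EFinP; exact: measurable_indic.
  - by apply/measurable_EFinP; exact: measurable_indic.
  - have mgood := measurable_good_path p_ge0 p_sum1 pD v0_ge0 v0_sum1.
    exists (~` good); split; first exact: measurableC.
      transitivity (1 - P1 good)%E; first exact: (probability_setC P1).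
      by rewrite (good_path_full p_ge0 p_sum1 p0 pD La0 p_stay v0_ge0 v0_sum1) subee.
    move=> u /= nu gu; apply: nu => _; apply: cvg_near_cst.
    have ev : \forall m \near \oo, forall x, x \in l -> Z (rat_above m x.1) u = chain x.1 u.
      have [M MP] : exists M, forall x, x \in l ->
          forall m, (M < m)%N -> Z (rat_above m x.1) u = chain x.1 u.
        have one (x : R * state) : 0 <= x.1 -> exists M, forall m, (M < m)%N ->
            Z (rat_above m x.1) u = chain x.1 u.
          move=> x0; have [M MP] := chain_right_limit gu x0; exists M => m Mm; apply: MP.
          have /andP[-> le] := rat_above_bounds m x.1; apply: le_lt_trans le _.
          by rewrite ltrD2l ltf_pV2 ?posrE ?ltr0n // ltr_nat.
        elim: (l) lpos => [|x l' IH] lpos'; first by exists 0%N.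
        have [|M1 M1P] := IH; first by move=> y yl; rewrite lpos' // in_cons yl orbT.
        have [|M2 M2P] := @one x; first by rewrite lpos' // mem_head.
        exists (maxn M1 M2) => y; rewrite in_cons => /orP[/eqP ->|yl] m; rewrite gtn_max.
          by move=> /andP[_]; exact: M2P.
        by move=> /andP[+ _]; exact: M1P.
      by exists M.+1 => // m /= Mm x xl; exact: MP.
    apply: filterS ev => m mP; congr EFin; rewrite !indicE; congr (_%:R); congr nat_of_bool.
    apply/idP/idP; rewrite !inE /follows /visits /lm /= all_map => /allP H;
      by apply/allP => x xl; have := H x xl; rewrite /= mP.
  - exact: (finite_measure_integrable_cst P1 1).
  - by apply: aeW => u m _; rewrite /= lee_fin indicE normr_nat (ler_nat _ _ 1) leq_b1.
  - exact.
by apply: (cvg_unique _ cvV cvW).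
Qed.

End cadlag.

(** * Markov property and holding times *)

Section markov_chain.
Context d (T : measurableType d) (R : realType) (P : probability T R) (n : nat).
Notation state := 'I_n.+1.
Variables (p : R -> 'M[R]_n.+1) (v0 : state -> R) (Y : R -> T -> state).
Hypothesis p_ge0 : forall t, 0 <= t -> forall x y, 0 <= p t x y.
Hypothesis p0 : p 0 = 1%:M.
Hypothesis v0_ge0 : forall x, 0 <= v0 x.
Hypothesis mY : forall t z, 0 <= t -> measurable [set w | Y t w = z].
Hypothesis Y_fdd : forall l, chronological 0 l ->
  P [set w | all (fun x => Y x.1 w == x.2) l] = (path_weight p v0 l)%:E.
Hypothesis Y_right : forall t w, 0 <= t ->
  exists2 e : R, 0 < e & forall v, t <= v < t + e -> Y v w = Y t w.

Definition cylinder (l : seq (R * state)) : set T := [set w | all (fun x => Y x.1 w == x.2) l].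

Lemma measurable_cylinder l : all (fun x => 0 <= x.1) l -> measurable (cylinder l).
Proof.
elim: l => [|[t z] l IH] /=.
  by move=> _; rewrite (_ : cylinder _ = setT) //; apply/seteqP; split.
move=> /andP[t0 l0]; rewrite (_ : cylinder _ = [set w | Y t w = z] `&` cylinder l).
  by apply: measurableI; [exact: mY|exact: IH].
by apply/seteqP; split => u; rewrite /cylinder /=; [move=> /andP[/eqP]|move=> [-> ->]; rewrite eqxx].
Qed.

Definition state_filtration (s : R) : set (set T) :=
  <<s [set A | exists u z, 0 <= u <= s /\ A = [set w | Y u w = z]] >>.

Lemma sub_state_filtration s : 0 <= s -> state_filtration s `<=` measurable.
Proof.
move=> s0; apply: smallest_sub; first exact: sigma_algebra_measurable.
by move=> A [u [z [/andP[u0 _] ->]]]; exact: mY.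
Qed.

Lemma chronological_rcons (t : R) (l : seq (R * state)) q z : chronological t (rcons l (q, z)) =
  chronological t l && (last t (map fst l) <= q).
Proof. by rewrite /chronological map_rcons rcons_path. Qed.

Let by_time : rel (R * state) := fun x y => x.1 <= y.1.
Let by_time_total : total by_time. Proof. by move=> x y; exact: le_total. Qed.

Lemma cylinder_markov l s h x y : 0 <= s -> 0 <= h -> all (fun x => 0 <= x.1 <= s) l ->
  P (cylinder l `&` ([set w | Y s w = x] `&` [set w | Y (s + h) w = y])) =
  ((p h x y)%:E * P (cylinder l `&` [set w | Y s w = x]))%E.
Proof.
move=> s0 h0 ls; pose l' := sort by_time l.
have l's : all (fun x => 0 <= x.1 <= s) l' by rewrite all_sort.
have l'P : chronological 0 l'.
  have : sorted by_time l' by exact: sort_sorted.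
  rewrite /chronological; case: (l') l's => //= y0 l0 /andP[/andP[-> _] _] /= yl.
  by rewrite path_map.
have last_le : last 0 (map fst l') <= s.
  have := mem_last 0 (map fst l'); rewrite in_cons => /orP[/eqP -> //|/mapP[z zl ->]].
  by have /andP[] := allP l's _ zl.
have e1 : cylinder l `&` [set w | Y s w = x] = cylinder (rcons l' (s, x)).
  apply/seteqP; split => w; rewrite /cylinder /= all_rcons all_sort /=.
    by move=> [-> ->]; rewrite eqxx.
  by move=> /andP[/eqP].
have e2 : cylinder l `&` ([set w | Y s w = x] `&` [set w | Y (s + h) w = y]) =
    cylinder (rcons (rcons l' (s, x)) (s + h, y)).
  apply/seteqP; split => w; rewrite /cylinder /= !all_rcons all_sort /=.
    by move=> [-> [-> ->]]; rewrite !eqxx.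
  by move=> /and3P[/eqP ? /eqP].
rewrite e1 e2 !Y_fdd ?chronological_rcons ?l'P ?last_le //; last first.
  by rewrite map_rcons last_rcons /= lerDl.
by rewrite path_weight_rcons -EFinM mulrC.
Qed.

(** Both sides are finite measures in A that agree on the cylinders, which form a
pi-system generating the past. *)
Lemma state_markov s h x y A : 0 <= s -> 0 <= h -> state_filtration s A ->
  P (A `&` ([set w | Y s w = x] `&` [set w | Y (s + h) w = y])) =
  ((p h x y)%:E * P (A `&` [set w | Y s w = x]))%E.
Proof.
move=> s0 h0 As.
have sh0 : 0 <= s + h by rewrite addr_ge0.
have mE : measurable ([set w | Y s w = x] `&` [set w | Y (s + h) w = y]).
  by apply: measurableI; exact: mY.
pose m1 : {measure set T -> \bar R} := mrestr P mE.
pose m2 : {measure set T -> \bar R} := mscale (NngNum (p_ge0 h0 x y)) (mrestr P (mY x s0)).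
pose G : set (set T) := [set A | exists2 l, all (fun x => 0 <= x.1 <= s) l & A = cylinder l].
have lpos l : all (fun x : R * state => 0 <= x.1 <= s) l -> all (fun x => 0 <= x.1) l.
  by apply: sub_all => z /andP[].
have GA : <<s G >> A.
  apply: (@sub_sigma_algebra2 _ setT) As => B [u [z [us ->]]].
  exists [:: (u, z)]; rewrite /= ?us //.
  by apply/seteqP; split => w; rewrite /cylinder /= andbT => /eqP.
apply: (@g_sigma_algebra_measure_unique _ _ _ G _ (fun=> setT) _ _ m1 m2 _ _ _ A GA).
- by move=> B [l ls ->]; apply: measurable_cylinder; exact: lpos.
- by move=> _; exists [::] => //; apply/seteqP; split.
- by rewrite bigcup_const.
- move=> B C [l1 ls1 ->] [l2 ls2 ->]; exists (l1 ++ l2); first by rewrite all_cat ls1.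
  by apply/seteqP; split => w; rewrite /cylinder /= all_cat; [move=> [-> ->]|move=> /andP[]].
- by move=> B [l ls ->]; exact: cylinder_markov.
- move=> k; rewrite /m1 /= /mrestr setTI; apply: le_lt_trans (probability_le1 P mE) _.
  by rewrite ltry.
Qed.

Lemma state_law t z : 0 <= t ->
  P [set w | Y t w = z] = (\sum_x v0 x * p t x z)%:E.
Proof.
move=> t0; transitivity (P [set w | all (fun x => Y x.1 w == x.2) [:: (t, z)]]).
  congr (P _); apply/seteqP; split => w /=; first by move=> ->; rewrite eqxx.
  by move=> /andP[/eqP].
rewrite Y_fdd; last by rewrite /chronological /= t0.
by congr EFin; apply: eq_bigr => x _; rewrite /= subr0 mulr1.
Qed.

Definition stays (s v : R) (x : state) : set T :=
  [set w | forall u, 0 <= u <= v -> Y (s + u) w = x].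

Definition grid_times (s h : R) (N : nat) : seq R := [seq s + h * j%:R | j <- iota 0 N.+1].

Lemma grid_weight s h x N : 0 <= s -> 0 <= h ->
  P (cylinder [seq (t, x) | t <- grid_times s h N]) =
  (P [set w | Y s w = x] * (p h x x ^+ N)%:E)%E.
Proof.
move=> s0 h0; rewrite state_law // -EFinM Y_fdd.
  have gw a b : path_weight_from p x (s + h * a%:R) [seq (t, x) | t <-
      [seq s + h * j%:R | j <- iota a.+1 b]] = p h x x ^+ b.
    elim: b a => [|b IH] a //=; rewrite IH exprS; congr (p _ x x * _).
    by rewrite -[a.+1%:R]natr1; ring.
  congr EFin; rewrite /path_weight mulr_suml; apply: eq_bigr => y _ /=.
  by rewrite (gw 0%N) mulr0 addr0 subr0 mulrA.
rewrite /chronological -map_comp /= mulr0 addr0 s0 /=.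
have gp a b : path <=%R (s + h * a%:R) [seq (fst \o pair^~ x) t | t <-
    [seq s + h * j%:R | j <- iota a.+1 b]].
  elim: b a => [|b IH] a //=; rewrite IH andbT lerD2l ler_wpM2l // ler_nat.
  exact: leqnSn.
by have := gp 0%N N; rewrite mulr0 addr0.
Qed.

(** By right continuity, a path that takes the value x at all dyadic subdivisions of
[s, s + v] takes it throughout. *)
Lemma stays_dyadic s v x : 0 <= s -> 0 <= v ->
  stays s v x = \bigcap_k cylinder [seq (t, x) | t <- grid_times s (v / (2 ^ k)%:R) (2 ^ k)].
Proof.
move=> s0 v_ge0; apply/seteqP; split => w.
  move=> wx k _; apply/allP => z /mapP[t tl ->]; case/mapP: tl => j jk ->.
  move: jk; rewrite mem_iota /= add0n ltnS => jk; apply/eqP/wx.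
  have k0 : (0 : R) < (2 ^ k)%:R by rewrite ltr0n expn_gt0.
  rewrite mulr_ge0 ?divr_ge0 ?ler0n //= mulrAC ler_pdivrMr // ler_wpM2l //.
  by rewrite ler_nat.
move=> H u /andP[u0 uv].
have Hkj k j : (j <= 2 ^ k)%N -> Y (s + v / (2 ^ k)%:R * j%:R) w = x.
  move=> jk; set t := s + _; have /allP/(_ (t, x)) := H k I.
  move=> /(_ _)/eqP; apply; apply: (map_f (fun t => (t, x))).
  by apply: (map_f (fun j => s + v / (2 ^ k)%:R * j%:R)); rewrite mem_iota add0n ltnS.
have [uv'|] := ltP u v; last first.
  move=> vu; have -> : u = v by apply/eqP; rewrite eq_le uv vu.
  by have := Hkj 0%N 1%N (leqnn _); rewrite expn0 mulr1 divr1.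
have v_gt0 : 0 < v by exact: le_lt_trans u0 uv'.
have [e e0 eP] := Y_right w (addr_ge0 s0 u0).
have [k kP] : exists k, v / (2 ^ k)%:R < e.
  exists (Num.truncn (v / e)).+1; rewrite ltr_pdivrMr ?ltr0n ?expn_gt0 // mulrC -ltr_pdivrMr //.
  by apply: lt_trans (truncnS_gt _) _; rewrite ltr_nat ltn_expl.
have k0 : (0 : R) < (2 ^ k)%:R by rewrite ltr0n expn_gt0.
have h0 : 0 < v / (2 ^ k)%:R by rewrite divr_gt0.
set h := v / (2 ^ k)%:R in kP h0.
pose j := Num.truncn (u / h).
have uh0 : 0 <= u / h by rewrite divr_ge0 // ltW.
have /andP[ju uj] := truncn_itv uh0.
have jk : (j < 2 ^ k)%N.
  rewrite -(ltr_nat R); apply: le_lt_trans ju _; rewrite ltr_pdivrMr // mulrC.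
  by rewrite /h divfK ?gt_eqF.
rewrite -(eP (s + h * j.+1%:R)); first exact: Hkj.
rewrite lerD2l -addrA ltrD2l; apply/andP; split.
  by move: uj; rewrite ltr_pdivrMr // mulrC => /ltW.
move: ju; rewrite ler_pdivlMr // mulrC -natr1 mulrDr mulr1 => ju.
by apply: ler_ltD.
Qed.

Lemma measurable_grid s h x N : 0 <= s -> 0 <= h ->
  measurable (cylinder [seq (t, x) | t <- grid_times s h N]).
Proof.
move=> s0 h0; apply: measurable_cylinder; rewrite !all_map; apply/allP => j _ /=.
by rewrite addr_ge0 // mulr_ge0.
Qed.

Variables (lam : state -> R) (La : R).
Hypothesis lam_ge0 : forall x, 0 <= lam x.
Hypothesis p_diag_ge : forall t x, 0 <= t -> expR (- (lam x * t)) <= p t x x.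
Hypothesis p_diag_le : forall t x, 0 <= t -> p t x x <= expR (- (lam x * t)) + (La * t) ^+ 2.

(** The two bounds on p h x x are raised to the power 2^k with h = v / 2^k; the quadratic
error then contributes a factor exp (O (h)). *)
Lemma cvg_diag_power v x : 0 <= v ->
  (fun k => p (v / (2 ^ k)%:R) x x ^+ (2 ^ k)) @ \oo --> expR (- (lam x * v)).
Proof.
move=> v_ge0; pose h k : R := v / (2 ^ k)%:R.
have k0 k : (0 : R) < (2 ^ k)%:R by rewrite ltr0n expn_gt0.
have h0 k : 0 <= h k by rewrite divr_ge0.
have hN k : h k * (2 ^ k)%:R = v by rewrite divfK // gt_eqF.
have ch : h @ \oo --> (0 : R).
  rewrite -[X in _ --> X](mulr0 v); apply: cvgMr.
  apply: (@squeeze_cvgr _ _ _ _ (fun=> 0) (fun m => m.+1%:R^-1)); first last.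
  - exact: cvg_harmonic.
  - exact: cvg_cst.
  apply: nearW => k; rewrite invr_ge0 (ltW (k0 k)) /= lef_pV2 ?posrE ?ltr0n ?expn_gt0 //.
  by rewrite ler_nat ltn_expl.
pose b k := v * La ^+ 2 * h k * expR (lam x * h k).
have cb : (fun k => expR (- (lam x * v)) * expR (b k)) @ \oo --> expR (- (lam x * v)).
  have e : expR (- (lam x * v)) =
      expR (- (lam x * v)) * expR (v * La ^+ 2 * 0 * expR (lam x * 0)).
    by rewrite mulr0 mul0r expR0 mulr1.
  rewrite [X in _ --> X]e; apply: cvgMr.
  apply: continuous_cvg; first exact: continuous_expR.
  apply: cvgM; first by apply: cvgMr.
  by apply: continuous_cvg; [exact: continuous_expR|apply: cvgMr].
apply: (squeeze_cvgr _ (cvg_cst _) cb); apply: nearW => k.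
have e1 : expR (- (lam x * v)) = expR (- (lam x * h k)) ^+ (2 ^ k).
  by rewrite -expRM_natl; congr expR; rewrite -(hN k); ring.
apply/andP; split; first by rewrite e1; apply: lerXn2r; rewrite ?nnegrE ?expR_ge0 ?p_ge0 ?(h0 k) //; exact: (p_diag_ge x (h0 k)).
have e2 : expR (b k) = expR ((La * h k) ^+ 2 * expR (lam x * h k)) ^+ (2 ^ k).
  by rewrite -expRM_natl; congr expR; rewrite /b -(hN k); ring.
rewrite e1 e2 -exprMn; apply: lerXn2r; rewrite ?nnegrE ?p_ge0 ?(h0 k) ?mulr_ge0 ?expR_ge0 //.
apply: le_trans (p_diag_le _ (h0 k)) _.
apply: (@le_trans _ _ (expR (- (lam x * h k)) * (1 + (La * h k) ^+ 2 * expR (lam x * h k)))).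
  rewrite mulrDr mulr1 lerD2l [leRHS](_ : _ = (La * h k) ^+ 2 *
    (expR (- (lam x * h k)) * expR (lam x * h k))); last by ring.
  by rewrite -expRD addNr expR0 mulr1.
by rewrite ler_wpM2l ?expR_ge0 // expR_ge1Dx.
Qed.

Lemma state_holding s v x : 0 <= s -> 0 <= v ->
  P (stays s v x) = (P [set w | Y s w = x] * (expR (- (lam x * v)))%:E)%E.
Proof.
move=> s0 v_ge0.
pose C k := cylinder [seq (t, x) | t <- grid_times s (v / (2 ^ k)%:R) (2 ^ k)].
have mC k : measurable (C k) by apply: measurable_grid => //; rewrite divr_ge0.
have cv1 : (P \o C) @ \oo --> P (stays s v x).
  rewrite stays_dyadic //; apply: nonincreasing_cvg_mu => //.
  - by apply: le_lt_trans (probability_le1 P (mC 0%N)) _; rewrite ltry.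
  - by apply: bigcap_measurable.
  apply/nonincreasing_seqP => k; apply/subsetPset => w.
  move=> /allP H; apply/allP => z /mapP[t tl ->]; case/mapP: tl => j jk ->.
  move: jk; rewrite mem_iota /= add0n ltnS => jk.
  rewrite (_ : s + _ = s + v / (2 ^ k.+1)%:R * (j * 2)%:R); last first.
    by congr (_ + _); rewrite expnSr !natrM; field; rewrite pnatr_eq0 expn_eq0.
  apply: (H (_, x)); apply: (map_f (fun t => (t, x))).
  apply: (map_f (fun j => s + v / (2 ^ k.+1)%:R * j%:R)).
  by rewrite mem_iota /= add0n ltnS expnSr leq_mul2r jk orbT.
have cv2 : (P \o C) @ \oo --> (P [set w | Y s w = x] * (expR (- (lam x * v)))%:E)%E.
  rewrite (_ : P \o C = fun k => (P [set w | Y s w = x] *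
      (p (v / (2 ^ k)%:R) x x ^+ (2 ^ k))%:E)%E); last first.
    by apply/funext => k /=; rewrite /C grid_weight // divr_ge0.
  rewrite state_law //; under eq_fun do rewrite -EFinM.
  rewrite -EFinM; apply: cvg_EFin; first exact: nearW.
  by apply: cvgMr; exact: cvg_diag_power.
exact: (cvg_unique _ cv1 cv2).
Qed.

End markov_chain.

(** * The martingale walk started from a point *)

Section cmrw.
Context d (T : measurableType d) (R : realType) (P : probability T R) (m : nat).
Notation state := 'I_m.+2.
Variables (p : R -> 'M[R]_m.+2) (Y : R -> T -> state).
Variables (i : state -> R) (e0 : R) (v0 : 'rV[R]_m.+2) (lam : state -> R) (La : R).
Hypothesis hi : forall j k : state, (j < k)%N -> i j < i k.
Hypothesis he0 : pos i 0 <= e0 <= pos i m.+1.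
Hypothesis v0P : split_law i e0 v0.
Hypothesis lam_ge0 : forall x, 0 <= lam x.
Hypothesis lam_ext : forall x, ~~ inner_state x -> lam x = 0.
Hypothesis p_ge0 : forall t, 0 <= t -> forall x y, 0 <= p t x y.
Hypothesis p0 : p 0 = 1%:M.
Hypothesis p_mean : forall t x, 0 <= t -> \sum_y p t x y * i y = i x.
Hypothesis p_diag_ge : forall t x, 0 <= t -> expR (- (lam x * t)) <= p t x x.
Hypothesis p_diag_le : forall t x, 0 <= t -> p t x x <= expR (- (lam x * t)) + (La * t) ^+ 2.
Hypothesis p_rate : forall x y, x != y ->
  h^-1 * p h x y @[h --> 0^'+] --> lam x * unit_generator i x y.
Hypothesis mY : forall t z, 0 <= t -> measurable [set w | Y t w = z].
Hypothesis Y_fdd : forall l, chronological 0 l ->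
  P [set w | all (fun x => Y x.1 w == x.2) l] = (path_weight p (v0 0) l)%:E.
Hypothesis Y_right : forall t w, 0 <= t ->
  exists2 e : R, 0 < e & forall v, t <= v < t + e -> Y v w = Y t w.

Local Notation S t z := [set w | Y t w = z].
Local Notation filt := (state_filtration Y).

(** At time 0 the walk sits at e0, and the chain Y gives its position immediately
afterwards. *)
Definition walk (t : R) (w : T) : R := if t == 0 then e0 else i (Y t w).

Let i_inj : injective i.
Proof.
move=> x y xy; apply/val_inj/eqP; rewrite eqn_leq /=; apply/andP; split;
  by rewrite leqNgt; apply/negP => /hi; rewrite xy ltxx.
Qed.

Let v0_ge0 x : 0 <= v0 0 x. Proof. exact: split_ge0 v0P x. Qed.

Let law0 z : P (S 0 z) = (v0 0 z)%:E.
Proof.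
rewrite (state_law Y_fdd) // p0; congr EFin.
rewrite (bigD1 z) //= mxE eqxx mulr1 big1 ?addr0 // => x xz.
by rewrite mxE (negPf xz) mulr0.
Qed.

Lemma state_fun_sum (f : state -> R) t w : f (Y t w) = \sum_z f z * \1_(S t z) w.
Proof.
rewrite (bigD1 (Y t w)) //= indicE mem_set // mulr1 big1 ?addr0 // => z zY.
by rewrite indicE memNset ?mulr0 //= => e; move: zY; rewrite e eqxx.
Qed.

Lemma measurable_state_fun (f : state -> R) t : 0 <= t ->
  measurable_fun setT (fun w => f (Y t w)).
Proof.
move=> t0; under eq_fun do rewrite state_fun_sum; apply: measurable_sum => z.
by apply: measurable_funM => //; exact: measurable_indic (mY z t0).
Qed.

(** A function of the state is a finite combination of indicator functions. *)
Lemma integral_state_fun (f : state -> R) t A : 0 <= t -> measurable A ->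
  (\int[P]_(w in A) (f (Y t w))%:E = \sum_z (f z)%:E * P (A `&` S t z))%E.
Proof.
move=> t0 mA.
have ind z : P.-integrable A (fun w => (\1_(S t z) w)%:E).
  by apply: (integrableS measurableT) => //; exact: integrable_indic (mY z t0).
under eq_integral do rewrite state_fun_sum -sumEFin.
rewrite integral_sum //; last first.
  by move=> z; under eq_fun do rewrite EFinM; exact: integrableZl.
apply: eq_bigr => z _; under eq_integral do rewrite EFinM.
rewrite integralZl // setIC; congr (_ * _)%E.
by rewrite integral_indic //; exact: mY.
Qed.

Lemma integrable_state_fun (f : state -> R) t : 0 <= t ->
  P.-integrable setT (fun w => (f (Y t w))%:E).
Proof.
move=> t0; under eq_fun do rewrite state_fun_sum -sumEFin.
apply: integrable_sum => // z _; under eq_fun do rewrite EFinM.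
by apply: integrableZl => //; exact: integrable_indic (mY z t0).
Qed.

Lemma expectation_cst (c : R) : (\int[P]_(w in setT) c%:E = c%:E)%E.
Proof.
have := @integral_cst _ _ _ P setT measurableT c%:E => /= ->.
by rewrite [X in (_ * X)%E]probability_setT mule1.
Qed.

Lemma walk0 w : walk 0 w = e0.
Proof. by rewrite /walk eqxx. Qed.

Lemma walk_gt0 t w : 0 < t -> walk t w = i (Y t w).
Proof. by move=> t0; rewrite /walk gt_eqF. Qed.

Lemma at_walk_gt0 t x : 0 < t -> at_state walk t (i x) = S t x.
Proof.
move=> t0; apply/seteqP; split => w; rewrite /at_state /= walk_gt0 //; first exact: i_inj.
by move=> ->.
Qed.

Lemma at_walk0 : at_state walk 0 e0 = setT.
Proof. by apply/seteqP; split => w // _; rewrite /at_state /= walk0. Qed.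

Lemma at_walk0_pos x : (0 < P (at_state walk 0 x))%E -> x = e0.
Proof.
move=> Px; apply: contrapT => ne; move: Px; rewrite (_ : at_state walk 0 x = set0).
  by rewrite measure0 ltxx.
by apply/seteqP; split => // w; rewrite /at_state /= walk0 => e; apply: ne.
Qed.

Lemma at_walk_gt0_pos t x A : 0 < t -> (0 < P (A `&` at_state walk t x))%E ->
  exists x', x = i x'.
Proof.
move=> t0 Px; apply: contrapT => ne; move: Px.
rewrite (_ : A `&` at_state walk t x = set0) ?measure0 ?ltxx //.
apply/seteqP; split => // w [_]; rewrite /at_state /= walk_gt0 // => e.
by apply: ne; exists (Y t w).
Qed.

(** At positive times the walk is a function of the chain, and at time 0 it is constant,
so its past contains no more events than that of the chain. *)
Lemma walk_filtration s : 0 < s -> natural_filtration walk s `<=` filt s.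
Proof.
move=> s0; apply: smallest_sub; first exact: smallest_sigma_algebra.
move=> _ [u /andP[u0 us] [B mB ->]].
have [->|une0] := eqVneq u 0.
  have [Be|Be] := pselect (B e0).
    rewrite (_ : _ @^-1` _ = setT); last first.
      by apply/seteqP; split => w // _; rewrite /= walk0.
    by rewrite -setC0; apply: sigma_algebraC; exact: sigma_algebra0.
  rewrite (_ : _ @^-1` _ = set0); first exact: sigma_algebra0.
  by apply/seteqP; split => w //=; rewrite walk0.
have u_gt0 : 0 < u by rewrite lt_neqAle eq_sym une0.
(* The preimage is a countable union over the state numbers; the numbers beyond the
last state contribute the empty set. *)
pose F k := if `[< (k < m.+2)%N /\ B (pos i k) >] then S u (inord k) else set0.
rewrite (_ : _ @^-1` _ = \bigcup_k F k).
  apply: sigma_algebra_bigcup => k; rewrite /F; case: ifP => _; last exact: sigma_algebra0.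
  by apply: sub_sigma_algebra; exists u, (inord k); rewrite u0 us.
apply/seteqP; split => w /=; rewrite walk_gt0 //.
  move=> BY; exists (Y u w) => //; rewrite /F asboolT ?pos_ord //=.
  by rewrite inord_val.
move=> [k _]; rewrite /F; case: ifP => // /asboolP[km Bk] /= ->.
exact: Bk.
Qed.

(** The walk is deterministic at time 0, even though the chain is not. *)
Lemma walk_filtration0 A : natural_filtration walk 0 A -> A = set0 \/ A = setT.
Proof.
move: A; apply: smallest_sub.
  split => [|A|F FP]; first by left.
    by rewrite setTD => -[->|->]; [right; rewrite setC0|left; rewrite setCT].
  have [[k Fk]|no] := pselect (exists k, F k = setT).
    by right; apply/seteqP; split => // w _; exists k => //; rewrite Fk.
  left; apply/seteqP; split => // w [k _]; have [->//|e] := FP k.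
  by exfalso; apply: no; exists k.
move=> _ [u /andP[u0 u0'] [B mB ->]].
have -> : u = 0 by apply/eqP; rewrite eq_le u0' u0.
have [Be|Be] := pselect (B e0); [right|left]; apply/seteqP; split => w //=; rewrite walk0 //.
Qed.

Lemma walk_paths : chain_paths i walk.
Proof.
split.
- move=> t t0; have [->|tne0] := eqVneq t 0.
    rewrite (_ : walk 0 = cst e0); first exact: measurable_cst.
    by apply/funext => w; exact: walk0.
  have t_gt0 : 0 < t by rewrite lt_neqAle eq_sym tne0.
  rewrite (_ : walk t = fun w => i (Y t w)); first exact: measurable_state_fun.
  by apply/funext => w; exact: walk_gt0.
- move=> w; exists (inord 0), (inord m.+1); rewrite walk0; exact: he0.
- by move=> t w t0; exists (Y t w); rewrite walk_gt0.
- move=> t w t0; have [e e_gt0 eP] := Y_right w (ltW t0).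
  apply: cvg_near_cst; near=> u.
  have tu : t < u by near: u; exact: nbhs_right_gt.
  rewrite !walk_gt0 //; last exact: lt_trans tu.
  rewrite eP // (ltW tu) /=; near: u; apply: nbhs_right_lt; by rewrite ltrDl.
- move=> w; have [e e_gt0 eP] := Y_right w (lexx 0).
  apply/cvg_ex; exists (i (Y 0 w)); apply: cvg_near_cst; near=> u.
  have u0 : 0 < u by near: u; exact: nbhs_right_gt.
  rewrite walk_gt0 // eP // (ltW u0) /=; near: u; apply: nbhs_right_lt; by rewrite add0r.
Unshelve. all: by end_near. Qed.

Lemma state_martingale s t A : 0 <= s -> s <= t -> filt s A ->
  (\int[P]_(w in A) (i (Y t w))%:E = \int[P]_(w in A) (i (Y s w))%:E)%E.
Proof.
move=> s0 st As; have t0 := le_trans s0 st.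
have mA := sub_state_filtration mY s0 As.
rewrite !integral_state_fun //.
under eq_bigr => y _.
  rewrite (measure_fibers P (measurableI _ _ mA (mY y t0)) (fun x => mY x s0)).
  rewrite (eq_bigr (fun x => (p (t - s) x y)%:E * P (A `&` S s x))%E); last first.
    move=> x _; have h0 : 0 <= t - s by rewrite subr_ge0.
    have := state_markov p_ge0 mY Y_fdd x y s0 h0 As.
    rewrite (addrC s) subrK => <-; congr (P _).
    by rewrite -setIA [S t y `&` _]setIC.
  over.
have fin x : P (A `&` S s x) \is a fin_num.
  by apply: fin_num_measure; apply: measurableI => //; exact: mY.
under eq_bigr => y _.
  rewrite (eq_bigr (fun x => (p (t - s) x y * fine (P (A `&` S s x)))%:E)).
    rewrite sumEFin -EFinM; over.
  by move=> x _; rewrite EFinM fineK.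
rewrite sumEFin.
under [RHS]eq_bigr do rewrite -(fineK (fin _)) -EFinM.
rewrite sumEFin; congr EFin.
under eq_bigr do rewrite mulr_sumr.
rewrite exchange_big /=; apply: eq_bigr => x _.
rewrite -(p_mean x (_ : 0 <= t - s)) ?subr_ge0 // mulr_suml; apply: eq_bigr => y _.
by rewrite mulrA [i y * _]mulrC.
Qed.

(** At positive times this is harmonicity of the identity under p.  From time 0 to time t it
uses in addition that the jump at time 0 has mean e0. *)
Lemma walk_martingale : martingale P walk.
Proof.
split.
  move=> t t0; have [->|tne0] := eqVneq t 0.
    rewrite (_ : _ \o _ = EFin \o cst e0).
      exact: finite_measure_integrable_cst.
    by apply/funext => w /=; rewrite walk0.
  have t_gt0 : 0 < t by rewrite lt_neqAle eq_sym tne0.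
  rewrite (_ : _ \o _ = fun w => (i (Y t w))%:E); first exact: integrable_state_fun.
  by apply/funext => w /=; rewrite walk_gt0.
move=> s t A s0 st As.
have [->|] := eqVneq s t; first by [].
move=> sne; have s_t : s < t by rewrite lt_neqAle sne.
have t0 : 0 < t by exact: le_lt_trans s_t.
have e1 B : (\int[P]_(w in B) (walk t w)%:E = \int[P]_(w in B) (i (Y t w))%:E)%E.
  by apply: eq_integral => w _; rewrite walk_gt0.
rewrite e1; have [s00|sne0] := eqVneq s 0; last first.
  have s_gt0 : 0 < s by rewrite lt_neqAle eq_sym sne0.
  rewrite (@state_martingale s) //; last exact: walk_filtration.
  by apply: eq_integral => w _; rewrite walk_gt0.
subst s; have [->|->] := walk_filtration0 As; first by rewrite !integral_set0.
rewrite (@state_martingale 0) ?(ltW t0) //; last first.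
  by rewrite -setC0; apply: sigma_algebraC; exact: sigma_algebra0.
rewrite integral_state_fun //; under [RHS]eq_integral do rewrite walk0.
rewrite expectation_cst.
under eq_bigr do rewrite setTI law0 -EFinM.
rewrite sumEFin; congr EFin; rewrite -(split_mean v0P).
by apply: eq_bigr => z _; rewrite mulrC.
Qed.


Lemma cprob_eq (A B : set T) (q : R) : measurable B -> (0 < P B)%E ->
  P (A `&` B) = (q%:E * P B)%E -> cprob P A B = q.
Proof.
move=> mB B0; rewrite /cprob => ->.
have Bfin : P B \is a fin_num by exact: fin_num_measure.
have Bn0 : fine (P B) != 0 by rewrite gt_eqF // fine_gt0 // B0 ltey_eq Bfin.
by rewrite fineM // mulfK.
Qed.

Lemma state_law0 x : e0 = i x -> P (S 0 x) = 1%E.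
Proof. by move=> ex; rewrite law0 (split_state v0P ex). Qed.

Lemma at_walk_out t y : 0 < t -> (forall y', y <> i y') -> at_state walk t y = set0.
Proof.
move=> t0 yS; apply/seteqP; split => // w; rewrite /at_state /= walk_gt0 // => e.
exact: (yS (Y t w)).
Qed.

Lemma measurable_at_walk t x : 0 <= t -> measurable (at_state walk t x).
Proof.
move=> t0; rewrite (_ : at_state _ _ _ = setT `&` walk t @^-1` [set x]); last first.
  by apply/seteqP; split => w //= [].
by have [H _ _ _ _] := walk_paths; exact: H.
Qed.

Lemma walk_filtration_measurable s A : 0 <= s -> natural_filtration walk s A -> measurable A.
Proof.
rewrite le_eqVlt => /predU1P[<-|s0].
  by move=> /walk_filtration0[] ->.
by move=> /(walk_filtration s0); apply: sub_state_filtration => //; exact: ltW.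
Qed.

Lemma walk_filtrationT s : natural_filtration walk s setT.
Proof. by rewrite -setC0; apply: sigma_algebraC; exact: sigma_algebra0. Qed.

(** Conditioning on the past at a positive time is the Markov property of the chain.  At
time 0 the walk is known to be at e0; when e0 is a state, the chain starts from the
point mass there, and the formula persists. *)
Lemma walk_transition s h x y A : 0 <= s -> 0 <= h -> natural_filtration walk s A ->
  (0 < P (A `&` at_state walk s (i x)))%E ->
  cprob P (at_state walk (s + h) (i y)) (A `&` at_state walk s (i x)) = p h x y.
Proof.
move=> s0 h0 As Apos; apply: cprob_eq => //.
  apply: measurableI; first exact: walk_filtration_measurable As.
  exact: measurable_at_walk.
have [s00|sne0] := eqVneq s 0; last first.
  have s_gt0 : 0 < s by rewrite lt_neqAle eq_sym sne0.
  rewrite !at_walk_gt0 //; last by rewrite ltr_wpDr.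
  have := state_markov p_ge0 mY Y_fdd x y s0 h0 (walk_filtration s_gt0 As).
  by move=> <-; congr (P _); rewrite setIC -setIA.
subst s; rewrite add0r.
have [AE|AE] := walk_filtration0 As; first by move: Apos; rewrite AE set0I measure0 ltxx.
move: Apos; rewrite AE !setTI => /at_walk0_pos ex.
rewrite ex at_walk0 setIT probability_setT mule1.
have [h00|hne0] := eqVneq h 0.
  rewrite h00 p0 mxE; have [<-|xy] := eqVneq x y.
    by rewrite ex at_walk0 probability_setT.
  rewrite (_ : at_state _ _ _ = set0) ?measure0 //.
  apply/seteqP; split => // w; rewrite /at_state /= walk0 -ex => /i_inj e.
  by rewrite e eqxx in xy.
rewrite at_walk_gt0; last by rewrite lt_neqAle eq_sym hne0.
have filt0 : filt 0 setT by rewrite -setC0; apply: sigma_algebraC; exact: sigma_algebra0.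
have := state_markov p_ge0 mY Y_fdd x y (lexx 0) h0 filt0.
rewrite !setTI state_law0 // mule1 add0r => <-.
rewrite (measure_fibers P (mY y h0) (fun x => mY x (lexx 0))) (bigD1 x) //=.
rewrite big1 ?adde0; first by rewrite setIC.
move=> z zx; apply/eqP; rewrite eq_le measure_ge0 andbT.
have z0 : v0 0 z = 0.
  have := split_sum1 v0P; rewrite (bigD1 x) //= (split_state v0P) //.
  rewrite -[RHS]addr0 => /addrI/eqP; rewrite psumr_eq0 // => /allP/(_ z).
  by rewrite mem_index_enum zx => /(_ isT)/eqP.
have <- : P (S 0 z) = 0%E by rewrite law0 z0.
by apply: le_measure; rewrite ?inE //; [apply: measurableI|]; exact: mY.
Qed.

Lemma walk_transition_at s h x y : 0 <= s -> 0 <= h ->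
  (0 < P (at_state walk s (i x)))%E ->
  cprob P (at_state walk (s + h) (i y)) (at_state walk s (i x)) = p h x y.
Proof.
move=> s0 h0 sx; rewrite -[at_state walk s _]setTI; apply: walk_transition => //.
  exact: walk_filtrationT.
by rewrite setTI.
Qed.

Lemma walk_markov : markov P walk.
Proof.
move=> s h x y A s0 h0 As Apos.
have [s00|sne0] := eqVneq s 0.
  subst s; have [AE|AE] := walk_filtration0 As; last by rewrite AE setTI.
  by move: Apos; rewrite AE set0I measure0 ltxx.
have s_gt0 : 0 < s by rewrite lt_neqAle eq_sym sne0.
have [x' ex] := at_walk_gt0_pos s_gt0 Apos.
have [[y' ey]|yS] := pselect (exists y', y = i y'); last first.
  rewrite at_walk_out ?ltr_wpDr //; last by move=> y' e; apply: yS; exists y'.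
  by rewrite /cprob !set0I measure0 !mul0r.
rewrite ex ey in Apos *; rewrite (walk_transition _ s0 h0 As Apos).
have sub : (0 < P (setT `&` at_state walk s (i x')))%E.
  rewrite setTI; apply: lt_le_trans Apos _; apply: le_measure; rewrite ?inE.
  - apply: measurableI; first exact: walk_filtration_measurable As.
    exact: measurable_at_walk.
  - exact: measurable_at_walk.
  - by move=> w [].
by rewrite walk_transition_at // -[at_state _ _ _]setTI.
Qed.

Lemma walk_time_homogeneous : time_homogeneous P walk.
Proof.
move=> s s' h x y s0 s'0 h0 sx s'x.
have [[x' ex]|xS] := pselect (exists x', x = i x'); last first.
  have eq0 u : 0 <= u -> (0 < P (at_state walk u x))%E -> u = 0.
    rewrite le_eqVlt => /predU1P[<- //|u0]; rewrite at_walk_out ?measure0 ?ltxx //.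
    by move=> x' e; apply: xS; exists x'.
  by rewrite (eq0 s) // (eq0 s').
have [[y' ey]|yS] := pselect (exists y', y = i y').
  by subst x y; rewrite !walk_transition_at.
suff out u : 0 <= u -> (0 < P (at_state walk u x))%E -> at_state walk (u + h) y = set0.
  by rewrite !out // /cprob !set0I measure0 !mul0r.
move=> u0 ux; have [uh|] := ltP 0 (u + h).
  by apply: at_walk_out => // y' e; apply: yS; exists y'.
move=> uh; have u00 : u = 0 by lra.
have h00 : h = 0 by lra.
subst u h; rewrite addr0; apply/seteqP; split => // w; rewrite /at_state /= walk0 => e.
by apply: yS; exists x'; rewrite -e -(at_walk0_pos ux).
Qed.

(** At time 0 the walk and the chain may differ, but staying at e0 on (0, v] forces the
chain to start there by right continuity. *)
Lemma walk_holding j s v : 0 <= s -> 0 <= v -> (0 < P (at_state walk s (i j)))%E ->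
  cprob P (stays_at walk s v (i j)) (at_state walk s (i j)) = expR (- (lam j * v)).
Proof.
move=> s0 v_ge0 sj; apply: cprob_eq => //; first exact: measurable_at_walk.
rewrite setIidl; last first.
  by move=> w /(_ 0); rewrite lexx v_ge0 addr0; exact.
have hold u := @state_holding _ _ _ P _ p (v0 0) Y p_ge0 mY Y_fdd Y_right lam La
  p_diag_ge p_diag_le u v j.
have [s00|sne0] := eqVneq s 0; last first.
  have s_gt0 : 0 < s by rewrite lt_neqAle eq_sym sne0.
  rewrite at_walk_gt0 // muleC -hold //; congr (P _); apply/seteqP.
  split => w H u uv; have := H u uv; have /andP[u0 _] := uv;
    rewrite walk_gt0 ?ltr_wpDr //; [exact: i_inj|by move=> ->].
subst s; have ex := at_walk0_pos sj; rewrite ex at_walk0 probability_setT mule1.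
have [v0'|vne0] := eqVneq v 0.
  rewrite v0' mulr0 oppr0 expR0 (_ : stays_at _ _ _ _ = setT) ?probability_setT //.
  apply/seteqP; split => w // _ u u0; have -> : u = 0 by lra.
  by rewrite addr0 walk0.
have v_gt0 : 0 < v by rewrite lt_neqAle eq_sym vne0.
have := hold 0 (lexx 0) v_ge0; rewrite state_law0 // mul1e => <-; congr (P _).
apply/seteqP; split => w H u uv; have /andP[u0 uv'] := uv; rewrite add0r; last first.
  have [->|une0] := eqVneq u 0; first by rewrite walk0.
  by rewrite walk_gt0 ?lt_neqAle ?(eq_sym 0) ?une0 // -ex -(H u uv) add0r.
have pos_case u' : 0 < u' <= v -> Y u' w = j.
  move=> /andP[u'0 u'v]; apply: i_inj; rewrite -walk_gt0 // -[u']add0r ex.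
  by apply: H; rewrite ltW.
have [->|une0] := eqVneq u 0; last by apply: pos_case; rewrite lt_neqAle eq_sym une0 u0.
have [e e_gt0 eP] := Y_right w (lexx 0).
pose u' := Num.min v (e / 2).
have u'0 : 0 < u' by rewrite lt_min v_gt0 divr_gt0.
rewrite -(eP u'); first by apply: pos_case; rewrite u'0 ge_min lexx.
rewrite (ltW u'0) add0r; have : u' <= e / 2 by rewrite ge_min lexx orbT.
lra.
Qed.

Lemma walk_rate j k s : j != k -> 0 <= s -> (0 < P (at_state walk s (i j)))%E ->
  h^-1 * cprob P (at_state walk (s + h) (i k)) (at_state walk s (i j))
      @[h --> 0^'+] --> lam j * unit_generator i j k.
Proof.
move=> jk s0 sj; apply: cvg_trans (p_rate jk); apply: near_eq_cvg; near=> h.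
have h0 : 0 < h by near: h; exact: nbhs_right_gt.
by rewrite walk_transition_at // ltW.
Unshelve. all: by end_near. Qed.

Lemma jumps_at_0_to_walk j : jumps_at_0_to walk (i j) = S 0 j.
Proof.
have lim w : walk u w @[u --> 0^'+] --> i (Y 0 w).
  have [e e_gt0 eP] := Y_right w (lexx 0).
  apply: cvg_near_cst; near=> u.
  have u0 : 0 < u by near: u; exact: nbhs_right_gt.
  rewrite walk_gt0 // eP // (ltW u0) /=; near: u; apply: nbhs_right_lt; by rewrite add0r.
apply/seteqP; split => w /=; last by move=> <-; exact: lim.
move=> jump; apply: i_inj; exact: (cvg_unique _ (lim w) jump).
Unshelve. all: by end_near. Qed.

Lemma walk_initial (f : R -> R) j B : measurable B -> (B e0 -> v0 0 j = f e0) ->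
  P (jumps_at_0_to walk (i j) `&` walk 0 @^-1` B) =
  (\int[P]_(w in walk 0%R @^-1` B) (f (walk 0%R w))%:E)%E.
Proof.
move=> mB fe; rewrite jumps_at_0_to_walk.
have [Be|Be] := pselect (B e0).
  rewrite (_ : walk 0 @^-1` B = setT); last first.
    by apply/seteqP; split => w // _; rewrite /= walk0.
  rewrite setIT law0 fe //; under eq_integral do rewrite walk0.
  by rewrite expectation_cst.
rewrite (_ : walk 0 @^-1` B = set0) ?setI0 ?measure0 ?integral_set0 //.
by apply/seteqP; split => w //=; rewrite walk0.
Qed.

Theorem walk_CMRW : CMRW P i walk.
Proof.
split; [exact: walk_paths|exact: walk_martingale|exact: walk_markov|
  exact: walk_time_homogeneous|exists lam].
have nbr (l j k : state) : j = l.+1 :> nat -> k = j.+1 :> nat ->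
    [/\ inner_state j, pos i j.-1 = i l & pos i j.+1 = i k].
  move=> jl kj; split; last by rewrite -kj pos_ord.
    by rewrite /inner_state; have := ltn_ord k; lia.
  by rewrite jl pos_ord.
split.
- exact: lam_ge0.
- by move=> j j0; apply: lam_ext; rewrite /inner_state j0.
- by move=> j /= jM; apply: lam_ext; rewrite /inner_state jM ltnn ?andbF.
- exact: walk_holding.
- move=> l j k s jl kj s0 sj; have [jin pl pk] := nbr l j k jl kj.
  rewrite (_ : _ * lam j = lam j * unit_generator i j k).
    by apply: walk_rate => //; apply/eqP => e; move: kj; rewrite e; lia.
  rewrite mxE jin /up pl pk pos_ord mulrC -kj eqxx.
  rewrite (_ : (k == j.-1 :> nat) = false); last by apply/eqP; lia.
  rewrite (_ : (k == j) = false); last by apply/eqP => e; move: kj; rewrite e; lia.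
  by rewrite mulr1 mulr0 addr0 subr0.
- move=> l j k s jl kj s0 sj; have [jin pl pk] := nbr l j k jl kj.
  rewrite (_ : _ * lam j = lam j * unit_generator i j l).
    by apply: walk_rate => //; apply/eqP => e; move: jl; rewrite e; lia.
  rewrite mxE jin /down pl pk pos_ord mulrC.
  rewrite (_ : (l == j.+1 :> nat) = false); last by apply/eqP; lia.
  rewrite (_ : (l == j.-1 :> nat) = true); last by apply/eqP; lia.
  rewrite (_ : (l == j) = false); last by apply/eqP => e; move: jl; rewrite e; lia.
  by rewrite mulr0 add0r mulr1 subr0.
- move=> l j B jl mB BI; apply: (walk_initial (f := fun e => (e - i l) / (i j - i l))) => //.
  by move=> /BI; rewrite /= in_itv /= => /(split_mid v0P jl)[].
- move=> l j B jl mB BI; apply: (walk_initial (f := fun e => (i j - e) / (i j - i l))) => //.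
  by move=> /BI; rewrite /= in_itv /= => /(split_mid v0P jl)[].
Qed.

End cmrw.

(** * The uniformized jump matrix *)

Section uniformization.
Variables (R : realType) (m : nat) (i : 'I_m.+2 -> R) (l : 'I_m.+2 -> R).
Hypothesis hi : forall j k : 'I_m.+2, (j < k)%N -> i j < i k.
Hypothesis l_ge0 : forall j, 0 <= l j.
Hypothesis l_ext : forall j, ~~ inner_state j -> l j = 0.

(** The summand 1 keeps the uniformization rate positive when all the rates vanish. *)
Definition total_rate : R := 1 + \sum_j l j.
Definition jump_matrix : 'M[R]_m.+2 := 1%:M + total_rate^-1 *: generator i l.

Local Notation La := total_rate.
Local Notation K := jump_matrix.

Lemma total_rate_gt0 : 0 < La.
Proof. by rewrite ltr_pwDl // sumr_ge0. Qed.

Let La_unit : La \is a GRing.unit.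
Proof. by rewrite unitfE gt_eqF // total_rate_gt0. Qed.

Lemma jump_matrixE j k : K j k = (j == k)%:R + La^-1 * (l j * unit_generator i j k).
Proof. by rewrite /jump_matrix !mxE. Qed.

Lemma jump_matrix_ge0 j k : 0 <= K j k.
Proof.
rewrite jump_matrixE; have [<-|jk] := eqVneq j k; last first.
  rewrite add0r !mulr_ge0 ?invr_ge0 ?(ltW total_rate_gt0) //.
  by rewrite (unit_generator_off hi) // eq_sym.
have /andP[Nge _] := unit_generator_diag i j.
have lLa : La^-1 * l j <= 1.
  rewrite mulrC ler_pdivrMr ?total_rate_gt0 // mul1r /total_rate (bigD1 j) //=.
  by rewrite addrCA lerDl addr_ge0 // sumr_ge0.
have : La^-1 * l j * -1 <= La^-1 * l j * unit_generator i j j.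
  by rewrite ler_wpM2l // mulr_ge0 // invr_ge0 (ltW total_rate_gt0).
by rewrite mulrA mulr1n; move: lLa; set a := La^-1 * l j; set b := a * unit_generator i j j; lra.
Qed.

Lemma jump_matrix_harmonic (f : 'I_m.+2 -> R) j :
  \sum_k unit_generator i j k * f k = 0 -> \sum_k K j k * f k = f j.
Proof.
move=> Nf; under eq_bigr do rewrite jump_matrixE mulrDl -!mulrA.
rewrite big_split /= -!mulr_sumr Nf !mulr0 addr0 (bigD1 j) //= eqxx mul1r.
by rewrite big1 ?addr0 // => k kj; rewrite eq_sym (negPf kj) mul0r.
Qed.

Lemma jump_matrix_sum1 j : \sum_k K j k = 1.
Proof.
rewrite -[RHS](@jump_matrix_harmonic (fun=> 1) j).
  by under [RHS]eq_bigr do rewrite mulr1.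
by under eq_bigr do rewrite mulr1; exact: unit_generator_sum1.
Qed.

Lemma jump_matrix_mean j : \sum_k K j k * i k = i j.
Proof. by apply: jump_matrix_harmonic; exact: unit_generator_mean. Qed.

Lemma jump_matrix_off j k : j != k -> La * K j k = l j * unit_generator i j k.
Proof. by move=> /negPf jk; rewrite jump_matrixE jk add0r mulVKr. Qed.

Lemma jump_matrix_diag j : La * (1 - K j j) = l j.
Proof.
rewrite jump_matrixE eqxx opprD addNKr mulrN mulVKr //.
have [jin|jext] := boolP (inner_state j); last by rewrite l_ext // mul0r oppr0.
have /andP[j0 _] := jin; rewrite mxE jin eqxx.
rewrite (_ : (j == j.+1 :> nat) = false); last by lia.
rewrite (_ : (j == j.-1 :> nat) = false); last by lia.
by rewrite !mulr0 !add0r mulrN mulr1 opprK.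
Qed.

Lemma uniform_inv_resolventE s : uniform_inv_resolvent K La s = inv_resolvent i s l.
Proof.
apply/matrixP => a b; rewrite !mxE -mulr_natr.
by field; rewrite gt_eqF // total_rate_gt0.
Qed.

End uniformization.

(** * Independence on a product space *)

Section product_space.
Context d0 (T0 : measurableType d0) (R : realType) (P0 : probability T0 R).
Context d1 (T1 : measurableType d1) (P1 : probability T1 R).

Local Notation Pr := (P0 \x P1)%E.

Lemma product_snd A : measurable A -> Pr (snd @^-1` A) = P1 A.
Proof.
move=> mA; rewrite (_ : _ @^-1` _ = setT `*` A); last first.
  by apply/seteqP; split => w //= [].
by rewrite product_measure1E // [X in (X * _)%E](@probability_setT _ T0 R P0) mul1e.
Qed.

Lemma product_fst A : measurable A -> Pr (fst @^-1` A) = P0 A.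
Proof.
move=> mA; rewrite (_ : _ @^-1` _ = A `*` setT); last first.
  by apply/seteqP; split => w //= [].
by rewrite product_measure1E // [X in (_ * X)%E](@probability_setT _ T1 R P1) mule1.
Qed.

(** The events observed through the second coordinate form a sigma-algebra of
preimages. *)
Lemma process_snd (X : R -> T1 -> R) A : (forall t, 0 <= t -> measurable_fun setT (X t)) ->
  process_sigma_algebra (fun t (w : T0 * T1) => X t w.2) A ->
  exists2 A1, measurable A1 & A = snd @^-1` A1.
Proof.
move=> mX; move: A; apply: smallest_sub.
  split.
  - by exists set0 => //; rewrite preimage_set0.
  - move=> _ [A mA ->]; exists (~` A); first exact: measurableC.
    by rewrite setTD preimage_setC.
  - move=> F FP.
    have ex k : exists A, measurable A /\ F k = snd @^-1` A by have [A] := FP k; exists A.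
    have [G GP] := choice ex.
    exists (\bigcup_k G k); first by apply: bigcupT_measurable => k; have [] := GP k.
    by rewrite preimage_bigcup; apply: eq_bigcup => // k _; have [] := GP k.
move=> _ [u u0 [B mB ->]]; exists (X u @^-1` B) => //.
by rewrite -[X u @^-1` _]setTI; exact: mX.
Qed.

Lemma product_independent (X : R -> T1 -> R) (tau : T0 -> R) :
  (forall t, 0 <= t -> measurable_fun setT (X t)) -> measurable_fun setT tau ->
  independent_process_time Pr (fun t (w : T0 * T1) => X t w.2) (tau \o fst).
Proof.
move=> mX mtau A B /(process_snd mX)[A1 mA1 ->] mB.
have mtB : measurable (tau @^-1` B) by rewrite -[_ @^-1` _]setTI; exact: mtau.
rewrite (_ : _ `&` _ = (tau @^-1` B) `*` A1); last by apply/seteqP; split => w /= [].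
rewrite [LHS]product_measure1E // muleC; congr (_ * _)%E; apply/esym.
  exact: product_snd.
exact: (product_fst mtB).
Qed.

End product_space.

(** * The embedding *)

Section erlang_embedding.
Variables (R : realType) (m : nat) (i : 'I_m.+2 -> R).
Hypothesis hi : forall j k : 'I_m.+2, (j < k)%N -> i j < i k.
Variables (e0 : R) (v0 : 'rV[R]_m.+2) (l : 'I_m.+2 -> R) (q : nat) (t : R).
Hypothesis he0 : pos i 0 <= e0 <= pos i m.+1.
Hypothesis v0P : split_law i e0 v0.
Hypothesis l_ge0 : forall j, 0 <= l j.
Hypothesis l_ext : forall j, ~~ inner_state j -> l j = 0.
Hypothesis t0 : 0 < t.
Context d0 (T0 : measurableType d0) (P0 : probability T0 R) (tau : {RV P0 >-> R}).
Hypothesis tau_ge0 : forall w, 0 <= tau w.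
Hypothesis tau_density : has_density P0 tau (gamma_time_pdf q.+1 t).

Local Notation La := (total_rate l).
Local Notation K := (jump_matrix i l).
Local Notation p := (transition K La).
Local Notation Om := (measurableTypeR R).
Local Notation P1 := (@unit_lebesgue R).
Local Notation Y := (chain p (v0 0)).
Local Notation Pr := (P0 \x P1)%E.

Let La0 : 0 <= La. Proof. exact/ltW/total_rate_gt0. Qed.
Let K_ge0 := jump_matrix_ge0 hi l_ge0.
Let K_sum1 := jump_matrix_sum1 l hi.
Let p_ge0 s : 0 <= s -> forall x y, 0 <= p s x y.
Proof. by move=> s0 x y; exact: transition_ge0. Qed.
Let p_sum1 s : 0 <= s -> forall x, \sum_y p s x y = 1.
Proof. by move=> s0 x; exact: transition_sum1. Qed.
Let p0 : p 0 = 1%:M. Proof. exact: transition0. Qed.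
Let pD s u : 0 <= s -> 0 <= u -> p (s + u) = p s *m p u.
Proof. exact: transitionD. Qed.
Let p_stay s x : 0 <= s -> 1 - La * s <= p s x x.
Proof. exact: transition_stay. Qed.
Let p_lip s h x y : 0 <= s -> 0 <= h -> `|p (s + h) x y - p s x y| <= La * h.
Proof. exact: transition_lipschitz. Qed.
Let v0_ge0 := split_ge0 v0P.
Let v0_sum1 := split_sum1 v0P.

Let mY s z : 0 <= s -> measurable [set u : Om | Y s u = z].
Proof. exact: (measurable_chain p_ge0 p_sum1 pD v0_ge0 v0_sum1). Qed.

Let Y_fdd c : chronological 0 c -> measurable (visits p (v0 0) c) /\
  P1 (visits p (v0 0) c) = (path_weight p (v0 0) c)%:E.
Proof. exact: (chain_fdd p_ge0 p_sum1 p0 pD La0 p_stay p_lip v0_ge0 v0_sum1). Qed.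

Definition embedding : R -> T0 * Om -> R := walk (fun s w => Y s w.2) i e0.

(** The walk is needed twice, on the product space and on the factor carrying the chain. *)
Lemma walk_on d (T : measurableType d) (P : probability T R) (Z : R -> T -> 'I_m.+2) :
  (forall s z, 0 <= s -> measurable [set w | Z s w = z]) ->
  (forall c, chronological 0 c ->
     P [set w | all (fun x => Z x.1 w == x.2) c] = (path_weight p (v0 0) c)%:E) ->
  (forall s w, 0 <= s -> exists2 e : R, 0 < e & forall v, s <= v < s + e -> Z v w = Z s w) ->
  CMRW P i (walk Z i e0).
Proof.
move=> mZ Z_fdd Z_right.
apply: (@walk_CMRW _ _ _ P m (transition K La) Z i e0 v0 l La) => //.
- by move=> s x s0; apply: transition_harmonic => // y; exact: jump_matrix_mean.
- by move=> s x s0; rewrite -(jump_matrix_diag i l_ge0 l_ext); exact: transition_diag_ge.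
- by move=> s x s0; rewrite -(jump_matrix_diag i l_ge0 l_ext); exact: transition_diag_le.
- by move=> x y xy; rewrite -(jump_matrix_off i l_ge0) //; exact: transition_rate.
Qed.

Lemma embedding_CMRW : CMRW Pr i embedding.
Proof.
apply: walk_on.
- move=> s z s0; rewrite (_ : [set w | _] = setT `*` [set u : Om | Y s u = z]).
    by apply: measurableX => //; exact: mY.
  by apply/seteqP; split => w //= [].
- by move=> c /Y_fdd[mc <-]; rewrite -(product_snd P0 P1 mc).
- by move=> s w s0; exact: chain_right_constant.
Qed.

Lemma embedding_independent : independent_process_time Pr embedding (tau \o fst).
Proof.
apply: (@product_independent _ _ _ P0 _ _ P1 (walk Y i e0)).
  have [[]] // : CMRW P1 i (walk Y i e0).
  apply: walk_on => // [c /Y_fdd[]//|s w s0]; exact: chain_right_constant.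
exact: measurable_funPT.
Qed.

(** At time 0 the walk is at e0 and not at the state of the chain, so the law at the random
time is computed on the event that it is positive; this event has full measure. *)
Lemma tau_eq0_null : P0 [set w | tau w = 0] = 0%E.
Proof.
have := @tau_density [set 0] (measurable_set1 _).
by rewrite (_ : tau @^-1` [set 0] = [set w | tau w = 0]) // => ->; exact: integral_set1.
Qed.

(** The product measure of an event is the integral over the random time of the measure
of its sections, and the section at time tau w is an event of the chain alone. *)
Lemma embedding_law j :
  Pr [set w | embedding (tau w.1) w = i j] = (erlang_law i (t / q.+1%:R) v0 l q.+1 0 j)%:E.
Proof.
have s0 : 0 < t / q.+1%:R by rewrite divr_gt0.
have resE : uniform_inv_resolvent K La (t / q.+1%:R) = inv_resolvent i (t / q.+1%:R) l.
  exact: uniform_inv_resolventE.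
have -> : erlang_law i (t / q.+1%:R) v0 l q.+1 0 j =
    (v0 *m invmx (uniform_inv_resolvent K La (t / q.+1%:R)) ^+ q.+1) 0 j by rewrite resE.
rewrite -(expectation_transition_erlang K_ge0 K_sum1 La0 t0 tau_ge0 tau_density v0_ge0);
  last by rewrite resE; exact: inv_resolvent_unit.
pose c : \bar R := if e0 == i j then 1%E else 0%E.
transitivity (\int[P0]_w (if tau w == 0%R then c else ((v0 *m p (tau w)) 0 j)%:E))%E.
  apply: eq_integral => w _ /=; have [tw|tw] := eqVneq (tau w) 0.
    rewrite /c; case: ifP => [/eqP ej|/eqP ej].
      rewrite (_ : xsection _ _ = setT); first exact: probability_setT.
      by apply/seteqP; split => u // _; rewrite /xsection /= inE /= tw /embedding /walk eqxx.
    rewrite (_ : xsection _ _ = set0) ?measure0 //.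
    by apply/seteqP; split => u //; rewrite /xsection /= inE /= tw /embedding /walk eqxx.
  rewrite (_ : xsection _ _ = [set u : Om | Y (tau w) u = j]); last first.
    apply/seteqP; split => u; rewrite /xsection /= inE /= /embedding /walk (negPf tw); last by move=> ->.
    move=> ij; apply/val_inj/eqP; rewrite eqn_leq /=; apply/andP; split;
      by rewrite leqNgt; apply/negP => /hi; rewrite ij ltxx.
  rewrite (@state_law _ _ _ P1 m.+1 p (v0 0) Y) //; first by rewrite mxE.
  by move=> c' /Y_fdd[].
apply: ae_eq_integral => //.
- apply: measurable_fun_ifT => //; first by apply: measurable_fun_eqr => //; exact: measurable_funPT.
  exact: (measurable_transition_time K_ge0 K_sum1 La0).
- exact: (measurable_transition_time K_ge0 K_sum1 La0).
- exists [set w | tau w = 0]; split; [|exact: tau_eq0_null|].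
    have := @measurable_funPT _ _ _ _ tau measurableT [set 0] (measurable_set1 _).
    by rewrite setTI.
  move=> w /= H; apply: contrapT => /eqP /negPf tw; apply: H => _; by rewrite tw.
Qed.

End erlang_embedding.

Theorem theorem2p7 (R : realType) (M : nat) (hM : (2 <= M)%N)
    (i : 'I_M -> R) (hi : forall j k : 'I_M, (j < k)%N -> i j < i k)
    (p : 'I_M -> R) (hp : forall j : 'I_M, 0 < p j)
    (hp1 : \sum_(j < M) p j = 1)
    (e0 : R) (he0 : e0 = \sum_(j < M) i j * p j)
    (r : nat) (hr : (1 <= r)%N) (t : R) (ht : 0 < t)
    (d0 : measure_display) (T0 : measurableType d0) (P0 : probability T0 R)
    (tau : {RV P0 >-> R}) (htau0 : forall w : T0, 0 <= tau w)
    (htau : has_density P0 tau (gamma_time_pdf r t)) :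
  exists (d : measure_display) (T : measurableType d) (P : probability T R)
      (proj : T -> T0) (X : R -> T -> R),
    [/\ enlarges P0 P proj,
        CMRW P i X,
        independent_process_time P X (tau \o proj),
        (0 < P (at_state X 0 e0))%E &
        forall j : 'I_M,
          cprob P [set w | X (tau (proj w)) w = i j] (at_state X 0 e0) = p j].
Proof.
case: M hM i hi p hp hp1 he0 => [|[|m]] // _ i hi p hp hp1 he0.
case: r hr htau => // q _ htau.
have s0 : 0 < t / q.+1%:R by rewrite divr_gt0.
have [v0 [l [v0P l_ge0 l_ext lp]]] := exists_split_rates hi hp hp1 he0 q s0.
have e0b := barycenter_bounds hi hp hp1 he0.
have at0 : at_state (embedding i e0 v0 l (T0 := T0)) 0 e0 = setT.
  by apply/seteqP; split => w // _; rewrite /at_state /embedding /= walk0.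
exists _, _, (P0 \x @unit_lebesgue R)%E, fst, (embedding i e0 v0 l (T0 := T0)).
split.
- split; first exact: measurable_fst.
  by move=> A mA; exact: product_fst.
- exact: embedding_CMRW.
- exact: embedding_independent.
- by rewrite at0 [X in (_ < X)%E]probability_setT.
- move=> j; rewrite at0 /cprob setIT [X in _ / fine X]probability_setT divr1.
  have := embedding_law hi v0P l_ge0 ht htau0 htau j.
by rewrite lp => lawE; rewrite [X in fine X]lawE.
Qed.
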